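(* Let $\Omega\subset\mathbb{C}^n$ be a bounded starlike circular domain with $0\in\Omega$ whose Minkowski functional $\rho$ is of class $C^1$ on $\mathbb{C}^n\setminus\{0\}$. Let $\Phi:\mathbb{U}\to\mathbb{C}$ be biholomorphic onto its image with $\Phi(0)=1$, $\Phi'(0)>0$, $\Phi''(0)\in\mathbb{R}$ and $\operatorname{Re}\Phi(\zeta)>0$ for $\zeta\in\mathbb{U}$, and suppose that $$|\Phi''(0)+2(\Phi'(0))^2|\ \ge\ 2\Phi'(0)>0.$$ Let $g:\Omega\to\mathbb{C}$ be holomorphic with $g(0)=1$, and let $G:\Omega\to\mathbb{C}^n$, $G(z)=z\,g(z)$. Suppose that $J_G(z)$ is invertible for every $z\in\Omega$ and that the mapping $z\mapsto J_G^{-1}(z)G(z)$ belongs to $\mathscr{M}_\Phi$. Then for all $z\in\Omega\setminus\{0\}$ $$\left|\left(2\frac{\partial\rho}{\partial z}\frac{D^3G(0)(z^3)}{3!\,\rho^3(z)}\right)^2-\left(2\frac{\partial\rho}{\partial z}\frac{D^2G(0)(z^2)}{2!\,\rho^2(z)}\right)^2\right|\ \le\ (\Phi'(0))^2+\frac{(\Phi'(0))^2}{4}\left(\frac12\frac{\Phi''(0)}{\Phi'(0)}+\Phi'(0)\right)^2 .$$ The bound is sharp: for every such $\Omega$ and $\Phi$ there exist a holomorphic function $g:\Omega\to\mathbb{C}$ with $g(0)=1$, such that for $G(z)=z\,g(z)$ the matrix $J_G(z)$ is invertible for every $z\in\Omega$ and the mapping $z\mapsto J_G^{-1}(z)G(z)$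 belongs to $\mathscr{M}_\Phi$, and a point $z\in\Omega\setminus\{0\}$ for which equality holds.
   Context: $\mathbb{U}$ is the open unit disk in $\mathbb{C}$. Points $z=(z_1,\dots,z_n)'$ of $\mathbb{C}^n$ are column vectors. The Minkowski functional of a bounded starlike circular domain $\Omega$ is the unique continuous function $\rho:\mathbb{C}^n\to\mathbb{R}$ with $\rho(z)\ge 0$, $\rho(z)=0\Leftrightarrow z=0$, $\rho(tz)=|t|\rho(z)$ for $t\in\mathbb{C}$, and $\Omega=\{z:\rho(z)<1\}$. The expression $\frac{\partial\rho}{\partial z}=\frac{\partial\rho(z)}{\partial z}=\left(\frac{\partial\rho(z)}{\partial z_1},\dots,\frac{\partial\rho(z)}{\partial z_n}\right)$ is the row vector of Wirtinger derivatives of $\rho$ at $z$; juxtaposed with a column vector it denotes the matrix product (a complex number). For a holomorphic mapping $G=(G_1,\dots,G_n)'$, $J_G(z)$ is the complex Jacobian matrix at $z$, $J_G^{-1}(z)$ its inverse, and $D^kG(0)(z^k)\in\mathbb{C}^n$ is the $k$-th Fréchet derivative of $G$ at $0$ evaluated at $(z,\dots,z)$; its $j$-th component is $\sum_{p_1,\dots,p_k=1}^n\frac{\partial^kG_j(0)}{\partial z_{p_1}\cdots\partial z_{p_k}}z_{p_1}\cdots z_{p_k}$. $\mathcal{H}(\Omega)$ is the set of holomorphic mappings $\Omega\to\mathbb{C}^n$, $I$ is the identity matrix, and $$\mathscr{M}_\Phi=\left\{p\in\mathcal{H}(\Omega):p(0)=0,\ J_p(0)=I,\ \frac{\rho(z)}{2\frac{\partial\rho}{\partial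 z}p(z)}\in\Phi(\mathbb{U})\ \text{for all } z\in\Omega\setminus\{0\}\right\}.$$ *)

(* Defs.v *)
From HB Require Import structures.
From mathcomp Require Import all_boot all_order all_algebra.
From mathcomp Require Import all_classical all_reals all_analysis.
From mathcomp Require Import complex.

Set Implicit Arguments.
Unset Strict Implicit.
Unset Printing Implicit Defensive.

Import Order.TTheory GRing.Theory Num.Theory numFieldNormedType.Exports.

Local Open Scope ring_scope.
Local Open Scope classical_set_scope.
Local Open Scope complex_scope.

(* R[i] is a numFieldType, but its canonical normed-module structure over
   itself is only found on the alias R[i]^o. *)
HB.instance Definition _ (R : rcfType) := NormedModule.copy R[i] R[i]^o.

Section Holomorphy.
Context {R : realType}.

(* Complex (Fréchet) differentiability at each point of A; only used for
   open A. Mappings are total, and their values outside A are irrelevant. *)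
Definition holomorphic_on (V W : normedModType R[i]) (A : set V)
    (f : V -> W) : Prop :=
  forall z, A z -> differentiable f z.

Definition unit_disk : set R[i] := [set zeta | `|zeta| < 1].

Definition biholomorphic_onto_image (A : set R[i]) (f : R[i] -> R[i]) : Prop :=
  [/\ holomorphic_on A f, open (f @` A) &
      exists2 h : R[i] -> R[i],
        holomorphic_on (f @` A) h & forall z, A z -> h (f z) = z].

End Holomorphy.

Section Domains.
Context {R : realType} {n : nat}.
Implicit Types (Omega : set 'cV[R[i]]_n) (rho : 'cV[R[i]]_n -> R).

Definition starlike Omega : Prop :=
  forall z (t : R), Omega z -> 0 <= t <= 1 -> Omega (t%:C *: z).

Definition circular Omega : Prop :=
  forall z (u : R[i]), Omega z -> `|u| = 1 -> Omega (u *: z).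

Definition bounded_starlike_circular_domain Omega : Prop :=
  [/\ open Omega, connected Omega, bounded_set Omega,
      starlike Omega & circular Omega].

(* The norm on R[i] takes values in R[i], whence the embedding in the
   homogeneity axiom. *)
Definition minkowski_functional Omega rho : Prop :=
  [/\ continuous rho,
      forall z, 0 <= rho z,
      forall z, rho z = 0 <-> z = 0,
      forall (t : R[i]) z, (rho (t *: z))%:C = `|t| * (rho z)%:C &
      Omega = [set z | rho z < 1]].

Definition stdvec (j : 'I_n) : 'cV[R[i]]_n := delta_mx j 0.

(* With z_j = x_j + i y_j, the direction v = stdvec j gives the partial
   derivative in x_j, and v = 'i *: stdvec j the one in y_j. *)
Definition real_line rho (z v : 'cV[R[i]]_n) : R -> R :=
  fun t => rho (z + t%:C *: v).

Definition real_derive rho (v z : 'cV[R[i]]_n) : R :=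
  derive1 (real_line rho z v) 0.

Definition C1_off_origin rho : Prop :=
  forall (j : 'I_n) v, v = stdvec j \/ v = 'i%C *: stdvec j ->
  forall z, z != 0 ->
    derivable (real_line rho z v) 0 1 /\
    {for z, continuous (real_derive rho v)}.

Definition wirtinger rho (z : 'cV[R[i]]_n) : 'rV[R[i]]_n :=
  \row_j (((real_derive rho (stdvec j) z)%:C
           - 'i%C * (real_derive rho ('i%C *: stdvec j) z)%:C) / 2).

Definition wirtinger_mul rho (z v : 'cV[R[i]]_n) : R[i] :=
  (wirtinger rho z *m v) 0 0.

End Domains.

Section Mappings.
Context {R : realType} {n : nat}.
Implicit Types (f : 'cV[R[i]]_n -> R[i]) (G p : 'cV[R[i]]_n -> 'cV[R[i]]_n).

(* The library's jacobian acts on row vectors; for column vectors row i holds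
   the partial derivatives of the i-th component. *)
Definition cjacobian G (z : 'cV[R[i]]_n) : 'M[R[i]]_n :=
  \matrix_(i, j) 'D_(stdvec j) (fun w => G w i 0) z.

Definition iter_partial (s : seq 'I_n) f : 'cV[R[i]]_n -> R[i] :=
  foldr (fun j h => 'D_(stdvec j) h) f s.

(* D^k G(a)(z^k), through its components
   \sum_(p_1, ..., p_k) (d^k G_j / dz_(p_1) ... dz_(p_k))(a) z_(p_1) ... z_(p_k) *)
Definition frechet_pow (k : nat) G (a z : 'cV[R[i]]_n) : 'cV[R[i]]_n :=
  \col_j \sum_(p : k.-tuple 'I_n)
    iter_partial p (fun w => G w j 0) a * \prod_(i < k) z (tnth p i) 0.

Definition class_M (Omega : set 'cV[R[i]]_n) (rho : 'cV[R[i]]_n -> R)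
    (Phi : R[i] -> R[i]) p : Prop :=
  [/\ holomorphic_on Omega p, p 0 = 0, cjacobian p 0 = 1%:M &
      forall z, Omega z -> z != 0 ->
        (Phi @` unit_disk) ((rho z)%:C / (2 * wirtinger_mul rho z (p z)))].

Definition times_id (g : 'cV[R[i]]_n -> R[i]) : 'cV[R[i]]_n -> 'cV[R[i]]_n :=
  fun z => g z *: z.

Definition invjac_mul G : 'cV[R[i]]_n -> 'cV[R[i]]_n :=
  fun z => invmx (cjacobian G z) *m G z.

End Mappings.

(* Main.v *)
Require Import Defs.
From HB Require Import structures.
From mathcomp Require Import all_boot all_order all_algebra.
From mathcomp Require Import all_classical all_reals all_analysis.
From mathcomp Require Import complex.
From mathcomp Require Import ring lra.

(** Fix z in Omega, put z0 = z / rho(z) and restrict g to the complex line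
    through z0: f(s) = g(s z0) for |s| < 1. Since J_G(z) z = (g + Dg(z)z) z for
    G(z) = z g(z), the mapping J_G^-1 G is z multiplied by g / (g + Dg(z)z).
    Euler's identity 2 (drho/dz) z = rho(z) ([wirtinger_mul_self]) then turns
    membership in the class M_Phi into f + s f' = f * (Phi o w) with w
    holomorphic from the disk to itself and w(0) = 0
    ([admissible_subordinate]), and turns the two terms of the inequality into
    b3 = f''(0)/2 and b2 = f'(0) ([lhs_line]).

    Write w(s) = c1 s + c2 s^2 + ..., p = Phi'(0) and q = Phi''(0). Comparing
    Taylor coefficients gives b2 = p c1 and
    2 b3 = p c2 + (q/2 + p^2) c1^2 ([coef_relation]). The bounds |c1| <= 1 and
    |c2| <= 1 - |c1|^2 ([schwarz_coefs]), together with p <= |q/2 + p^2|, give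
    |b2| <= p and |b3| <= |q/2 + p^2| / 2, and the triangle inequality finishes
    the estimate ([coef_bound]).

    For sharpness, let zs maximise |z_j| on the set rho = 1
    ([extremal_vector]), and let l(z) = z_j / zs_j, so that |l| <= rho and
    l(zs) = 1. With K a primitive of (Phi(i s) - 1) / s on the disk, the
    function g = exp (K o l) satisfies g + Dg(z)z = g Phi(i l(z)). On the line
    through zs this is the case w(s) = i s, for which b3^2 and -b2^2 are both
    nonnegative, so that equality holds throughout.

    Holomorphy means complex differentiability at each point, so the function
    theory starts from Goursat's lemma for triangles ([goursat_triangle]),
    which provides primitives on convex sets ([primitive_of_convex]). A
    function k on a punctured disk is pulled back by the exponential; if P is a
    primitive of k (exp x) on a half-plane, P (x + 2 pi i) - P x does not
    depend on x, and letting Re x tend to minus infinity bounds the central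
    value of k by its values on a circle ([circle_mean_le]). Applied to
    difference quotients this gives Cauchy's estimate, with constants that
    depend only on a bound of the function. Hence the difference quotients of a
    holomorphic function of several variables converge uniformly, and its
    directional derivatives are again holomorphic ([derive_differentiable]).
    Applied after a Moebius transformation it gives the maximum principle, and
    from it the Schwarz lemma and its second-coefficient version. *)

Set Implicit Arguments.
Unset Strict Implicit.
Unset Printing Implicit Defensive.

Import Order.TTheory GRing.Theory Num.Theory numFieldNormedType.Exports.

Local Open Scope ring_scope.
Local Open Scope classical_set_scope.
Local Open Scope complex_scope.

(** * The real-valued norm of a complex normed space *)

Section RealNorm.
Context {R : realType}.
Local Notation C := R[i].

(** The norm of a complex normed space takes its values in R[i]; nv is the same
    norm with values in R, where order reasoning is available. *)
Definition nv {V : normedModType C} (v : V) : R := complex.Re `|v|.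

Lemma nvE (V : normedModType C) (v : V) : `|v| = (nv v)%:C.
Proof. by rewrite /nv RRe_real// ger0_real. Qed.

Lemma nv_ge0 (V : normedModType C) (v : V) : 0 <= nv v.
Proof. by rewrite -ler0c -nvE. Qed.

Lemma nvD (V : normedModType C) (u v : V) : nv (u + v) <= nv u + nv v.
Proof. by rewrite -lecR rmorphD /= -!nvE ler_normD. Qed.

Lemma nvN (V : normedModType C) (v : V) : nv (- v) = nv v.
Proof. by rewrite /nv normrN. Qed.

Lemma nvZ (V : normedModType C) (a : C) (v : V) : nv (a *: v) = nv a * nv v.
Proof. by apply: complexI; rewrite rmorphM /= -!nvE normrZ. Qed.

Lemma nvM (a b : C) : nv (a * b) = nv a * nv b.
Proof. by apply: complexI; rewrite rmorphM /= -!nvE normrM. Qed.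

Lemma nvX (a : C) n : nv (a ^+ n) = nv a ^+ n.
Proof. by apply: complexI; rewrite rmorphXn /= -!nvE normrX. Qed.

Lemma nvV (a : C) : nv a^-1 = (nv a)^-1.
Proof. by apply: complexI; rewrite fmorphV /= -!nvE normfV. Qed.

Lemma nv0 (V : normedModType C) : nv (0 : V) = 0.
Proof. by rewrite /nv normr0. Qed.

Lemma nv1 : nv (1 : C) = 1.
Proof. by rewrite /nv normr1. Qed.

Lemma nv_eq0 (V : normedModType C) (v : V) : (nv v == 0) = (v == 0).
Proof. by rewrite -(normr_eq0 v) nvE -(inj_eq (@complexI R)). Qed.

Lemma nv_gt0 (V : normedModType C) (v : V) : (0 < nv v) = (v != 0).
Proof. by rewrite lt_neqAle nv_ge0 andbT eq_sym nv_eq0. Qed.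

Lemma nvB (V : normedModType C) (u v : V) : nv (u - v) = nv (v - u).
Proof. by rewrite -nvN opprB. Qed.

Lemma nv_tri (V : normedModType C) (w u v : V) :
  nv (u - v) <= nv (u - w) + nv (w - v).
Proof. by rewrite -[u - v](subrKA w) nvD. Qed.

Lemma nv_real (x : R) : nv (x%:C : C) = `|x|.
Proof. by rewrite /nv /= expr0n addr0 sqrtr_sqr. Qed.

Lemma nvi : nv ('i : C) = 1.
Proof. by rewrite /nv /= expr0n expr1n add0r sqrtr1. Qed.

Lemma sqr_nv (z : C) : nv z ^+ 2 = complex.Re z ^+ 2 + complex.Im z ^+ 2.
Proof. by rewrite /nv normc_def /= sqr_sqrtr// addr_ge0 ?sqr_ge0. Qed.

Lemma Re_le_nv (z : C) : `|complex.Re z| <= nv z.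
Proof.
by rewrite -ler_sqr ?nnegrE ?nv_ge0// sqr_nv real_normK ?num_real// lerDl sqr_ge0.
Qed.

Lemma Im_le_nv (z : C) : `|complex.Im z| <= nv z.
Proof.
by rewrite -ler_sqr ?nnegrE ?nv_ge0// sqr_nv real_normK ?num_real// lerDr sqr_ge0.
Qed.

Lemma nv_le_ReIm (z : C) : nv z <= `|complex.Re z| + `|complex.Im z|.
Proof.
have h : `|complex.Re z| + `|complex.Im z| \is Num.nneg by rewrite nnegrE addr_ge0.
rewrite -ler_sqr ?nnegrE ?nv_ge0// sqr_nv -(real_normK (num_real (complex.Re z)))
  -(real_normK (num_real (complex.Im z))).
by have := normr_ge0 (complex.Re z); have := normr_ge0 (complex.Im z); nra.
Qed.

Lemma nv_lec (V : normedModType C) (v : V) (r : R) : (`|v| <= r%:C) = (nv v <= r).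
Proof. by rewrite nvE lecR. Qed.

Lemma nv_ltc (V : normedModType C) (v : V) (r : R) : (`|v| < r%:C) = (nv v < r).
Proof. by rewrite nvE ltcR. Qed.

Lemma gt0cP (e : C) : 0 < e -> exists2 r : R, 0 < r & e = r%:C.
Proof.
move=> e0; exists (complex.Re e); first by move: e0; rewrite ltcE => /andP[].
by rewrite RRe_real// gtr0_real.
Qed.

Lemma nbhs_nvP (V : normedModType C) (x : V) (A : set V) :
  nbhs x A <-> exists2 d : R, 0 < d & forall h, nv h < d -> A (x + h).
Proof.
split.
  move=> /nbhs_ballP[e /gt0cP[r r0 ->] hA]; exists r => // h hr.
  by apply: hA; rewrite -ball_normE /= opprD addNKr normrN nv_ltc.
move=> [d d0 hA]; apply/nbhs_ballP; exists d%:C; first by rewrite /= ltcR.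
move=> y; rewrite -ball_normE /= => xy; rewrite -[y](subrKC x); apply: hA.
by rewrite -nv_ltc distrC.
Qed.

Lemma nbhsR_P (x : R) (A : set R) :
  nbhs x A <-> exists2 d : R, 0 < d & forall h, `|h| < d -> A (x + h).
Proof.
split.
  move=> /nbhs_ballP[e e0 hA]; exists e => // h hr.
  by apply: hA; rewrite -ball_normE /= opprD addNKr normrN.
move=> [d d0 hA]; apply/nbhs_ballP; exists d => //.
move=> y; rewrite -ball_normE /= => xy; rewrite -[y](subrKC x); apply: hA.
by rewrite distrC.
Qed.

Lemma open_nvP (V : normedModType C) (A : set V) : open A <->
  forall x, A x -> exists2 d : R, 0 < d & forall h, nv h < d -> A (x + h).
Proof.
rewrite openE; split=> h x /h; first by move/nbhs_nvP.
by move=> ?; apply/nbhs_nvP.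
Qed.

Lemma continuous_nvP (V W : normedModType C) (f : V -> W) x :
  {for x, continuous f} <-> forall e : R, 0 < e ->
  exists2 d : R, 0 < d & forall h, nv h < d -> nv (f (x + h) - f x) < e.
Proof.
split.
  move=> /cvgrPdist_lt h e e0; have := h e%:C; rewrite ltcR => /(_ e0) /nbhs_nvP.
  by move=> [d d0 hd]; exists d => // u /hd /=; rewrite nv_ltc nvB.
move=> h; apply/cvgrPdist_lt => _ /gt0cP[e e0 ->].
apply/nbhs_nvP; have [d d0 hd] := h _ e0; exists d => // u /hd.
by rewrite /= nv_ltc nvB.
Qed.

End RealNorm.

Section Deriv.
Context {R : realType}.
Local Notation C := R[i].

(** Differentiability in a direction as an epsilon-delta statement on real
    norms. *)
Lemma is_derive_nvP (V W : normedModType C) (f : V -> W) x v df :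
  is_derive x v f df <-> forall e : R, 0 < e ->
  exists2 d : R, 0 < d & forall t : C, nv t < d ->
    nv (f (x + t *: v) - f x - t *: df) <= e * nv t.
Proof.
split.
  case=> dfx dfe e e0; have /derivable_nbhs /eqaddoP := dfx.
  move=> /(_ e%:C); rewrite ltcR => /(_ e0) /nbhs_nvP[d d0 hd].
  exists d => // t /hd; rewrite add0r /= dfe.
  rewrite !fctE /= [t *: v + x]addrC opprD addrA.
  by rewrite nvE [`|t|]nvE -rmorphM lecR.
move=> h.
suff H : (fun h : C => h^-1 *: ((f \o shift x) (h *: v) - f x)) @ 0^' --> df.
  by split; [apply/cvg_ex; exists df | apply/cvg_lim].
apply/cvgrPdist_le => _ /gt0cP[e e0 ->].
rewrite near_withinE; apply/nbhs_nvP; have [d d0 hd] := h _ e0.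
exists d => // t; rewrite add0r => /hd /= ht t0.
rewrite nv_lec nvB [t *: v + x]addrC.
rewrite -[df](scalerK t0) -scalerBr nvZ nvV mulrC ler_pdivrMr ?nv_gt0//.
Qed.

Section Rules.
Context {V : normedModType C}.
Implicit Types (f g : V -> C) (x v : V).

Lemma cder_ext f g x v a : is_derive x v f a -> f =1 g -> is_derive x v g a.
Proof. by move=> ? /funext <-. Qed.

Lemma cder_cst (c : C) x v : is_derive x v (fun=> c) 0.
Proof. exact: is_derive_cst. Qed.

Lemma cderD f g x v a b : is_derive x v f a -> is_derive x v g b ->
  is_derive x v (fun z => f z + g z) (a + b).
Proof. by move=> ? ?; exact: is_deriveD. Qed.

Lemma cderB f g x v a b : is_derive x v f a -> is_derive x v g b ->
  is_derive x v (fun z => f z - g z) (a - b).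
Proof. by move=> ? ?; exact: is_deriveB. Qed.

Lemma cderM f g x v a b : is_derive x v f a -> is_derive x v g b ->
  is_derive x v (fun z => f z * g z) (a * g x + f x * b).
Proof.
move=> fa gb; have H : is_derive x v (fun z => f z * g z) (f x *: b + g x *: a).
  exact: (is_deriveM fa gb).
apply: is_derive_eq H _; rewrite -[f x *: b]/(f x * b) -[g x *: a]/(g x * a); ring.
Qed.

Lemma cderZ (c : C) f x v a : is_derive x v f a ->
  is_derive x v (fun z => c * f z) (c * a).
Proof. by move=> ?; exact: is_deriveZ. Qed.

Lemma cderX f x v a n : is_derive x v f a ->
  is_derive x v (fun z => f z ^+ n) (n%:R * f x ^+ n.-1 * a).
Proof.
move=> fa; elim: n => [|n IH].
  by rewrite mul0r mul0r; exact: cder_cst.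
have := cderM fa IH; have -> : (fun z => f z * f z ^+ n) = fun z => f z ^+ n.+1.
  by apply/funext => z; rewrite exprS.
move=> /is_derive_eq; apply; case: n {IH} => [|n]; first by rewrite /= !expr0; ring.
by rewrite /= [n.+2%:R]mulrS [f x ^+ n.+1]exprS; ring.
Qed.

Lemma cderV f x v a : is_derive x v f a -> f x != 0 ->
  is_derive x v (fun z => (f z)^-1) (- a / f x ^+ 2).
Proof.
move=> [fa <-] f0; split; first exact: derivableV.
rewrite deriveV//; rewrite -[_ *: _]/(_ * _); rewrite mulrC mulrN mulNr;
  congr (- (_ * _)).
Qed.

End Rules.

Lemma cder_id (x : C) : is_derive x 1 (fun z => z) 1.
Proof. exact: is_derive_id. Qed.

Lemma cder_comp (V : normedModType C) (f : V -> C) (g : C -> C) x v a b :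
  is_derive x v f a -> is_derive (f x) 1 g b ->
  is_derive x v (fun z => g (f z)) (b * a).
Proof.
move=> /is_derive_nvP hf /is_derive_nvP hg; apply/is_derive_nvP => e e0.
have b0 : 0 < nv b + 1 by rewrite ltr_wpDl ?nv_ge0.
have a0 : 0 < nv a + 1 by rewrite ltr_wpDl ?nv_ge0.
have e1 : 0 < e / (2 * (nv a + 1)) by rewrite divr_gt0// mulr_gt0.
have e2 : 0 < e / (2 * (nv b + 1)) by rewrite divr_gt0// mulr_gt0.
have [d1 d10 h1] := hg _ e1; have [d2 d20 h2] := hf _ e2.
have [d3 d30 h3] := hf _ ltr01.
exists (Num.min d2 (Num.min d3 (d1 / (nv a + 1)))).
  by rewrite !lt_min d20 d30 divr_gt0.
move=> t; rewrite !lt_min => /and3P[/h2 H2 /h3 H3].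
rewrite ltr_pdivlMr// mul1r in H3 * => H1.
set k := f (x + t *: v) - f x in H2 H3 *.
have kl : nv k <= (nv a + 1) * nv t.
  rewrite -[k](subrK (t *: a)); apply: le_trans (nvD _ _) _.
  by rewrite nvZ; move: H3; nra.
have kd : nv k < d1 by apply: le_lt_trans kl _; rewrite mulrC.
have := h1 _ kd; rewrite -[k *: 1]/(k * 1) mulr1 {1}/k (subrKC (f x)) => H4.
have -> : g (f (x + t *: v)) - g (f x) - t *: (b * a) =
  (g (f (x + t *: v)) - g (f x) - k *: b) + b * (k - t *: a).
  by rewrite -[k *: b]/(k * b) -[t *: (b * a)]/(t * (b * a)) -[t *: a]/(t * a);
    ring.
apply: le_trans (nvD _ _) _; rewrite nvM [e in leRHS]splitr mulrDl; apply: lerD.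
  apply: le_trans H4 _; apply: le_trans (_ :
    e / (2 * (nv a + 1)) * ((nv a + 1) * nv t) <= _).
    by rewrite ler_wpM2l// ltW.
  by rewrite le_eqVlt; apply/orP; left; apply/eqP; field; rewrite gt_eqF.
apply: le_trans (_ : (nv b + 1) * (e / (2 * (nv b + 1)) * nv t) <= _).
  by apply: ler_pM; rewrite ?nv_ge0// lerDl.
by rewrite le_eqVlt; apply/orP; left; apply/eqP; field; rewrite gt_eqF.
Qed.

Lemma cder_dir (g : C -> C) (x v b : C) :
  is_derive x 1 g b -> is_derive x v g (b * v).
Proof. by move=> gb; apply: (@cder_comp _ (fun z => z)) gb;
  exact: is_derive_id. Qed.

End Deriv.

(** * Curves in the complex plane: mean value inequality and antiderivatives *)

Section RealCurves.
Context {R : realType}.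
Local Notation C := R[i].

Lemma is_derive_realP (f : R -> R) (x df : R) :
  is_derive x 1 f df <-> forall e : R, 0 < e ->
  exists2 d : R, 0 < d & forall t : R, `|t| < d ->
    `|f (x + t) - f x - t * df| <= e * `|t|.
Proof.
split.
  case=> dfx dfe e e0; have /derivable_nbhs /eqaddoP := dfx.
  move=> /(_ e e0) /nbhsR_P[d d0 hd].
  exists d => // t /hd; rewrite add0r /= dfe.
  by rewrite !fctE /= [_ + x]addrC opprD addrA [t *: 1]mulr1.
move=> h.
suff H : (fun h : R => h^-1 *: ((f \o shift x) (h *: 1) - f x)) @ 0^' --> df.
  by split; [apply/cvg_ex; exists df | apply/cvg_lim].
apply/cvgrPdist_le => e e0.
rewrite near_withinE; apply/nbhsR_P; have [d d0 hd] := h _ e0.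
exists d => // t; rewrite add0r => /hd /= ht t0.
rewrite distrC [t *: 1]mulr1 [t + x]addrC.
rewrite -[df](mulKf t0) -mulrBr normrM normfV mulrC ler_pdivrMr ?normr_gt0//.
Qed.

Lemma continuous_realP (f : R -> R) x :
  {for x, continuous f} <-> forall e : R, 0 < e ->
  exists2 d : R, 0 < d & forall h, `|h| < d -> `|f (x + h) - f x| < e.
Proof.
split.
  move=> /cvgrPdist_lt h e e0; have := h e e0 => /nbhsR_P.
  by move=> [d d0 hd]; exists d => // u /hd /=; rewrite distrC.
move=> h; apply/cvgrPdist_lt => e e0.
apply/nbhsR_P; have [d d0 hd] := h _ e0; exists d => // u /hd.
by rewrite /= distrC.
Qed.

(** The derivative of a curve from R to the complex plane; the plane is a
    normed space over R[i] only, so this is stated directly. *)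
Definition rder (A : R -> C) (t : R) (d : C) := forall e : R, 0 < e ->
  exists2 dl : R, 0 < dl & forall h : R, `|h| < dl ->
    nv (A (t + h) - A t - h%:C * d) <= e * `|h|.

(** Continuity of a curve from R to the complex plane at t. *)
Definition rcont (A : R -> C) (t : R) := forall e : R, 0 < e ->
  exists2 dl : R, 0 < dl & forall h : R, `|h| < dl -> nv (A (t + h) - A t) < e.

(** Real-linear images of a differentiable curve are differentiable real
    functions; the multiplier u selects the direction of projection. *)
Lemma rder_dot (A : R -> C) t d (u : C) : rder A t d ->
  is_derive t 1 (fun s => complex.Re (u * A s)) (complex.Re (u * d)).
Proof.
move=> dA; apply/is_derive_realP => e e0.
have e1 : 0 < e / (nv u + 1) by rewrite divr_gt0// ltr_wpDl ?nv_ge0.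
have [dl dl0 hd] := dA _ e1; exists dl => // h /hd hh.
have -> : complex.Re (u * A (t + h)) - complex.Re (u * A t) - h * complex.Re (u *
  d) =
  complex.Re (u * (A (t + h) - A t - h%:C * d)).
  by case: u {e1 hd hh} => a b; case: (A _) => ? ?; case: (A t) => ? ?;
    case: d {dA} => ? ? /=; ring.
apply: le_trans (Re_le_nv _) _; rewrite nvM.
apply: le_trans (_ : (nv u + 1) * (e / (nv u + 1) * `|h|) <= _).
  by apply: ler_pM => //; rewrite ?nv_ge0// lerDl.
by rewrite mulrA mulrCA mulfV ?mulr1// gt_eqF// ltr_wpDl ?nv_ge0.
Qed.

(** The mean value inequality: projecting onto the direction of A 1 - A 0
    reduces it to the real mean value theorem. *)
Lemma mean_value_le (A : R -> C) (a : R -> C) M :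
  (forall t : R, 0 <= t <= 1 -> rder A t (a t)) ->
  (forall t : R, 0 <= t <= 1 -> nv (a t) <= M) -> nv (A 1 - A 0) <= M.
Proof.
move=> dA aM; set D := A 1 - A 0.
have M0 : 0 <= M by apply: le_trans (aM 0 _); rewrite ?nv_ge0 ?lexx ?ler01.
have [->|D0] := eqVneq D 0; first by rewrite nv0.
pose f s := complex.Re (D^* * A s).
have df (t : R) : 0 <= t <= 1 -> is_derive t 1 f (complex.Re (D^* * a t)).
  by move=> /dA /(rder_dot D^*).
have [|||c c01] := @MVT_segment R f (fun t => complex.Re (D^* * a t)) 0 1.
- exact: ler01.
- by move=> x /[!in_itv] /= /andP[x0 x1]; apply: df; rewrite !ltW.
- apply: derivable_within_continuous => x; rewrite in_itv /= => x01.
  by have [] := df _ x01.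
rewrite subr0 mulr1 /f => E.
have {}E : nv D ^+ 2 = complex.Re (D^* * a c).
  rewrite -E sqr_nv /D; case: (A 1) => ? ?; case: (A 0) => ? ? /=; ring.
have : nv D ^+ 2 <= nv D * M.
  rewrite E; apply: le_trans (ler_norm _) _; apply: le_trans (Re_le_nv _) _.
  rewrite nvM; have -> : nv D^* = nv D by rewrite /nv normcJ.
  by rewrite ler_wpM2l ?nv_ge0// aM//; move: c01; rewrite in_itv.
by rewrite expr2 ler_pM2l// nv_gt0.
Qed.

(** Only continuity at the points of [0, 1] is assumed: f is first precomposed
    with the clamping of R to [0, 1]. *)
Lemma real_antiderivative (f : R -> R) :
  (forall t : R, 0 <= t <= 1 -> {for t, continuous f}) ->
  exists A : R -> R, forall t : R, 0 <= t <= 1 -> is_derive t 1 A (f t).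
Proof.
move=> cf.
(* cl clamps R to [0, 1], so that f o cl is continuous on all of R *)
pose cl (t : R) := if t < 0 then 0 else if 1 < t then 1 else t.
have clb (t : R) : 0 <= cl t <= 1.
  by rewrite /cl; case: ltP => ?; [rewrite lexx ler01|case: ltP => ?; lra].
have cle (t : R) : 0 <= t <= 1 -> cl t = t.
  by move=> /andP[t0 t1]; rewrite /cl ltNge t0 ltNge t1.
have ccl : continuous cl.
  move=> x; apply/continuous_realP => e e0; exists e => // h he.
  apply: le_lt_trans he; have := ler_norm h; have := ler_norm (- h).
  rewrite normrN ler_norml /cl => ? ?.
  by case: (ltP (x + h) 0); case: (ltP 1 (x + h)); case: (ltP x 0);
    case: (ltP 1 x) => *; apply/andP; split; lra.
pose g := f \o cl.
have cg : continuous g.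
  by move=> x; apply: continuous_comp; [exact: ccl|apply: cf; exact: clb].
have ig : (@lebesgue_measure R).-integrable `[-1, 2] (EFin \o g).
  apply: continuous_compact_integrable; first exact: segment_compact.
  exact: continuous_subspaceT.
exists (fun x => \int[lebesgue_measure]_(t in `[-1, x]) g t)%R => t t01.
have [t0 t1] := andP t01.
have [] := @continuous_FTC1_closed R g (-1) t 2 _ ig _ (cg t).
- lra.
- lra.
move=> dA; rewrite derive1E => dE; split => //.
by rewrite dE /g /= cle.
Qed.

Lemma antiderivative (f : R -> C) :
  (forall t : R, 0 <= t <= 1 -> rcont f t) ->
  exists A : R -> C, forall t : R, 0 <= t <= 1 -> rder A t (f t).
Proof.
move=> cf.
have [A hA] : exists A : R -> R, forall t :
  R, 0 <= t <= 1 -> is_derive t 1 A (complex.Re (f t)).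
  apply: real_antiderivative => t /cf ct; apply/continuous_realP => e /ct[d d0 hd].
  exists d => // h /hd; apply: le_lt_trans; rewrite -raddfB; exact: Re_le_nv.
have [B hB] : exists A : R -> R, forall t :
  R, 0 <= t <= 1 -> is_derive t 1 A (complex.Im (f t)).
  apply: real_antiderivative => t /cf ct; apply/continuous_realP => e /ct[d d0 hd].
  exists d => // h /hd; apply: le_lt_trans; rewrite -raddfB; exact: Im_le_nv.
exists (fun t => A t +i* B t) => t t01 e e0.
have e2 : 0 < e / 2 by rewrite divr_gt0.
have /is_derive_realP/(_ _ e2)[d d0 hd] := hA _ t01.
have /is_derive_realP/(_ _ e2)[d' d'0 hd'] := hB _ t01.
exists (Num.min d d'); first by rewrite lt_min d0.
move=> h; rewrite lt_min => /andP[/hd h1 /hd' h2].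
apply: le_trans (nv_le_ReIm _) _.
rewrite [e]splitr mulrDl; apply: lerD.
  by move: h1; case: (f t) => x y /=; rewrite mul0r subr0.
by move: h2; case: (f t) => x y /=; rewrite mul0r addr0.
Qed.

End RealCurves.

(** * Integrals along segments *)

Section Segments.
Context {R : realType}.
Local Notation C := R[i].

Lemma rder_eq (A : R -> C) t d d' : rder A t d -> d = d' -> rder A t d'.
Proof. by move=> ? <-. Qed.

Lemma rderD (A B : R -> C) t a b : rder A t a -> rder B t b ->
  rder (fun s => A s + B s) t (a + b).
Proof.
move=> hA hB e e0; have e2 : 0 < e / 2 by rewrite divr_gt0.
have [d d0 hd] := hA _ e2; have [d' d'0 hd'] := hB _ e2.
exists (Num.min d d'); first by rewrite lt_min d0.
move=> h; rewrite lt_min => /andP[/hd h1 /hd' h2].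
rewrite [e]splitr mulrDl.
have -> : A (t + h) + B (t + h) - (A t + B t) - h%:C * (a + b) =
  (A (t + h) - A t - h%:C * a) + (B (t + h) - B t - h%:C * b) by ring.
by apply: le_trans (nvD _ _) _; apply: lerD.
Qed.

Lemma rderZ (A : R -> C) t a (c : C) : rder A t a ->
  rder (fun s => c * A s) t (c * a).
Proof.
move=> hA e e0; have e2 : 0 < e / (nv c + 1) by rewrite divr_gt0// ltr_wpDl ?nv_ge0.
have [d d0 hd] := hA _ e2; exists d => // h /hd h1.
have -> : c * A (t + h) - c * A t - h%:C * (c * a) =
  c * (A (t + h) - A t - h%:C * a) by ring.
rewrite nvM; apply: le_trans (_ : (nv c + 1) * (e / (nv c + 1) * `|h|) <= _).
  by apply: ler_pM => //; rewrite ?nv_ge0// lerDl.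
by rewrite mulrA mulrCA mulfV ?mulr1// gt_eqF// ltr_wpDl ?nv_ge0.
Qed.

Lemma rderB (A B : R -> C) t a b : rder A t a -> rder B t b ->
  rder (fun s => A s - B s) t (a - b).
Proof.
move=> hA hB; have /= H := rderD hA (rderZ (-1) hB).
have -> : (fun s => A s - B s) = (fun s => A s + -1 * B s).
  by apply/funext => s; ring.
by apply: rder_eq H _; ring.
Qed.

Lemma rder_affine (A : R -> C) t d (s s0 : R) : rder A (s * t + s0) d ->
  rder (fun u => A (s * u + s0)) t (s%:C * d).
Proof.
move=> hA e e0; have e2 : 0 < e / (`|s| + 1) by rewrite divr_gt0// ltr_wpDl.
have [dl d0 hd] := hA _ e2; exists (dl / (`|s| + 1)).
  by rewrite divr_gt0// ltr_wpDl.
move=> h; rewrite ltr_pdivlMr ?ltr_wpDl// => hh.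
have /hd : `|s * h| < dl.
  by rewrite normrM; apply: le_lt_trans hh; rewrite mulrC ler_wpM2l// lerDl.
have -> : s * (t + h) + s0 = s * t + s0 + s * h by ring.
rewrite rmorphM /= mulrA [h%:C * _]mulrC => H; apply: le_trans H _.
rewrite mulrAC ler_pdivrMr ?ltr_wpDl// -mulrA ler_wpM2l ?(ltW e0)//.
by rewrite normrM mulrC ler_wpM2l// lerDl.
Qed.

Lemma rder_line (V : normedModType C) (F : V -> C) (a v : V) (t : R) (d : C) :
  is_derive (a + t%:C *: v) v F d -> rder (fun s => F (a + s%:C *: v)) t d.
Proof.
move=> /is_derive_nvP H e /H[dl d0 hd]; exists dl => // h hh.
have := hd h%:C; rewrite nv_real => /(_ hh).
by rewrite rmorphD /= scalerDl addrA.
Qed.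

(** The integral over [0, 1], as the increment of a chosen antiderivative; the
    value 0 is returned if there is none. By the mean value inequality the
    choice is irrelevant. *)
Definition int01 (f : R -> C) : C :=
  let A := xget (fun=> 0) [set A : R -> C | forall t :
    R, 0 <= t <= 1 -> rder A t (f t)] in
  A 1 - A 0.

Lemma int01E (f A : R -> C) :
  (forall t : R, 0 <= t <= 1 -> rder A t (f t)) -> int01 f = A 1 - A 0.
Proof.
move=> hA; rewrite /int01; set B := xget _ _.
have hB : forall t : R, 0 <= t <= 1 -> rder B t (f t).
  by have /(xgetPex (fun=> 0)) : exists A : R -> C, [set A : R -> C |
    forall t : R, 0 <= t <= 1 -> rder A t (f t)] A by exists A.
have : nv ((B 1 - A 1) - (B 0 - A 0)) <= 0.
  apply: (@mean_value_le _ (fun s => B s - A s) (fun=> 0)) => t t01;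
    last by rewrite nv0.
  by rewrite -[0](subrr (f t)); apply: rderB; [exact: hB|exact: hA].
rewrite le_eqVlt ltNge nv_ge0 orbF nv_eq0 => /eqP E.
by apply/eqP; rewrite -subr_eq0 -[X in _ == X]E; apply/eqP; ring.
Qed.

(** The integral of f along the oriented segment from a to b. *)
Definition seg (f : C -> C) (a b : C) : C :=
  (b - a) * int01 (fun t => f (a + t%:C * (b - a))).

(** f is continuous at each point of the segment from a to b. *)
Definition cont_seg (f : C -> C) (a b : C) :=
  forall t : R, 0 <= t <= 1 -> {for a + t%:C * (b - a), continuous f}.

Lemma segP f a b : cont_seg f a b -> exists2 A : R -> C,
  forall t : R, 0 <= t <= 1 -> rder A t (f (a + t%:C * (b - a))) &
  seg f a b = (b - a) * (A 1 - A 0).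
Proof.
move=> cf.
have [|A hA] := @antiderivative R (fun t : R => f (a + t%:C * (b - a))); last first.
  by exists A => //; rewrite /seg (int01E hA).
move=> t /cf /continuous_nvP ct e /ct[d d0 hd].
exists (d / (nv (b - a) + 1)); first by rewrite divr_gt0// ltr_wpDl ?nv_ge0.
move=> h; rewrite ltr_pdivlMr ?ltr_wpDl ?nv_ge0// => hh.
have -> : a + (t + h)%:C * (b - a) = a + t%:C * (b - a) + h%:C * (b - a).
  by rewrite rmorphD /=; ring.
apply: hd; apply: le_lt_trans hh.
by rewrite nvM nv_real ler_wpM2l// lerDl.
Qed.

Lemma segE (f : C -> C) (A : R -> C) a b :
  (forall t : R, 0 <= t <= 1 -> rder A t (f (a + t%:C * (b - a)))) ->
  seg f a b = (b - a) * (A 1 - A 0).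
Proof. by move=> hA; rewrite /seg (int01E hA). Qed.

Lemma realC2 : (2 : R)%:C = 2 :> C.
Proof. by rewrite (rmorph_nat (real_complex R)). Qed.

Lemma C2neq0 : (2 : C) != 0.
Proof. by rewrite pnatr_eq0. Qed.

Lemma seg_mid f a b : cont_seg f a b ->
  seg f a b = seg f a ((a + b) / 2) + seg f ((a + b) / 2) b.
Proof.
move=> /segP[A hA ->].
have C2 : (2 : C) * 2^-1 = 1 by rewrite mulfV// C2neq0.
have iC : (2^-1 : R)%:C = (2^-1 : C) by rewrite fmorphV /= realC2.
rewrite (@segE f (fun t => 2 * A (2^-1 * t + 0)) a ((a + b) / 2)); last first.
  move=> t t01; apply: rder_eq (rderZ 2 (rder_affine (hA _ _))) _; first lra.
  rewrite mulrA iC C2 mul1r; congr (f _); rewrite rmorphD rmorphM /= iC rmorph0;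
    by field.
rewrite (@segE f (fun t => 2 * A (2^-1 * t + 2^-1)) ((a + b) / 2) b); last first.
  move=> t t01; apply: rder_eq (rderZ 2 (rder_affine (hA _ _))) _; first lra.
  rewrite mulrA iC C2 mul1r; congr (f _); rewrite rmorphD rmorphM /= iC; by field.
rewrite !mulr0 !mulr1 !add0r addr0.
have -> : 2^-1 + 2^-1 = 1 :> R by lra.
by field.
Qed.

Lemma seg_rev f a b : cont_seg f a b -> seg f b a = - seg f a b.
Proof.
move=> /segP[A hA ->].
rewrite (@segE f (fun t => -1 * A (-1 * t + 1))); last first.
  move=> t t01; apply: rder_eq (rderZ (-1) (rder_affine (hA _ _))) _; first lra.
  rewrite mulrA rmorphN rmorph1 mulN1r opprK mul1r; congr (f _).
  by rewrite rmorphD rmorphM /= rmorphN rmorph1; ring.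
by rewrite mulr0 mulr1 add0r addNr; ring.
Qed.

Lemma segB f g a b : cont_seg f a b -> cont_seg g a b ->
  seg (fun z => f z - g z) a b = seg f a b - seg g a b.
Proof.
move=> /segP[A hA ->] /segP[B hB ->].
rewrite (@segE _ (fun t => A t - B t)); last first.
  by move=> t t01; apply: rderB; [exact: hA|exact: hB].
by ring.
Qed.

Lemma seg_le f a b M : cont_seg f a b ->
  (forall t : R, 0 <= t <= 1 -> nv (f (a + t%:C * (b - a))) <= M) ->
  nv (seg f a b) <= nv (b - a) * M.
Proof.
move=> /segP[A hA ->] hM; rewrite nvM ler_wpM2l ?nv_ge0//.
exact: mean_value_le hA hM.
Qed.

(** The integral of a derivative along a segment. *)
Lemma seg_ftc f F a b : cont_seg f a b ->
  (forall t : R, 0 <= t <= 1 ->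
    is_derive (a + t%:C * (b - a)) 1 F (f (a + t%:C * (b - a)))) ->
  seg f a b = F b - F a.
Proof.
move=> /segP[A hA ->] hF.
have : nv (((b - a) * A 1 - F (a + 1%:C * (b - a))) - ((b - a) * A 0 - F (a +
  0%:C * (b - a)))) <= 0.
  apply: (@mean_value_le _ (fun s =>
    (b - a) * A s - F (a + s%:C * (b - a))) (fun=> 0)) => t t01;
      last by rewrite nv0.
  rewrite -[0](subrr ((b - a) * f (a + t%:C * (b - a)))); apply: rderB.
    exact/rderZ/hA.
  apply: (@rder_line _ F a (b - a)); have /is_derive_nvP H := hF _ t01.
  apply/is_derive_nvP => e e0.
  have e2 : 0 < e / (nv (b - a) + 1) by rewrite divr_gt0// ltr_wpDl ?nv_ge0.
  have [d d0 hd] := H _ e2; exists (d / (nv (b - a) + 1)).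
    by rewrite divr_gt0// ltr_wpDl ?nv_ge0.
  move=> u; rewrite ltr_pdivlMr ?ltr_wpDl ?nv_ge0// => hu.
  have /hd : nv (u * (b - a)) < d.
    by rewrite nvM; apply: le_lt_trans hu; rewrite ler_wpM2l ?nv_ge0// lerDl.
  rewrite -[(u * (b - a)) *: 1]/((u * (b - a)) * 1) mulr1.
  rewrite -[_ *: f _]/(_ * f _) -mulrA => H1; apply: le_trans H1 _.
  rewrite mulrAC ler_pdivrMr ?ltr_wpDl ?nv_ge0// -mulrA ler_wpM2l ?(ltW e0)//.
  by rewrite nvM ler_wpM2l ?nv_ge0// lerDl.
rewrite le_eqVlt ltNge nv_ge0 orbF nv_eq0 rmorph1 rmorph0 mul1r mul0r addr0
  (addrC a) subrK => /eqP E.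
by apply/eqP; rewrite -subr_eq0 -[X in _ == X]E; apply/eqP; ring.
Qed.

End Segments.

(** * Goursat's lemma and primitives on convex sets *)

Section Goursat.
Context {R : realType}.
Local Notation C := R[i].

(** A sequence whose terms m and n differ by at most e m + e n has a limit,
    with error e n: the limit is the supremum of x n - e n. *)
Lemma real_cauchy (x e : nat -> R) :
  (forall m n, `|x m - x n| <= e m + e n) ->
  exists l, forall n, `|x n - l| <= e n.
Proof.
move=> h; pose S := [set x n - e n | n in [set: nat]].
have ub m : ubound S (x m + e m).
  move=> _ [n _ <-]; have := h n m; rewrite ler_norml => /andP[_]; lra.
have S0 : S !=set0 by exists (x 0%N - e 0%N), 0%N.
exists (sup S) => n; rewrite ler_norml.
have h1 : sup S <= x n + e n by apply: ge_sup => //; exact: ub.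
have h2 : x n - e n <= sup S.
  by apply: ub_le_sup; [exists (x n + e n); exact: ub|exists n].
by apply/andP; split; lra.
Qed.

Lemma complex_cauchy (x : nat -> C) (e : nat -> R) :
  (forall m n, nv (x m - x n) <= e m + e n) ->
  exists l, forall n, nv (x n - l) <= 2 * e n.
Proof.
move=> h.
have [a ha] : exists l, forall n, `|complex.Re (x n) - l| <= e n.
  by apply: real_cauchy => m n; apply: le_trans (h m n); rewrite -raddfB;
    exact: Re_le_nv.
have [b hb] : exists l, forall n, `|complex.Im (x n) - l| <= e n.
  by apply: real_cauchy => m n; apply: le_trans (h m n); rewrite -raddfB;
    exact: Im_le_nv.
exists (a +i* b) => n; apply: le_trans (nv_le_ReIm _) _.
rewrite mulr2n mulrDl mul1r; apply: lerD.
  by have := ha n; case: (x n).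
by have := hb n; case: (x n).
Qed.

Variable D : set C.
Hypothesis Dconv : forall a b (t :
  R), D a -> D b -> 0 <= t <= 1 -> D (a + t%:C * (b - a)).
Hypothesis Dclosed : forall p, (forall e :
  R, 0 < e -> exists2 a, D a & nv (a - p) < e) -> D p.

Let per (T : C * C * C) := let: (a, b, c) :=
  T in nv (b - a) + nv (c - b) + nv (a - c).
Let inD (T : C * C * C) := let: (a, b, c) := T in [/\ D a, D b & D c].
Let tri (f : C -> C) (T : C * C * C) := let: (a, b, c) := T in
  seg f a b + seg f b c + seg f c a.

Lemma convex_cont_seg f a b : (forall z, D z -> {for z, continuous f}) ->
  D a -> D b -> cont_seg f a b.
Proof. by move=> cf Da Db t t01; apply: cf; exact: Dconv. Qed.

Lemma convex_mid a b : D a -> D b -> D ((a + b) / 2).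
Proof.
move=> Da Db; have -> : (a + b) / 2 = a + (2^-1 : R)%:C * (b - a).
  by rewrite fmorphV /= realC2; field.
by apply: Dconv => //; lra.
Qed.

Lemma realC_half : (2^-1 : R)%:C = (2^-1 : C).
Proof. by rewrite fmorphV /= realC2. Qed.

Lemma nv_half (z : C) : nv (z / 2) = nv z / 2.
Proof. by rewrite nvM -realC_half nv_real ger0_norm// invr_ge0. Qed.

(** Halving the sides cuts a triangle into four similar ones, and one of them
    carries at least a quarter of the boundary integral. *)
Lemma tri_bisect f T : (forall z, D z -> {for z, continuous f}) -> inD T ->
  exists T', [/\ inD T', nv (tri f T) <= 4 * nv (tri f T'), per T' = per T / 2 &
    nv (T'.1.1 - T.1.1) <= per T].
Proof.
move=> cf; case: T => [[a b] c] [Da Db Dc].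
set x := (a + b) / 2; set y := (b + c) / 2; set z := (c + a) / 2.
have Dx : D x by exact: convex_mid.
have Dy : D y by exact: convex_mid.
have Dz : D z by exact: convex_mid.
have cs u v : D u -> D v -> cont_seg f u v by move=> *; exact: convex_cont_seg.
have E : tri f (a, b, c) = tri f (a, x, z) + tri f (x, b, y) + tri f (z, y,
  c) + tri f (y, z, x).
  rewrite /tri (seg_mid (cs _ _ Da Db)) (seg_mid (cs _ _ Db Dc)) (seg_mid (cs _ _
    Dc Da)).
  rewrite -/x -/y -/z.
  rewrite (seg_rev (cs _ _ Dx Dz)) (seg_rev (cs _ _ Dx Dy)) (seg_rev (cs _ _ Dy
    Dz)).
  by ring.
have n1 := nv_ge0 (b - a); have n2 := nv_ge0 (c - b); have n3 := nv_ge0 (a - c).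
have P u1 u2 u3 v1 v2 v3 : u2 - u1 = v1 / 2 \/ u2 - u1 = - (v1 / 2) ->
    u3 - u2 = v2 / 2 \/ u3 - u2 = - (v2 / 2) ->
    u1 - u3 = v3 / 2 \/ u1 - u3 = - (v3 / 2) ->
    per (u1, u2, u3) = (nv v1 + nv v2 + nv v3) / 2.
  rewrite /per; case=> ->; case=> ->; case=> ->; rewrite ?nvN !nv_half; lra.
have : (nv (tri f (a, b, c)) <= 4 * nv (tri f (a, x, z)) \/
       nv (tri f (a, b, c)) <= 4 * nv (tri f (x, b, y))) \/
       (nv (tri f (a, b, c)) <= 4 * nv (tri f (z, y, c)) \/
       nv (tri f (a, b, c)) <= 4 * nv (tri f (y, z, x))).
  rewrite E; set A1 := tri f (a, x, z); set A2 := tri f (x, b, y).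
  set A3 := tri f (z, y, c); set A4 := tri f (y, z, x).
  have := nvD (A1 + A2 + A3) A4; have := nvD (A1 + A2) A3; have := nvD A1 A2.
  move: (nv (A1 + A2 + A3 + A4)) (nv (A1 + A2)) (nv (A1 + A2 + A3)) => N N1 N2.
  move: (nv A1) (nv A2) (nv A3) (nv A4) => x1 x2 x3 x4 h1 h2 h3.
  case: (lerP N (4 * x1)) => [?|?]; first by left; left.
  case: (lerP N (4 * x2)) => [?|?]; first by left; right.
  case: (lerP N (4 * x3)) => [?|?]; first by right; left.
  by right; right; lra.
have h1 : nv (x - a) <= nv (b - a).
  have -> : x - a = (b - a) / 2 by rewrite /x; field.
  rewrite nv_half; lra.
have h2 : nv (y - a) <= nv (b - a) + nv (c - b).
  have -> : y - a = (b - a) + (c - b) / 2 by rewrite /y; field.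
  apply: le_trans (nvD _ _) _; rewrite nv_half; lra.
have h3 : nv (z - a) <= nv (a - c).
  have -> : z - a = - ((a - c) / 2) by rewrite /z; field.
  rewrite nvN nv_half; lra.
case; case => H.
- exists (a, x, z); split => //; last by rewrite /= subrr nv0; lra.
  by apply: P; rewrite /x /y /z; [left|left|left]; field.
- exists (x, b, y); split => //=; last by lra.
  by apply: P; rewrite /x /y /z; [left|left|left]; field.
- exists (z, y, c); split => //=; last by lra.
  by apply: P; rewrite /x /y /z; [left|left|left]; field.
- exists (y, z, x); split => //=; last by lra.
  by apply: P; rewrite /x /y /z; [right|right|right]; field.
Qed.

(** Goursat's lemma: no continuity of the derivative is required. *)
Lemma goursat_triangle f a b c : (forall z, D z -> derivable f z 1) ->
  D a -> D b -> D c -> seg f a b + seg f b c + seg f c a = 0.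
Proof.
move=> df Da Db Dc.
have cf z : D z -> {for z, continuous f}.
  by move=> /df /derivable1_diffP /differentiable_continuous.
have [->|T0] := eqVneq (seg f a b + seg f b c + seg f c a) 0 => //; exfalso.
(* iterate the bisection; the perimeter halves at each step *)
have [next hnext] : exists next, forall T, inD T -> [/\ inD (next T),
    nv (tri f T) <= 4 * nv (tri f (next T)), per (next T) = per T / 2 &
    nv ((next T).1.1 - T.1.1) <= per T].
  suff /choice[g hg] : forall T, exists T', inD T -> [/\ inD T',
    nv (tri f T) <= 4 * nv (tri f T'), per T' = per T / 2 &
    nv (T'.1.1 - T.1.1) <= per T] by exists g.
  move=> T.
  have [/(tri_bisect cf)[T' hT']|nT] := pselect (inD T); first by exists T'.
  by exists T => /nT.
pose T n := iter n next (a, b, c).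
have TD n : inD (T n) by elim: n => //= n /hnext[].
have TP n : per (T n) = per (a, b, c) / 2 ^+ n.
  elim: n => [|n IH]; first by rewrite expr0 divr1.
  by rewrite /= (let: And4 _ _ h _ := hnext _ (TD n) in h) IH exprSr invfM mulrA.
have TI n : nv (tri f (a, b, c)) <= 4 ^+ n * nv (tri f (T n)).
  elim: n => [|n IH]; first by rewrite expr0 mul1r.
  apply: le_trans IH _; rewrite exprSr -mulrA ler_wpM2l ?exprn_ge0//.
  by have [] := hnext _ (TD n).
have per0 T' : 0 <= per T' by case: T' => [[? ?] ?]; rewrite /per !addr_ge0 ?nv_ge0.
have TA n k : nv ((T (n + k)%N).1.1 - (T n).1.1) <= 2 * per (T n) - 2 * per (T (n
  + k)%N).
  elim: k => [|k IH]; first by rewrite addn0 subrr nv0 subrr.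
  apply: le_trans (nv_tri (T (n + k)%N).1.1 _ _) _.
  have [_ _ h1 h2] := hnext _ (TD (n + k)%N).
  rewrite addnS /= h1; apply: le_trans (lerD h2 IH) _; lra.
have [p hp] : exists p, forall n, nv ((T n).1.1 - p) <= 2 * (2 * per (T n)).
  apply: complex_cauchy => m n.
  wlog mn : m n / (n <= m)%N.
    move=> H; have [mn|/ltnW mn] := leqP n m; first exact: H.
    by rewrite nvB [leRHS]addrC; exact: H.
  rewrite -(subnKC mn); apply: le_trans (TA _ _) _.
  by have := per0 (T (n + (m - n))%N); lra.
set P := per (a, b, c) in TP.
(* the triangles shrink to the point p, at which f is differentiable *)
have small (e : R) : 0 < e -> exists n, per (T n) < e.
  move=> e0; have [n hn] : exists n : nat, P / e < n%:R.
    by exists (Num.truncn (P / e)).+1; rewrite truncnS_gt// num_real.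
  exists n; rewrite TP ltr_pdivrMr ?exprn_gt0// mulrC -ltr_pdivrMr//.
  by apply: lt_le_trans hn _; rewrite -natrX ler_nat ltnW// ltn_expl.
have Dp : D p.
  apply: Dclosed => e e0; have [|n hn] := small (e / 4); first lra.
  exists (T n).1.1; first by have := TD n; case: (T n) => [[? ?] ?] [].
  by apply: le_lt_trans (hp n) _; lra.
have dfp := df _ Dp; have := derivableP dfp;
  set d : C := 'D_1 f p => /is_derive_nvP hd.
(* each point of a triangle of perimeter Q is within 5 Q of p, so the integral
   over it is at most e 5 Q^2; this e makes the bound smaller than eta *)
set eta := nv (tri f (a, b, c)).
have eta0 : 0 < eta by rewrite nv_gt0.
have P0 : 0 <= P by apply: per0.
have e0 : 0 < eta / (5 * P ^+ 2 + 1).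
  by rewrite divr_gt0// ltr_wpDl// mulr_ge0// sqr_ge0.
set e := eta / _ in e0.
have [dl dl0 {}hd] := hd _ e0.
have [|n hn] := small (dl / 5); first lra.
have := TI n; have := TP n; have := TD n; have := hp n.
move: hn; case: (T n) => [[u v] w] /= hn hpu [Du Dv Dw] perE.
(* the affine part g of f at p has the primitive F, so its integral vanishes *)
set F : C -> C := fun z => f p * z + d / 2 * (z ^+ 2 - 2 * p * z).
set g : C -> C := fun z => f p + d * (z - p).
have dF (z : C) : is_derive z 1 F (g z).
  apply: is_derive_eq (cderD (cderZ _ (cder_id _)) (cderZ _ (cderB (cderX 2
    (cder_id _)) (cderZ _ (cder_id _))))) _.
  by rewrite /g /= expr1; field.
have cg (z : C) : {for z, continuous g}.
  by apply/differentiable_continuous/derivable1_diffP; apply: ex_derive.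
have cs x y : D x -> D y -> cont_seg f x y by move=> *; exact: convex_cont_seg.
have tg : tri g (u, v, w) = 0.
  rewrite /tri !(@seg_ftc _ g F); do ?[by move=> *; exact: cg|by move=> *;
    exact: dF].
  ring.
have tfg : tri f (u, v, w) = tri (fun z => f z - g z) (u, v, w).
  have sB x y : D x -> D y ->
      seg (fun z => f z - g z) x y = seg f x y - seg g x y.
    by move=> Dx Dy; apply: segB; [exact: cs|move=> t _; exact: cg].
  rewrite /tri !sB//; move: tg; rewrite /tri; set s1 := seg g u v;
    set s2 := seg g v w; set s3 := seg g w u => tg; rewrite -[LHS]subr0 -tg; ring.
have n1 := nv_ge0 (v - u); have n2 := nv_ge0 (w - v); have n3 := nv_ge0 (u - w).
set Q := nv (v - u) + nv (w - v) + nv (u - w) in perE hn hpu.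
have Q0 : 0 <= Q by rewrite /Q; lra.
have sb x y : D x -> D y -> nv (x - u) <= Q -> nv (y - x) + nv (x - u) <= Q ->
    nv (seg (fun z => f z - g z) x y) <= nv (y - x) * (e * (5 * Q)).
  move=> Dx Dy hx hyx; apply: seg_le.
    move=> t t01; apply: continuousB; [exact: cf (Dconv Dx Dy t01)|exact: cg].
  move=> t t01; set z := x + _.
  have zp : nv (z - p) <= 5 * Q.
    have -> : z - p = t%:C * (y - x) + (x - u) + (u - p) by rewrite /z; ring.
    apply: le_trans (nvD _ _) _; have := nvD (t%:C * (y - x)) (x - u).
    rewrite nvM nv_real ger0_norm; last lra.
    have : t * nv (y - x) <= nv (y - x) by rewrite ler_piMl ?nv_ge0//; lra.
    by move: hpu; rewrite -/Q; lra.
  have := hd (z - p); rewrite -[(z - p) *: 1]/((z - p) * 1) mulr1 subrKC => H.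
  have -> : f z - g z = f z - f p - (z - p) *: d by rewrite /g -[_ *: d]/(_ * d);
    ring.
  apply: le_trans (H _) _; first by lra.
  by rewrite ler_wpM2l// ltW.
have : nv (tri f (u, v, w)) <= Q * (e * (5 * Q)).
  rewrite tfg /tri; apply: le_trans (nvD _ _) _.
  set K := e * _; rewrite {1}/Q 2!mulrDl; apply: lerD; last first.
    have tr := nv_tri v w u; have wu := nvB w u.
    by apply: sb => //; rewrite /Q; lra.
  apply: le_trans (nvD _ _) _; apply: lerD; apply: sb => //;
    rewrite ?subrr ?nv0 -/Q //.
  - by rewrite /Q; lra.
  - by rewrite /Q; lra.
  - by rewrite /Q; lra.
move=> h1; apply/negP; rewrite -ltNge.
apply: (@le_lt_trans _ _ (5 * e * P ^+ 2)).
  apply: le_trans (_ : 4 ^+ n * (Q * (e * (5 * Q))) <= _);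
    first by rewrite ler_wpM2l// exprn_ge0.
  rewrite perE; have -> : 4 = 2 ^+ 2 :> R by ring.
  rewrite -exprM mulnC exprM expr2; set k := 2 ^+ n.
  have k0 : k != 0 by rewrite expf_neq0.
  by rewrite le_eqVlt; apply/orP; left; apply/eqP; field.
have := sqr_ge0 P => P2; rewrite -[ltRHS](@divfK _ (5 * P ^+ 2 + 1)); last by lra.
rewrite -/eta -/e; nra.
Qed.

(** The integral from a base point c0 is a primitive at the interior points of
    D. *)
Lemma primitive_of_convex f c0 z : (forall z, D z -> derivable f z 1) ->
  D c0 -> (exists2 r : R, 0 < r & forall h, nv h < r -> D (z + h)) ->
  is_derive z 1 (seg f c0) (f z).
Proof.
move=> df Dc0 [r r0 Dr].
have Dz : D z by rewrite -[z]addr0; apply: Dr; rewrite nv0.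
have cf y : D y -> {for y, continuous f}.
  by move=> /df /derivable1_diffP /differentiable_continuous.
have cs x y : D x -> D y -> cont_seg f x y by move=> *; exact: convex_cont_seg.
apply/is_derive_nvP => e e0.
have /continuous_nvP /(_ _ e0)[d d0 hd] := cf _ Dz.
exists (Num.min d r); first by rewrite lt_min d0.
move=> h; rewrite lt_min => /andP[hdd hr].
have Dzh : D (z + h) by exact: Dr.
rewrite -[h *: 1]/(h * 1) mulr1 -[h *: f z]/(h * f z).
have := goursat_triangle df Dc0 Dz Dzh; rewrite (seg_rev (cs _ _ Dc0 Dzh)) => /eqP.
rewrite subr_eq0 => /eqP <-; rewrite [seg f c0 z + _]addrC addrK.
have E : seg (fun=> f z) z (z + h) = h * f z.
  rewrite (@segE _ _ (fun t => f z * t%:C)).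
    by rewrite rmorph1 rmorph0; ring.
  move=> t _ e' e'0; exists 1 => // k _; rewrite rmorphD /=.
  have -> : f z * (t%:C + k%:C) - f z * t%:C - k%:C * f z = 0 by ring.
  by rewrite nv0 mulr_ge0// ltW.
have cz : cont_seg (fun=> f z) z (z + h) by move=> t _; exact: cst_continuous.
rewrite -E -segB; [|exact: cs|exact: cz].
apply: le_trans (@seg_le _ _ _ _ e _ _) _.
- by move=> t t01; apply: continuousB; [exact: cs|exact: cz].
- move=> t t01; apply/ltW/hd; rewrite [z + h]addrC addrK nvM nv_real ger0_norm;
  last by lra.
  by apply: le_lt_trans hdd; rewrite ler_piMl ?nv_ge0//; lra.
- by rewrite [z + h]addrC addrK mulrC.
Qed.

End Goursat.

(** * The complex exponential and the mean value property on circles *)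

Section MeanValue.
Context {R : realType}.
Local Notation C := R[i].

(** The mean value inequality along a segment of a complex normed space. *)
Lemma line_mean_value_le (V : normedModType C) (f : V -> C) (a v : V) (d :
  R -> C) M :
  (forall t : R, 0 <= t <= 1 -> is_derive (a + t%:C *: v) v f (d t)) ->
  (forall t : R, 0 <= t <= 1 -> nv (d t) <= M) -> nv (f (a + v) - f a) <= M.
Proof.
move=> fd dM.
have := @mean_value_le _ (fun t => f (a + t%:C *: v)) d M.
rewrite rmorph1 rmorph0 scale1r scale0r addr0; apply=> // t /fd.
exact: rder_line.
Qed.

Lemma complex_mean_value_le (f d : C -> C) (a v : C) M :
  (forall t : R, 0 <= t <= 1 -> is_derive (a + t%:C * v) 1 f (d (a + t%:C * v))) ->
  (forall t : R, 0 <= t <= 1 -> nv (d (a + t%:C * v)) <= M) ->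
  nv (f (a + v) - f a) <= M * nv v.
Proof.
move=> fd dM; apply: (@line_mean_value_le _ f a v (fun t => d (a + t%:C * v) * v)).
  by move=> t /fd h; exact: cder_dir.
by move=> t /dM h; rewrite nvM ler_wpM2r ?nv_ge0.
Qed.

(** The complex exponential, defined by its polar form. *)
Definition cexp (z : C) : C :=
  (expR (complex.Re z))%:C * (cos (complex.Im z) +i* sin (complex.Im z)).

Lemma cexpD z w : cexp (z + w) = cexp z * cexp w.
Proof.
rewrite /cexp !raddfD /= expRD cosD sinD.
by apply/eqP; rewrite eq_complex /= !mul0r; apply/andP; split; apply/eqP; ring.
Qed.

Lemma nv_cexp z : nv (cexp z) = expR (complex.Re z).
Proof.
rewrite /cexp nvM nv_real ger0_norm ?expR_ge0//.
suff -> : nv (cos (complex.Im z) +i* sin (complex.Im z)) = 1 by rewrite mulr1.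
by apply/eqP; rewrite -(@eqrXn2 _ 2) ?nv_ge0// sqr_nv /= cos2Dsin2 expr1n.
Qed.

Lemma cexp_neq0 z : cexp z != 0.
Proof. by rewrite -nv_gt0 nv_cexp expR_gt0. Qed.

Lemma cexp0 : cexp 0 = 1.
Proof. by rewrite /cexp /= expR0 cos0 sin0 mul1r. Qed.

Lemma cexp_period z : cexp (z + (pi *+ 2)%:C * 'i) = cexp z.
Proof.
rewrite cexpD; suff -> : cexp ((pi *+ 2)%:C * 'i) = 1 by rewrite mulr1.
by rewrite /cexp /= !mul0r !mulr0 subrr mulr1 addr0 expR0 cos2pi sin2pi mul1r.
Qed.

Lemma is_derive_cexp (z : C) : is_derive z 1 cexp (cexp z).
Proof.
apply/is_derive_nvP => e e0.
set n := nv (cexp z); have n0 : 0 < n + 1 by rewrite ltr_wpDl ?nv_ge0.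
pose e' := e / (12 * (n + 1)).
have e'0 : 0 < e' by rewrite divr_gt0// mulr_gt0.
have /is_derive_realP/(_ _ e'0)[d1 d10 h1] := @is_derive_expR R 0.
have /is_derive_realP/(_ _ e'0)[d2 d20 h2] := @is_derive_sin R 0.
have /is_derive_realP/(_ _ e'0)[d3 d30 h3] := @is_derive_cos R 0.
exists (Num.min (Num.min d1 d2) (Num.min d3 (Num.min 1 e'))).
  by rewrite !lt_min d10 d20 d30 ltr01 e'0.
move=> h; rewrite !lt_min => /andP[/andP[hd1 hd2] /and3P[hd3 hd4 hd5]].
rewrite -[h *: 1]/(h * 1) mulr1 -[h *: _]/(h * cexp z) cexpD.
have -> : cexp z * cexp h - cexp z - h * cexp z = cexp z * (cexp h - 1 - h) by ring.
rewrite nvM -/n; case: h hd1 hd2 hd3 hd4 hd5 => x y;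
  set h := x +i* y => hd1 hd2 hd3 hd4 hd5.
have hx : `|x| <= nv h := Re_le_nv h; have hy : `|y| <= nv h := Im_le_nv h.
have := h1 _ (le_lt_trans hx hd1); have := h2 _ (le_lt_trans hy hd2).
have := h3 _ (le_lt_trans hy hd3);
  rewrite !(add0r, addr0, expR0, cos0, sin0, oppr0, mulr0, subr0, mulr1).
move=> H3 H2 H1.
suff H : nv (cexp h - 1 - h) <= 12 * e' * nv h.
  apply: le_trans (_ : (n + 1) * (12 * e' * nv h) <= _).
    by apply: ler_pM => //; rewrite ?nv_ge0// lerDl.
  by rewrite /e' le_eqVlt; apply/orP; left; apply/eqP; field; rewrite gt_eqF.
apply: le_trans (nv_le_ReIm _) _; rewrite /cexp /= !mul0r subr0 addr0.
have -> : expR x * cos y - 1 - x = cos y * (expR x - 1 - x) + (1 + x) * (cos y -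
  1) by ring.
have -> : expR x * sin y - 0 - y = sin y * (expR x - 1 - x) + (1 + x) * (sin y -
  y) + x * y by ring.
have x1 : `|1 + x| <= 2 by apply: le_trans (ler_normD _ _) _; rewrite normr1; lra.
have cy : `|cos y| <= 1 by rewrite ler_norml cos_geN1 cos_le1.
have sy : `|sin y| <= 1 by rewrite ler_norml sin_geN1 sin_le1.
have N0 := nv_ge0 h.
have E1 : `|expR x - 1 - x| <= e' * nv h by apply: le_trans H1 _;
  rewrite ler_wpM2l// ltW.
have E2 : `|sin y - y| <= e' * nv h by apply: le_trans H2 _;
  rewrite ler_wpM2l// ltW.
have E3 : `|cos y - 1| <= e' * nv h by apply: le_trans H3 _;
  rewrite ler_wpM2l// ltW.
have F1 : `|cos y * (expR x - 1 - x)| <= 1 * (e' * nv h) by rewrite normrM ler_pM.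
have F2 : `|(1 + x) * (cos y - 1)| <= 2 * (e' * nv h) by rewrite normrM ler_pM.
have F3 : `|sin y * (expR x - 1 - x)| <= 1 * (e' * nv h) by rewrite normrM ler_pM.
have F4 : `|(1 + x) * (sin y - y)| <= 2 * (e' * nv h) by rewrite normrM ler_pM.
have F5 : `|x * y| <= e' * nv h.
  by rewrite normrM ler_pM//; apply: le_trans hx _; exact: ltW.
have G1 := ler_normD (cos y * (expR x - 1 - x)) ((1 + x) * (cos y - 1)).
have G2 := ler_normD (sin y * (expR x - 1 - x) + (1 + x) * (sin y - y)) (x * y).
have G3 := ler_normD (sin y * (expR x - 1 - x)) ((1 + x) * (sin y - y)).
have : 0 <= e' * nv h by rewrite mulr_ge0// ltW.
rewrite -[12 * e' * nv h]mulrA; move: (e' * nv h) F1 F2 F3 F4 F5 => w; lra.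
Qed.

Lemma le_of_addgt0 (x y : R) : (forall e, 0 < e -> x <= y + e) -> x <= y.
Proof. by move=> h; apply/ler_addgt0Pr. Qed.

(** At the centre k is only assumed continuous, which allows removable
    singularities. *)
Lemma circle_mean_le (k : C -> C) (r R0 M : R) : 0 < r -> r < R0 ->
  (forall z : C, z != 0 -> nv z < R0 -> derivable k z 1) -> {for 0, continuous k} ->
  (forall z, nv z = r -> nv (k z) <= M) -> nv (k 0) <= M.
Proof.
move=> r0 rR dk ck kM.
pose b := ln ((r + R0) / 2).
have eb : expR b = (r + R0) / 2 by rewrite lnK// posrE; lra.
(* the half-plane D is mapped by the exponential into the punctured disk *)
pose D : set C := [set w | complex.Re w <= b].
have Dconv (u v : C) (t : R) : D u -> D v -> 0 <= t <= 1 -> D (u + t%:C * (v - u)).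
  rewrite /D; case: u => u1 u2; case: v => v1 v2 /= hu hv /andP[t0 t1].
  by rewrite mul0r subr0; nra.
have Dclosed (p : C) : (forall e :
  R, 0 < e -> exists2 a, D a & nv (a - p) < e) -> D p.
  move=> h; apply: le_of_addgt0 => e /h[a Da ap].
  have := Re_le_nv (a - p); rewrite raddfB /= => H.
  have := ler_norm (- (complex.Re a - complex.Re p)); rewrite normrN => H'.
  by move: Da; rewrite /D /=; lra.
pose F (w : C) : C := k (cexp w).
have dF (w : C) : D w -> derivable F w 1.
  move=> Dw; have lw : nv (cexp w) < R0.
    rewrite nv_cexp; apply: (@le_lt_trans _ _ (expR b)); first by rewrite ler_expR.
    by rewrite eb; lra.
  have dkw := derivableP (dk _ (cexp_neq0 w) lw).
  by have [] := cder_comp (is_derive_cexp w) dkw.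
pose P := seg F b%:C.
have dP (w : C) : complex.Re w < b -> is_derive w 1 P (F w).
  move=> wb; apply: (primitive_of_convex Dconv Dclosed dF); first by rewrite /D /=.
  exists (b - complex.Re w); first lra.
  move=> h hw; rewrite /D /= raddfD /=; have := Re_le_nv h.
  have := ler_norm (complex.Re h); lra.
pose T : C := (pi *+ 2)%:C * 'i.
have nT : nv T = pi *+ 2 by rewrite nvM nv_real nvi mulr1 ger0_norm//
  mulrn_wge0// pi_ge0.
have ReT (w : C) : complex.Re (w + T) = complex.Re w.
  by case: w => x y; rewrite /T /= !mulr0 mul0r subr0 addr0.
have ReTt (w : C) (t : R) : complex.Re (w + t%:C * T) = complex.Re w.
  by case: w => x y; rewrite /T /=; ring.
(* by periodicity A is constant; it is i times the integral over a circle *)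
pose A (w : C) : C := P (w + T) - P w.
have dA (w : C) : complex.Re w < b -> is_derive w 1 A 0.
  move=> wb; rewrite -[0](subrr (F w)); apply: cderB (dP _ wb).
  have -> : F w = F (w + T) * (1 + 0) by rewrite /F cexp_period addr0 mulr1.
  have dT : is_derive w 1 (fun z : C => z + T) (1 + 0).
    exact: (cderD (cder_id w) (cder_cst T w 1)).
  have dPT : is_derive (w + T) 1 P (F (w + T)) by apply: dP; rewrite ReT.
  exact: (@cder_comp _ _ (fun z => z + T) P w 1 _ _ dT dPT).
have Ac (x1 x2 : R) : x1 < b -> x2 < b -> A x1%:C = A x2%:C.
  move=> h1 h2; have : nv (A (x2%:C + (x1%:C - x2%:C)) - A x2%:C) <= 0 * nv
    (x1%:C - x2%:C).
    apply: (@complex_mean_value_le _ (fun=> 0)) => t t01; last by rewrite nv0.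
    apply: dA; rewrite -rmorphB -rmorphM -rmorphD /=.
    by move: t01 => /andP[t0 t1]; case: (lerP x1 x2) => ?; nra.
  rewrite mul0r subrKC => H; apply/eqP; rewrite -subr_eq0 -nv_eq0.
  by rewrite eq_le H nv_ge0.
have lb : ln r < b by rewrite ltr_ln ?posrE; lra.
have h1 : nv (A (ln r)%:C) <= M * (pi *+ 2).
  rewrite -nT; apply: (@complex_mean_value_le _ F) => t t01.
    by apply: dP; rewrite ReTt.
  by apply: kM; rewrite nv_cexp ReTt /= lnK.
apply: le_of_addgt0 => e e0.
have /continuous_nvP/(_ _ e0)[d d0 hd] := ck.
(* far to the left exp x is close to 0, where k is close to k 0 *)
pose x0 := Num.min (b - 1) (ln (d / 2)).
have x0b : x0 < b by rewrite /x0 gt_min; apply/orP; left; lra.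
have h2 : nv ((P (x0%:C + T) - k 0 * (x0%:C + T)) - (P x0%:C - k 0 * x0%:C)) <= e
  * (pi *+ 2).
  rewrite -nT; apply: (@complex_mean_value_le (fun w => P w - k 0 * w) (fun w =>
    F w - k 0)) => t t01.
    apply: cderB; first by apply: dP; rewrite ReTt.
    by apply: is_derive_eq (cderZ (k 0) (cder_id _)) _; rewrite mulr1.
  apply/ltW; have := hd (cexp (x0%:C + t%:C * T)); rewrite add0r; apply.
  rewrite nv_cexp ReTt /=; apply: (@le_lt_trans _ _ (d / 2)); last lra.
  by rewrite -[leRHS]lnK ?posrE; [rewrite ler_expR /x0 ge_min lexx orbT|lra].
have pi0 : 0 < pi *+ 2 :> R by rewrite mulrn_wgt0// pi_gt0.
rewrite -(ler_pM2r pi0) mulrDl -[X in _ * X <= _]nT -nvM.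
have -> : k 0 * T = A x0%:C - ((P (x0%:C + T) - k 0 * (x0%:C + T)) - (P x0%:C - k
  0 * x0%:C)).
  by rewrite /A; ring.
apply: le_trans (nvD _ _) _; rewrite nvN; apply: lerD => //.
by rewrite (Ac _ _ x0b lb).
Qed.

End MeanValue.

(** * Cauchy estimates and difference quotients *)

Section CauchyEstimates.
Context {R : realType}.
Local Notation C := R[i].

(** A directional derivative depends only on the values near the point. *)
Lemma cder_near (V : normedModType C) (f g : V -> C) (x v : V) (d : C) :
  is_derive x v f d -> (exists2 r :
    R, 0 < r & forall h, nv h < r -> f (x + h) = g (x + h)) ->
  is_derive x v g d.
Proof.
move=> /is_derive_nvP fd [r r0 fg]; apply/is_derive_nvP => e /fd[dl dl0 hd].
have v0 : 0 < nv v + 1 by rewrite ltr_wpDl ?nv_ge0.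
exists (Num.min dl (r / (nv v + 1))); first by rewrite lt_min dl0 divr_gt0.
move=> t; rewrite lt_min => /andP[/hd ht]; rewrite ltr_pdivlMr// => tr.
rewrite -fg; last by rewrite nvZ; apply: le_lt_trans tr;
  rewrite ler_wpM2l ?nv_ge0// lerDl.
by have := fg 0; rewrite addr0 nv0 => <-.
Qed.

(** Restriction to a complex line. *)
Lemma cder_line (V : normedModType C) (g : V -> C) (w u : V) (z d : C) :
  is_derive (w + z *: u) u g d -> is_derive z 1 (fun s => g (w + s *: u)) d.
Proof.
move=> /is_derive_nvP gd; apply/is_derive_nvP => e /gd[dl dl0 hd].
exists dl => // t /hd; rewrite -[t *: 1]/(t * 1) mulr1.
by rewrite scalerDl addrA.
Qed.

(** The difference quotient of f at 0, extended by the derivative at z = 0. *)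
Definition dquot (f : C -> C) (z : C) : C :=
  if z == 0 then 'D_1 f 0 else (f z - f 0) / z.

Lemma dquot_derivable (f : C -> C) (z : C) :
  z != 0 -> derivable f z 1 -> derivable (dquot f) z 1.
Proof.
move=> z0 /derivableP df.
have H := cderM (cderB df (cder_cst (f 0) z 1)) (cderV (cder_id z) z0).
suff [] : is_derive z 1 (dquot f) ((('D_1 f z - 0)) * z^-1 + (f z - f 0) * (- 1 /
  z ^+ 2)) by [].
apply: cder_near H _; exists (nv z); first by rewrite nv_gt0.
move=> h hz; rewrite /dquot; case: eqP => // /eqP; rewrite addr_eq0 => /eqP zh.
by move: hz; rewrite zh nvN ltxx.
Qed.

Lemma dquot_continuous (f : C -> C) :
  derivable f 0 1 -> {for 0, continuous (dquot f)}.
Proof.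
move=> /derivableP/is_derive_nvP df; apply/continuous_nvP => e e0.
have e2 : 0 < e / 2 by lra.
have [d d0 hd] := df _ e2; exists d => // h /hd; rewrite add0r /dquot eqxx.
rewrite -[h *: 1]/(h * 1) mulr1 add0r -[h *: _]/(h * _) => H.
case: eqP => [_|/eqP h0]; first by rewrite subrr nv0.
have nh : 0 < nv h by rewrite nv_gt0.
have -> : (f h - f 0) / h - 'D_1 f 0 = (f h - f 0 - h * 'D_1 f 0) / h by field.
rewrite nvM nvV ltr_pdivrMr//; apply: le_lt_trans H _.
by rewrite ltr_pM2r//; lra.
Qed.

(** A bound valid for every radius below rho holds for rho. *)
Lemma le_mul_lim (x y rho : R) : 0 < rho ->
  (forall r, 0 < r -> r < rho -> x * r <= y) -> x * rho <= y.
Proof.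
move=> rho0 h; apply: contrapT => /negP; rewrite -ltNge => yx.
have h1 : x * (rho / 2) <= y by apply: h; lra.
have x0 : 0 < x by nra.
have xy : y / x < rho by rewrite ltr_pdivrMr// mulrC.
have y0 : 0 <= y / x by rewrite divr_ge0//; nra.
have := h ((y / x + rho) / 2); have -> :
  x * ((y / x + rho) / 2) = (y + x * rho) / 2.
  by field; rewrite gt_eqF.
by lra.
Qed.

(** Cauchy's estimate at the centre, from the mean value property of the
    difference quotient. *)
Lemma cauchy_estimate1 (f : C -> C) (rho M : R) : 0 < rho ->
  (forall z : C, nv z < rho -> derivable f z 1) ->
  (forall z : C, nv z < rho -> nv (f z) <= M) ->
  nv ('D_1 f 0) * rho <= 2 * M.
Proof.
move=> rho0 df fM; apply: le_mul_lim => // r r0 rr.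
rewrite -ler_pdivlMr//.
have E : 'D_1 f 0 = dquot f 0 by rewrite /dquot eqxx.
rewrite E; apply: (@circle_mean_le _ (dquot f) r rho) => //.
- by move=> z z0 zr; apply: dquot_derivable => //; exact: df.
- by apply: dquot_continuous; apply: df; rewrite nv0.
move=> z zr; rewrite /dquot -nv_eq0 zr gt_eqF// nvM nvV zr ler_pM2r ?invr_gt0//.
apply: le_trans (nvD _ _) _; rewrite nvN mulr2n mulrDl mul1r; apply: lerD;
  apply: fM.
  by rewrite zr.
by rewrite nv0.
Qed.

Section Vector.
Context {V : normedModType C}.
Implicit Types (g : V -> C) (a w u v h : V).

(** On the ball of centre a and radius rho, g is differentiable in each
    direction and bounded by M. *)
Definition hol_bounded g a (rho M : R) := forall w, nv (w - a) < rho ->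
  (forall u, derivable g w u) /\ nv (g w) <= M.

Lemma cauchy_estimate g w u (rho M : R) : 0 < rho -> hol_bounded g w rho M ->
  nv ('D_u g w) * rho <= 2 * M * nv u.
Proof.
move=> rho0 hg; have [->|u0] := eqVneq u 0.
  by rewrite derive0 !nv0 mul0r mulr0.
have nu : 0 < nv u by rewrite nv_gt0.
rewrite -ler_pdivrMr// -mulrA.
have hz (z : C) : nv z < rho / nv u -> nv (w + z *: u - w) < rho.
  by rewrite ltr_pdivlMr// [w + _]addrC addrK nvZ.
have dz (z : C) : nv z < rho / nv u ->
    is_derive z 1 (fun s => g (w + s *: u)) ('D_u g (w + z *: u)).
  by move=> /hz /hg[dg _]; apply: cder_line; apply: derivableP; exact: dg.
have -> : 'D_u g w = 'D_1 (fun s : C => g (w + s *: u)) (0 : C).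
  have := dz 0; rewrite nv0 => /(_ (divr_gt0 rho0 nu)) [_ ->].
  by rewrite scale0r addr0.
apply: cauchy_estimate1; first by rewrite divr_gt0.
- by move=> z /dz[].
- by move=> z /hz /hg[].
Qed.

Lemma hol_bounded_sub g a b (rho r M : R) : hol_bounded g a rho M ->
  nv (b - a) + r <= rho -> hol_bounded g b r M.
Proof.
move=> hg br w hw; apply: hg; apply: le_lt_trans (nv_tri b _ _) _; lra.
Qed.

Lemma ball_segment a w u (rho t : R) : nv (w - a) < rho -> nv (w + u - a) < rho ->
  0 <= t <= 1 -> nv (w + t%:C *: u - a) < rho.
Proof.
move=> h1 h2 /andP[t0 t1].
rewrite [w + u - a]addrAC in h2; rewrite addrAC; move: (w - a) h1 h2 => x h1 h2.
have -> : x + t%:C *: u = (1 - t)%:C *: x + t%:C *: (x + u).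
  by rewrite rmorphB rmorph1 /= scalerBl scale1r scalerDr addrA subrK.
apply: le_lt_trans (nvD _ _) _; rewrite !nvZ !nv_real !ger0_norm; [|lra..].
have [->|t1'] := eqVneq t 1; first by rewrite subrr mul0r add0r mul1r.
have : t < 1 by rewrite lt_neqAle t1'.
by move: (nv x) (nv (x + u)) h1 h2 => p q *; nra.
Qed.

Lemma hol_lipschitz g a w u (rho M : R) : 0 < rho -> hol_bounded g a (2 * rho) M ->
  nv (w - a) < rho -> nv (w + u - a) < rho ->
  nv (g (w + u) - g w) <= 2 * M / rho * nv u.
Proof.
move=> rho0 hg h1 h2.
have hb (t : R) : 0 <= t <= 1 -> hol_bounded g (w + t%:C *: u) rho M.
  move=> t01; apply: hol_bounded_sub hg _; have := ball_segment h1 h2 t01; lra.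
apply: (@line_mean_value_le _ V g w u (fun t => 'D_u g (w + t%:C *: u))) => t t01.
  by apply: derivableP; have [] := hb _ t01 (w + t%:C *: u); rewrite ?subrr ?nv0.
by rewrite mulrAC ler_pdivlMr//; apply: cauchy_estimate => //; exact: hb.
Qed.

(** The difference quotient of g with increment s in the direction v. *)
Definition gquot g v (s : C) : V -> C := fun x => (g (x + s *: v) - g x) / s.

Lemma derivable_shift g x y u : derivable g (x + y) u ->
  is_derive x u (fun z => g (z + y)) ('D_u g (x + y)).
Proof.
move=> /derivableP/is_derive_nvP gd; apply/is_derive_nvP => e /gd[d d0 hd].
by exists d => // t /hd; rewrite (addrAC x).
Qed.

Lemma derivable_gquot g v s x u : derivable g (x + s *: v) u -> derivable g x u ->
  is_derive x u (gquot g v s) (('D_u g (x + s *: v) - 'D_u g x) / s).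
Proof.
move=> h1 /derivableP h2; rewrite /gquot.
have -> : (fun x0 => (g (x0 + s *: v) - g x0) / s) = (fun x0 =>
  s^-1 * (g (x0 + s *: v) - g x0)).
  by apply/funext => z; rewrite mulrC.
rewrite mulrC; exact: (cderZ s^-1 (cderB (derivable_shift h1) h2)).
Qed.

Lemma gquot_hol_bounded g a v s (rho M : R) :
  0 < rho -> s != 0 -> nv (s *: v) < rho ->
  hol_bounded g a (4 * rho) M -> hol_bounded (gquot g v s) a rho (M / rho * nv v).
Proof.
move=> rho0 s0 sv hg w wa.
have wsv : nv (w + s *: v - a) < 2 * rho.
  rewrite addrAC; apply: le_lt_trans (nvD _ _) _; lra.
split.
  move=> u; have [] // := @derivable_gquot g v s w u.
    by have [] := hg (w + s *: v); first lra.
  by have [] := hg w; first lra.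
rewrite /gquot nvM nvV ler_pdivrMr ?nv_gt0//.
have -> : M / rho * nv v * nv s = 2 * M / (2 * rho) * nv (s *: v).
  by rewrite nvZ; field; rewrite gt_eqF.
apply: hol_lipschitz wsv; [lra| |lra].
by move=> x xa; apply: hg; lra.
Qed.

Lemma gquot_lim g v x (e : R) : 0 < e -> derivable g x v ->
  exists2 d : R, 0 < d & forall s, s != 0 -> nv s < d ->
    nv (gquot g v s x - 'D_v g x) <= e.
Proof.
move=> e0 /derivableP /is_derive_nvP /(_ _ e0)[d d0 hd].
exists d => // s s0 /hd H; rewrite /gquot.
have -> : (g (x + s *: v) - g x) / s - 'D_v g x = (g (x + s *: v) - g x - s *:
  'D_v g x) / s.
  by rewrite -[s *: 'D_v g x]/(s * 'D_v g x); field.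
by rewrite nvM nvV ler_pdivrMr ?nv_gt0.
Qed.

Lemma small_scalar v (d d' : R) : 0 < d -> 0 < d' -> exists s :
  C, [/\ s != 0, nv s < d & nv (s *: v) < d'].
Proof.
move=> d0 d'0; have v0 : 0 < nv v + 1 by rewrite ltr_wpDl ?nv_ge0.
pose s := Num.min (d / 2) (d' / (2 * (nv v + 1))).
have s0 : 0 < s by rewrite lt_min !divr_gt0// mulr_gt0.
have sd : s <= d / 2 by rewrite ge_min lexx.
have sd' : s <= d' / (2 * (nv v + 1)) by rewrite ge_min lexx orbT.
exists s%:C; split.
- by rewrite -nv_gt0 nv_real gtr0_norm.
- by rewrite nv_real gtr0_norm//; lra.
- rewrite nvZ nv_real gtr0_norm//; move: sd'; rewrite ler_pdivlMr ?mulr_gt0//.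
  by have := nv_ge0 v; nra.
Qed.

(** The difference quotients of g are uniformly bounded, hence uniformly
    Lipschitz; the directional derivative inherits the Lipschitz constant. *)
Lemma derive_lipschitz g a w u v (rho M : R) :
  0 < rho -> hol_bounded g a (8 * rho) M ->
  nv (w - a) < rho -> nv (w + u - a) < rho ->
  nv ('D_v g (w + u) - 'D_v g w) <= M / rho ^+ 2 * nv v * nv u.
Proof.
move=> rho0 hg h1 h2; apply: le_of_addgt0 => e e0.
have e2 : 0 < e / 2 by lra.
have dg x : nv (x - a) < rho -> derivable g x v.
  by move=> xa; have [] := hg x; first lra.
have [d1 d10 hd1] := gquot_lim e2 (dg _ h1).
have [d2 d20 hd2] := gquot_lim e2 (dg _ h2).
have d12 : 0 < Num.min d1 d2 by rewrite lt_min d10.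
have r2 : 0 < 2 * rho by lra.
have [s [s0 sd sv]] := small_scalar v d12 r2.
have hg4 : hol_bounded g a (4 * (2 * rho)) M by move=> x xa; apply: hg; lra.
have := hol_lipschitz rho0 (gquot_hol_bounded r2 s0 sv hg4) h1 h2.
have -> : 2 * (M / (2 * rho) * nv v) / rho * nv u = M / rho ^+ 2 * nv v * nv u.
  by field; rewrite gt_eqF.
move: sd; rewrite lt_min => /andP[/(hd1 _ s0) + /(hd2 _ s0)].
move: (gquot g v s w) (gquot g v s (w + u)) ('D_v g w) ('D_v g (w + u)) =>
  p q dp dq H1 H2 H3.
have -> : dq - dp = - (q - dq) + ((q - p) + (p - dp)) by ring.
apply: le_trans (nvD _ _) _; rewrite nvN; have := nvD (q - p) (p - dp).
lra.
Qed.

(** Taylor's formula to first order, with a remainder controlled by the bound M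
    only. *)
Lemma taylor2 g a w u (rho M : R) : 0 < rho -> hol_bounded g a (8 * rho) M ->
  nv (w - a) < rho -> nv (w + u - a) < rho ->
  nv (g (w + u) - g w - 'D_u g w) <= M / rho ^+ 2 * nv u ^+ 2.
Proof.
move=> rho0 hg h1 h2.
have := @mean_value_le _ (fun t => g (w + t%:C *: u) - 'D_u g w * t%:C)
  (fun t => 'D_u g (w + t%:C *: u) - 'D_u g w) (M / rho ^+ 2 * nv u ^+ 2).
rewrite rmorph1 rmorph0 scale1r scale0r addr0 mulr0 mulr1 subr0.
have -> : g (w + u) - 'D_u g w - g w = g (w + u) - g w - 'D_u g w by ring.
apply => t t01; have ht := ball_segment h1 h2 t01.
  apply: rderB.
    by apply/rder_line/derivableP; have [] := hg (w + t%:C *: u); first lra.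
  move=> e e0; exists 1 => // k _; rewrite rmorphD /=.
  have -> : 'D_u g w * (t%:C + k%:C) - 'D_u g w * t%:C - k%:C * 'D_u g w = 0 by
    ring.
  by rewrite nv0 mulr_ge0// ltW.
apply: le_trans (derive_lipschitz u rho0 hg h1 ht) _.
rewrite expr2 mulrA nvZ nv_real ger0_norm; last by lra.
have M0 : 0 <= M / rho ^+ 2 * nv u * nv u.
  have M0 : 0 <= M by have [_] := hg w ltac:(lra); apply: le_trans; exact: nv_ge0.
  by rewrite !mulr_ge0 ?nv_ge0// invr_ge0 exprn_ge0// ltW.
by rewrite mulrCA ler_piMl//; lra.
Qed.

End Vector.
End CauchyEstimates.

(** * Derivatives of holomorphic functions are holomorphic *)

Section Differentiable.
Context {R : realType}.
Local Notation C := R[i].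

(** Differentiability from a bounded linear approximation, in epsilon-delta
    form. *)
Lemma differentiable_nv (V W : normedModType C) (f : V -> W) (a : V) (L :
  V -> W) (K : R) :
  linear L -> (forall u, nv (L u) <= K * nv u) ->
  (forall e : R, 0 < e -> exists2 d : R, 0 < d & forall u, nv u < d ->
     nv (f (a + u) - f a - L u) <= e * nv u) -> differentiable f a.
Proof.
move=> linL LK fL.
pose scallM := GRing.isLinear.Build _ _ _ _ _ linL.
pose L' : {linear V -> W} := HB.pack L scallM.
have cL : continuous L'.
  move=> x; apply/continuous_nvP => e e0.
  have K0 : 0 < `|K| + 1 by rewrite ltr_wpDl.
  exists (e / (`|K| + 1)); first by rewrite divr_gt0.
  move=> h; rewrite ltr_pdivlMr// => hh; rewrite linearD [L' x + _]addrC addrK.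
  apply: le_lt_trans (LK h) _; apply: le_lt_trans hh;
    rewrite mulrC ler_wpM2l ?nv_ge0//.
  by have := ler_norm K; lra.
have fo : f \o shift a = cst (f a) + L' +o_ 0 id.
  apply/eqaddoP => _ /gt0cP[e e0 ->]; apply/nbhs_nvP.
  have [d d0 hd] := fL _ e0; exists d => // h /hd; rewrite add0r.
  by rewrite !fctE /= [h + a]addrC opprD addrA nvE [`|h|]nvE -rmorphM lecR.
have dE := diff_unique cL fo.
by apply/diff_locallyP; rewrite dE.
Qed.

Lemma derive_linear (V : normedModType C) (g : V -> C) a (c : C) u v :
  differentiable g a -> 'D_(c *: u + v) g a = c * 'D_u g a + 'D_v g a.
Proof. by move=> dg; rewrite !deriveE// linearD linearZ. Qed.

(** Archimedean squeeze. *)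
Lemma nv_squeeze0 (x : C) (K : R) : (forall n : nat, nv x <= K / n.+1%:R) -> x = 0.
Proof.
move=> h; apply/eqP; rewrite -nv_eq0 eq_le nv_ge0 andbT leNgt; apply/negP => x0.
have K0 : 0 < K by have := h 0%N; rewrite divr1; lra.
have := h (Num.truncn (K / nv x)); rewrite leNgt => /negP; apply.
rewrite ltr_pdivrMr// mulrC -ltr_pdivrMr//.
by rewrite truncnS_gt// num_real.
Qed.

(** The difference quotients q n in the direction v converge uniformly near a,
    and Cauchy's estimate makes their derivatives at a converge to a linear map
    L. Letting n tend to infinity in the Taylor formula of q n shows that L is
    the differential of 'D_v g at a. *)
Lemma derive_differentiable_at (V : normedModType C) (g : V -> C) (a v :
  V) (rho M : R) :
  0 < rho -> hol_bounded g a (32 * rho) M ->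
  (forall w, nv (w - a) < 32 * rho -> differentiable g w) ->
  differentiable ('D_v g) a.
Proof.
move=> rho0 hg dg.
have v0 : 0 < nv v + 1 by rewrite ltr_wpDl ?nv_ge0.
pose t0 : R := rho / (nv v + 1).
have t00 : 0 < t0 by rewrite divr_gt0.
have t0v : t0 * nv v < rho by rewrite /t0 mulrAC ltr_pdivrMr//; have := nv_ge0 v;
  nra.
pose t (n : nat) : R := t0 / n.+1%:R.
have n0 (n : nat) : 0 < n.+1%:R :> R by rewrite ltr0n.
have tp n : 0 < t n by rewrite divr_gt0.
have tle n : t n <= t0 by rewrite ler_pdivrMr// ler_pMr// ler1n.
have tv n : nv ((t n)%:C *: v) < rho.
  rewrite nvZ nv_real gtr0_norm//; apply: le_lt_trans t0v.
  by rewrite ler_wpM2r ?nv_ge0.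
have tC n : (t n)%:C != 0 :> C by rewrite -nv_gt0 nv_real gtr0_norm.
pose q n := gquot g v (t n)%:C.
(* uniform bound of the quotients on the ball of radius 8 rho *)
pose B := M / (8 * rho) * nv v.
have hq n : hol_bounded (q n) a (8 * rho) B.
  have tvn : nv ((t n)%:C *: v) < 8 * rho by have := tv n; lra.
  have r8 : 0 < 8 * rho by lra.
  by apply: (gquot_hol_bounded r8 (tC n) tvn) => w wa; apply: hg; lra.
(* constant of the Taylor formula of g on the ball of radius 4 rho *)
pose K2 := M / (4 * rho) ^+ 2 * nv v ^+ 2.
(* uniform convergence of the quotients, from the Taylor formula of g *)
have qD n w : nv (w - a) < 2 * rho -> nv (q n w - 'D_v g w) <= K2 * t n.
  move=> wa; have wtv : nv (w + (t n)%:C *: v - a) < 4 * rho.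
    by rewrite addrAC; apply: le_lt_trans (nvD _ _) _; have := tv n; lra.
  have r4 : 0 < 4 * rho by lra.
  have hg' : hol_bounded g a (8 * (4 * rho)) M by move=> x xa; apply: hg; lra.
  have wa4 : nv (w - a) < 4 * rho by lra.
  have := taylor2 r4 hg' wa4 wtv.
  have -> : 'D_((t n)%:C *: v) g w = (t n)%:C * 'D_v g w.
    by rewrite !deriveE ?linearZ//; apply: dg; lra.
  move=> H; have -> : q n w - 'D_v g w =
     (g (w + (t n)%:C *: v) - g w - (t n)%:C * 'D_v g w) / (t n)%:C.
    by rewrite /q /gquot; field; exact: tC.
  rewrite nvM nvV nv_real gtr0_norm// ler_pdivrMr//; apply: le_trans H _.
  by rewrite nvZ nv_real gtr0_norm// /K2 le_eqVlt; apply/orP; left; apply/eqP; ring.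
have dq n u : derivable (q n) a u by have [] := hq n a _; rewrite ?subrr ?nv0//;
  lra.
(* Cauchy's estimate for the difference of two quotients *)
have qCau u m n : nv ('D_u (q m) a - 'D_u (q n) a) <= K2 * nv u / rho * t m + K2
  * nv u / rho * t n.
  have -> : 'D_u (q m) a - 'D_u (q n) a = 'D_u (fun w => q m w - q n w) a.
    by have [_ ->] := cderB (derivableP (dq m u)) (derivableP (dq n u)).
  have h2 : hol_bounded (fun w => q m w - q n w) a (2 * rho) (K2 * (t m + t n)).
    move=> w wa; split.
      move=> u'; have [|d1 _] := hq m w; first lra.
      have [|d2 _] := hq n w; first lra.
      by have [] := cderB (derivableP (d1 u')) (derivableP (d2 u')).
    have -> : q m w - q n w = (q m w - 'D_v g w) - (q n w - 'D_v g w) by ring.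
    apply: le_trans (nvD _ _) _; rewrite nvN mulrDr; apply: lerD; exact: qD.
  have r2 : 0 < 2 * rho by lra.
  have := cauchy_estimate u r2 h2; rewrite -ler_pdivlMr// => H; apply: le_trans H _.
  by rewrite le_eqVlt; apply/orP; left; apply/eqP; field; rewrite gt_eqF.
have Lex u : exists l : C, forall n,
  nv ('D_u (q n) a - l) <= 2 * (K2 * nv u / rho * t n).
  by apply: (@complex_cauchy _ (fun n => 'D_u (q n) a)) => m n; exact: qCau.
have [L hL] := choice Lex.
have dqa n : differentiable (q n) a.
  rewrite /q /gquot.
  have -> : (fun x => (g (x + (t n)%:C *: v) - g x) / (t n)%:C) =
    (t n)%:C^-1 *: ((g \o shift ((t n)%:C *: v)) - g).
    by apply/funext => x; rewrite /= mulrC.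
  apply: differentiableZ; apply: differentiableB; last by apply: dg;
    rewrite subrr nv0; lra.
  apply: differentiable_comp; first exact: ex_diff.
  by apply: dg; rewrite /= addrAC subrr add0r; have := tv n; lra.
have K20 : 0 <= K2.
  have := qD 0%N a; rewrite subrr nv0 => /(_ ltac:(lra)) H.
  by have := le_trans (nv_ge0 _) H; rewrite pmulr_lge0.
have linL : linear L.
  move=> c u w; apply/eqP; rewrite -subr_eq0; apply/eqP.
  apply: (@nv_squeeze0 _ (2 * (K2 / rho * t0) * (nv (c *: u + w) + nv c * nv u +
    nv w))) => n.
  have E := derive_linear c u w (dqa n).
  have h1 := hL (c *: u + w) n; have h2 := hL u n; have h3 := hL w n.
  rewrite -[c *: L u]/(c * L u).
  move: E h1 h2 h3; move: ('D_(c *: u + w) (q n) a) ('D_u (q n) a) ('D_w (q n) a)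
    => d1 d2 d3 E.
  move: (L (c *: u + w)) (L u) (L w) => l1 l2 l3 h1 h2 h3.
  have -> : l1 - (c * l2 + l3) = - (d1 - l1) + (c * (d2 - l2) + (d3 - l3)) by
    rewrite E; ring.
  apply: le_trans (nvD _ _) _; rewrite nvN.
  have {}h2 : nv (c * (d2 - l2)) <= nv c * (2 * (K2 * nv u / rho * t n)).
    by rewrite nvM ler_wpM2l ?nv_ge0.
  have h4 := nvD (c * (d2 - l2)) (d3 - l3).
  have -> : 2 * (K2 / rho * t0) * (nv (c *: u + w) + nv c * nv u + nv w) / n.+1%:R =
    2 * (K2 * nv (c *: u + w) / rho * t n) +
    (nv c * (2 * (K2 * nv u / rho * t n)) + 2 * (K2 * nv w / rho * t n)).
    by rewrite /t; field; rewrite !gt_eqF.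
  lra.
have LK u : nv (L u) <= (2 * B / (8 * rho) + 2 * (K2 / rho * t 0%N)) * nv u.
  have -> : L u = 'D_u (q 0%N) a - ('D_u (q 0%N) a - L u) by ring.
  apply: le_trans (nvD _ _) _; rewrite nvN mulrDl; apply: lerD.
    rewrite mulrAC ler_pdivlMr; last lra.
    by apply: cauchy_estimate => //; lra.
  by apply: le_trans (hL u 0%N) _; rewrite le_eqVlt; apply/orP; left; apply/eqP;
    ring.
apply: (differentiable_nv linL LK).
have B0 : 0 <= B by have [|_] := hq 0%N a; [rewrite subrr nv0;
  lra|apply: le_trans; exact: nv_ge0].
have quad u : nv u < rho -> nv ('D_v g (a + u) - 'D_v g a - L u) <= B / rho ^+ 2
  * nv u ^+ 2.
  move=> ur; apply: le_of_addgt0 => e e0.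
  have [n hn] : exists n, (2 * K2 + 2 * (K2 * nv u / rho)) * t n <= e.
    have Ku : 0 <= K2 * nv u / rho.
      by apply: divr_ge0; [exact: (mulr_ge0 K20 (nv_ge0 u))|exact: ltW].
    set K3 := 2 * K2 + 2 * (K2 * nv u / rho); have K30 : 0 <= K3.
      by apply: addr_ge0; apply: mulr_ge0 => //; rewrite ler0n.
    exists (Num.truncn (K3 * t0 / e));
      rewrite /t mulrA ler_pdivrMr// [e * _]mulrC -ler_pdivrMr//.
    by apply: ltW; rewrite truncnS_gt// num_real.
  have uau : nv (a + u - a) < rho by rewrite addrAC subrr add0r.
  have aa : nv (a - a) < rho by rewrite subrr nv0.
  have uau2 : nv (a + u - a) < 2 * rho by lra.
  have aa2 : nv (a - a) < 2 * rho by lra.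
  have h1 := taylor2 rho0 (hq n) aa uau.
  have h2 : nv (q n (a + u) - 'D_v g (a + u)) <= K2 * t n := qD n _ uau2.
  have h3 : nv (q n a - 'D_v g a) <= K2 * t n := qD n _ aa2.
  have h4 := hL u n.
  move: h1 h2 h3 h4; move: (q n a) (q n (a + u)) ('D_u (q n) a) ('D_v g a) ('D_v
    g (a + u)) (L u).
  move=> qa qu dqa' da du Lu h1 h2 h3 h4.
  have -> : du - da - Lu = (qu - qa - dqa') + (- (qu - du) + ((qa - da) + (dqa' -
    Lu))) by ring.
  apply: le_trans (nvD _ _) _; apply: lerD => //.
  apply: le_trans (nvD _ _) _; rewrite nvN.
  have := nvD (qa - da) (dqa' - Lu); lra.
move=> e e0; have BB : 0 < B / rho ^+ 2 + 1.
  by rewrite ltr_wpDl// divr_ge0// exprn_ge0// ltW.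
exists (Num.min rho (e / (B / rho ^+ 2 + 1)));
  first by rewrite lt_min rho0 divr_gt0.
move=> u; rewrite lt_min => /andP[/quad H]; rewrite ltr_pdivlMr// => ue.
apply: le_trans H _; rewrite expr2 mulrA ler_wpM2r ?nv_ge0//.
by have := nv_ge0 u; nra.
Qed.

(** Directional derivatives of a holomorphic function are holomorphic. *)
Theorem derive_differentiable (V : normedModType C) (g : V -> C) (A : set V) :
  open A -> (forall z, A z -> differentiable g z) ->
  forall v z, A z -> differentiable ('D_v g) z.
Proof.
move=> /open_nvP oA dg v a Aa.
have [d d0 hd] := oA _ Aa.
have /continuous_nvP /(_ _ ltr01)[d' d'0 hd'] :=
  differentiable_continuous (dg _ Aa).
pose rho := Num.min d d' / 32.
have r0 : 0 < Num.min d d' by rewrite lt_min d0.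
have E : 32 * rho = Num.min d d' by rewrite /rho; field.
have inA w : nv (w - a) < 32 * rho -> A w.
  by rewrite E lt_min => /andP[/hd]; rewrite subrKC.
apply: (@derive_differentiable_at _ _ _ _ rho (nv (g a) + 1)).
- by rewrite /rho; lra.
- move=> w wa; split; first by move=> u; apply/diff_derivable/dg/inA.
  move: wa; rewrite E lt_min => /andP[_ /hd']; rewrite subrKC => H.
  by have := nvD (g w - g a) (g a); rewrite subrK; lra.
- by move=> w /inA/dg.
Qed.

End Differentiable.

(** * Maximum principle and coefficients of Schwarz functions *)

Section Schwarz.
Context {R : realType}.
Local Notation C := R[i].

(** The difference quotient is differentiable at 0, and its derivative there
    is half of the second derivative. *)
Lemma dquot_derive0 (f : C -> C) (r : R) : 0 < r ->
  (forall z : C, nv z < r -> derivable f z 1) -> derivable ('D_1 f) (0 : C) 1 ->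
  is_derive (0 : C) 1 (dquot f) ('D_1 ('D_1 f) 0 / 2).
Proof.
move=> r0 df /derivableP/is_derive_nvP ddf; apply/is_derive_nvP => e e0;
  have [d d0 hd] := ddf _ e0.
exists (Num.min d r); first by rewrite lt_min d0.
move=> h; rewrite lt_min -[h *: 1]/(h * 1) mulr1 -[h *: _]/(h * ('D_1 ('D_1 f) 0
  / 2)) add0r => /andP[hh hr].
have [->|h0] := eqVneq h 0; first by rewrite subrr mul0r subr0 nv0 mulr0.
set D1 : C := 'D_1 f 0; set D2 : C := 'D_1 ('D_1 f) 0.
have hseg (t : R) : 0 <= t <= 1 -> nv (t%:C * h) <= nv h.
  move=> t01; rewrite nvM nv_real ger0_norm; last by lra.
  by rewrite ler_piMl ?nv_ge0//; lra.
have H : nv ((f (0 + h) - D1 * (0 + h) - D2 / 2 * (0 + h) ^+ 2) - (f 0 - D1 * 0 -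
  D2 / 2 * 0 ^+ 2)) <= (e * nv h) * nv h.
  apply: (@complex_mean_value_le _ (fun w => f w - D1 * w - D2 / 2 * w ^+ 2)
    (fun w => 'D_1 f w - D1 - w * D2)) => t t01.
    have dfw : derivable f (0 + t%:C * h) 1.
      by apply: df; rewrite add0r; apply: le_lt_trans hr; exact: hseg.
    apply: is_derive_eq (cderB (cderB (derivableP dfw) (cderZ D1 (cder_id _)))
      (cderZ (D2 / 2) (cderX 2 (cder_id _)))) _.
    by rewrite expr1; field.
  have := hd (t%:C * h); rewrite -[(t%:C * h) *: 1]/((t%:C * h) * 1) mulr1 !add0r
    => H.
  apply: le_trans (H _) _; first exact: le_lt_trans (hseg _ t01) hh.
  by rewrite ler_wpM2l ?hseg// ltW.
rewrite /dquot (negbTE h0) eqxx -/D1.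
have -> : (f h - f 0) / h - D1 - h * (D2 / 2) =
  ((f (0 + h) - D1 * (0 + h) - D2 / 2 * (0 + h) ^+ 2) - (f 0 - D1 * 0 - D2 / 2 *
    0 ^+ 2)) / h.
  by rewrite add0r expr0n /=; field.
by rewrite nvM nvV ler_pdivrMr ?nv_gt0.
Qed.

Lemma nv_conj (z : C) : nv z^* = nv z.
Proof. by rewrite /nv normcJ. Qed.

(** The identity behind the Moebius transformation
    x |-> (x + a) / (1 + conj(a) x) of the unit disk. *)
Lemma moebius_identity (a x : C) :
  nv (1 + a^* * x) ^+ 2 - nv (x + a) ^+ 2 = (1 - nv a ^+ 2) * (1 - nv x ^+ 2).
Proof. by rewrite !sqr_nv; case: a => a1 a2; case: x => x1 x2 /=; ring. Qed.

Lemma sqr_lt1 (x : R) : 0 <= x -> x < 1 -> x ^+ 2 < 1.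
Proof. by move=> ? ?; rewrite expr_lt1. Qed.

Lemma moebius_lt1 (a x : C) : nv a < 1 -> nv x < 1 ->
  [/\ 1 + a^* * x != 0, 1 - nv a <= nv (1 + a^* * x) & nv ((x + a) / (1 + a^* *
    x)) < 1].
Proof.
move=> a1 x1; have h : 1 - nv a <= nv (1 + a^* * x).
  have := nvD (1 + a^* * x) (- (a^* * x)); rewrite addrK nvN nv1 nvM nv_conj.
  by have := nv_ge0 a; move: (nv a) (nv x) x1 {a1} => p q *; nra.
have p0 : 0 < nv (1 + a^* * x) by lra.
split => //; first by rewrite -nv_gt0.
rewrite nvM nvV ltr_pdivrMr// mul1r -ltr_sqr ?nnegrE ?nv_ge0//.
rewrite -subr_gt0 moebius_identity mulr_gt0// subr_gt0 sqr_lt1 ?nv_ge0//.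
Qed.

(** The form of the maximum principle needed for the Schwarz lemma: psi is
    bounded by 1 because |psi z| <= 1 / |z|, with 1 / |z| close to 1 near the
    unit circle. The Moebius transformation sending 0 to a point a moves the
    bound on circles to a. *)
Lemma max_principle (psi : C -> C) :
  (forall z : C, nv z < 1 -> derivable psi z 1) ->
  (forall z : C, z != 0 -> nv z < 1 -> nv (psi z) * nv z <= 1) ->
  forall z : C, nv z < 1 -> nv (psi z) <= 1.
Proof.
move=> dpsi hpsi a a1; rewrite leNgt; apply/negP => p1.
pose phi (x : C) : C := (x + a) / (1 + a^* * x).
have dk (z : C) : nv z < 1 -> derivable (fun x => psi (phi x)) z 1.
  move=> z1; have [n0 _ l1] := moebius_lt1 a1 z1.
  have dphi := cderM (cderD (cder_id z) (cder_cst a z 1))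
    (cderV (cderD (cder_cst 1 z 1) (cderZ a^* (cder_id z))) n0).
  by have [] := cder_comp dphi (derivableP (dpsi _ l1)).
have ck : {for 0, continuous (fun x => psi (phi x))}.
  by apply/differentiable_continuous/derivable1_diffP/dk; rewrite nv0.
set p := nv (psi a) in p1.
have A0 : 0 <= nv a by exact: nv_ge0.
pose c := (1 - nv a) ^+ 2.
have c0 : 0 < c by rewrite exprn_gt0//; lra.
have c1 : c <= 1 by rewrite /c; nra.
have pinv : 0 < 1 - p^-1 by rewrite subr_gt0 invf_lt1//; lra.
have pinv1 : p^-1 > 0 by rewrite invr_gt0; lra.
(* on the circle of radius 1 - d, |phi| is at least m > 1 / p: here c bounds
   |1 + conj(a) z|^2 from below, and 1 - (1 - d)^2 <= 2 d *)
pose d := c * (1 - p^-1) / 4.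
have d0 : 0 < d by rewrite divr_gt0// mulr_gt0.
have d1 : d <= 1 / 4 by rewrite /d; nra.
have s0 : 0 < 1 - d by lra.
have s1 : 1 - d < 1 by lra.
pose m := 1 - 2 * d / c.
have mE : m = 1 - (1 - p^-1) / 2 by rewrite /m /d; field; rewrite !gt_eqF//; lra.
have m0 : 0 < m by lra.
have := @circle_mean_le _ (fun x => psi (phi x)) (1 - d) 1 m^-1 s0 s1.
have -> : psi (phi 0) = psi a by rewrite /phi add0r mulr0 addr0 divr1.
rewrite -/p => H; have {H} : p <= m^-1.
  apply: H; [by move=> z _; exact: dk|exact: ck|].
  move=> z zE; have z1 : nv z < 1 by rewrite zE.
  have [n0 ln l1] := moebius_lt1 a1 z1.
  have E : nv (phi z) ^+ 2 = 1 - (1 - nv a ^+ 2) * (1 - (1 - d) ^+ 2) / nv (1 +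
    a^* * z) ^+ 2.
    rewrite -zE -moebius_identity /phi nvM nvV.
    have : nv (1 + a^* * z) != 0 by rewrite nv_eq0.
    by move: (nv (1 + a^* * z)) (nv (z + a)) => X Y X0; field.
  have lb : m <= nv (phi z) ^+ 2.
    rewrite E /m lerD2l lerN2 ler_pdivrMr ?exprn_gt0 ?nv_gt0//.
    rewrite mulrAC ler_pdivlMr//.
    have : c <= nv (1 + a^* * z) ^+ 2 by rewrite /c ler_sqr ?nnegrE ?nv_ge0//; lra.
    have := sqr_ge0 (nv a).
    have : nv a ^+ 2 <= 1 by apply: ltW; exact: sqr_lt1.
    move: (nv _ ^+ 2) (nv a ^+ 2) => X Y hY Y0 hX.
    have h1 : (1 - Y) * (1 - (1 - d) ^+ 2) <= 2 * d by nra.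
    have : 0 <= 2 * d by lra.
    have : 0 <= 1 - (1 - d) ^+ 2 by nra.
    nra.
  have np : 0 < nv (phi z).
    by rewrite lt_neqAle nv_ge0 andbT eq_sym; apply/eqP => h; move: lb;
      rewrite h; nra.
  have lb2 : m <= nv (phi z) by move: lb l1; rewrite -/(phi z); nra.
  rewrite -[m^-1]mul1r ler_pdivlMr//.
  apply: le_trans (hpsi (phi z) _ l1); last by rewrite -nv_gt0.
  by rewrite ler_wpM2l ?nv_ge0.
rewrite -[m^-1]mul1r ler_pdivlMr// mE.
have : p * p^-1 = 1 by rewrite mulfV// gt_eqF//; lra.
move: (p^-1) => y; nra.
Qed.

Lemma open_ball1 : open [set z : C | nv z < 1].
Proof.
apply/open_nvP => z /= z1; exists (1 - nv z); first lra.
by move=> h hh; apply: le_lt_trans (nvD _ _) _; lra.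
Qed.

Lemma derive1_derivable (f : C -> C) : (forall z :
  C, nv z < 1 -> derivable f z 1) ->
  forall z : C, nv z < 1 -> derivable ('D_1 f) z 1.
Proof.
move=> df z z1; apply/derivable1_diffP.
apply: (derive_differentiable open_ball1) => // w /= w1.
exact/derivable1_diffP/df.
Qed.

Lemma dquot_derivable_disk (f : C -> C) : (forall z :
  C, nv z < 1 -> derivable f z 1) ->
  forall z : C, nv z < 1 -> derivable (dquot f) z 1.
Proof.
move=> df z z1; have [->|z0] := eqVneq z 0; last by apply: dquot_derivable => //;
  exact: df.
have [] // := @dquot_derive0 f 1 ltr01 df _.
by apply: derive1_derivable => //; rewrite nv0.
Qed.

(** The Schwarz lemma, stated for the quotient w z / z. *)
Lemma schwarz_lemma (w : C -> C) : (forall z : C, nv z < 1 -> derivable w z 1) ->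
  (forall z : C, nv z < 1 -> nv (w z) <= 1) -> w 0 = 0 ->
  forall z : C, nv z < 1 -> nv (dquot w z) <= 1.
Proof.
move=> dw w1 w0; apply: max_principle; first exact: dquot_derivable_disk.
move=> z z0 z1; rewrite /dquot (negbTE z0) w0 subr0 -nvM divfK//.
exact: w1.
Qed.

(** The Schwarz-Pick inequality at the centre. *)
Lemma schwarz_pick0 (psi : C -> C) : (forall z :
  C, nv z < 1 -> derivable psi z 1) ->
  (forall z : C, nv z < 1 -> nv (psi z) <= 1) ->
  nv ('D_1 psi 0) <= 1 - nv (psi 0) ^+ 2.
Proof.
move=> dpsi hpsi.
have z01 : nv (0 : C) < 1 by rewrite nv0.
set c := psi 0; have c1 : nv c <= 1 by exact: hpsi.
(* the factor t < 1 keeps the denominator of the Moebius transformation away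
     from 0; it tends to 1 at the end *)
have key (t : R) : 0 < t -> t < 1 -> t * nv ('D_1 psi 0) <= 1 - t ^+ 2 * nv c ^+ 2.
  move=> t0 t1; pose a : C := - (t%:C * c).
  have na : nv a = t * nv c by rewrite nvN nvM nv_real gtr0_norm.
  have a1 : nv a < 1 by rewrite na; have := nv_ge0 c; nra.
  have tp (z : C) : nv z < 1 -> nv (t%:C * psi z) < 1.
    by move=> /hpsi h; rewrite nvM nv_real gtr0_norm//; have := nv_ge0 (psi z);
      move: (nv (psi z)) h => x *; nra.
  pose b (z : C) : C := (t%:C * psi z + a) / (1 + a^* * (t%:C * psi z)).
  have db (z : C) : nv z < 1 -> is_derive z 1 b
     ((t%:C * 'D_1 psi z + 0) * (1 + a^* * (t%:C * psi z))^-1 + (t%:C * psi z + a) *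
       (- (0 + a^* * (t%:C * 'D_1 psi z)) / (1 + a^* * (t%:C * psi z)) ^+ 2)).
    move=> z1; have [n0 _ _] := moebius_lt1 a1 (tp _ z1).
    have h1 := cderZ t%:C (derivableP (dpsi _ z1)).
    exact: (cderM (cderD h1 (cder_cst a z 1)) (cderV (cderD (cder_cst 1 z 1)
      (cderZ a^* h1)) n0)).
  have h : nv (dquot b 0) <= 1.
    apply: (@schwarz_lemma b _ _ _ 0 z01).
    - by move=> z /db[].
    - by move=> z /tp z1; have [_ _ /ltW] := moebius_lt1 a1 z1.
    - by rewrite /b /a -/c subrr mul0r.
  move: h; rewrite /dquot eqxx; have [_ ->] := db _ z01.
  rewrite -/c /a subrr mul0r !addr0.
  have -> : 1 + (- (t%:C * c))^* * (t%:C * c) = (1 - t ^+ 2 * nv c ^+ 2)%:C.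
    rewrite sqr_nv; case: (c) => x y; apply/eqP; rewrite eq_complex /=.
    by apply/andP; split; apply/eqP; ring.
  have pos : 0 < 1 - t ^+ 2 * nv c ^+ 2.
    by rewrite -exprMn -na subr_gt0 sqr_lt1 ?nv_ge0.
  rewrite nvM nvV nv_real nvM nv_real !gtr0_norm// ler_pdivrMr// mul1r; exact.
apply: le_of_addgt0 => e e0.
have := nv_ge0 c; have := nv_ge0 ('D_1 psi 0); move: key c1.
move: (nv ('D_1 psi 0)) (nv c) => x y key y1 x0 y0.
pose d := Num.min (1 / 2) (e / (x + 2)).
have dh : d <= 1 / 2 by rewrite /d ge_min lexx.
have x2 : 0 < x + 2 by lra.
have d0 : 0 < d by rewrite lt_min !divr_gt0.
have de : d * (x + 2) <= e by rewrite -ler_pdivlMr;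
  [rewrite /d ge_min lexx orbT|lra].
have := key (1 - d); move=> /(_ ltac:(lra) ltac:(lra)).
have : y ^+ 2 <= 1 by rewrite expr_le1.
have := sqr_ge0 y; move: (y ^+ 2) => Y; nra.
Qed.

(** The bounds |c1| <= 1 and |c2| <= 1 - |c1|^2 for the Taylor coefficients of a
    Schwarz function. *)
Lemma schwarz_coefs (w : C -> C) : (forall z : C, nv z < 1 -> derivable w z 1) ->
  (forall z : C, nv z < 1 -> nv (w z) <= 1) -> w 0 = 0 ->
  nv ('D_1 w 0) <= 1 /\ nv ('D_1 ('D_1 w) 0 / 2) <= 1 - nv ('D_1 w 0) ^+ 2.
Proof.
move=> dw w1 w0; have z01 : nv (0 : C) < 1 by rewrite nv0.
have E : 'D_1 w 0 = dquot w 0 by rewrite /dquot eqxx.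
have h := schwarz_lemma dw w1 w0; split; first by rewrite E; exact: h.
have [_ <-] := dquot_derive0 ltr01 dw (derive1_derivable dw z01).
by rewrite E; exact: (schwarz_pick0 (dquot_derivable_disk dw) h).
Qed.

End Schwarz.

(** * Coefficients under subordination *)

Section Coefficients.
Context {R : realType}.
Local Notation C := R[i].

Lemma cder_unique (V : normedModType C) (f : V -> C) (x v : V) a b :
  is_derive x v f a -> is_derive x v f b -> a = b.
Proof. by case=> _ <- [_ <-]. Qed.

Lemma derive_eq_disk (f g : C -> C) (z a b : C) : nv z < 1 ->
  (forall x : C, nv x < 1 -> f x = g x) ->
  is_derive z 1 f a -> is_derive z 1 g b -> a = b.
Proof.
move=> z1 fg fa; apply: cder_unique; apply: cder_near fa _.
exists (1 - nv z); first by rewrite subr_gt0.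
by move=> h hh; apply: fg; apply: le_lt_trans (nvD _ _) _; rewrite -ltrBrDl.
Qed.

(** The relation f + s f' = f * (Phi o w) is differentiated twice at 0; the
    derivatives are named so that they can be treated as independent functions. *)
Lemma coef_relation_derivs (f f1 f2 f3 Phi P1 P2 w w1 w2 : C -> C) :
  (forall z : C, nv z < 1 -> is_derive z 1 f (f1 z)) ->
  (forall z : C, nv z < 1 -> is_derive z 1 f1 (f2 z)) ->
  (forall z : C, nv z < 1 -> is_derive z 1 f2 (f3 z)) ->
  (forall z : C, nv z < 1 -> is_derive z 1 Phi (P1 z)) ->
  (forall z : C, nv z < 1 -> is_derive z 1 P1 (P2 z)) ->
  (forall z : C, nv z < 1 -> is_derive z 1 w (w1 z)) ->
  (forall z : C, nv z < 1 -> is_derive z 1 w1 (w2 z)) ->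
  (forall z : C, nv z < 1 -> nv (w z) < 1) -> w 0 = 0 -> Phi 0 = 1 -> f 0 = 1 ->
  (forall z : C, nv z < 1 -> f z + z * f1 z = f z * Phi (w z)) ->
  f1 0 = P1 0 * w1 0 /\
  f2 0 / 2 = (f1 0 ^+ 2 + P2 0 / 2 * w1 0 ^+ 2 + P1 0 * (w2 0 / 2)) / 2.
Proof.
move=> hf hf1 hf2 hP hP1 hw hw1 wU w0 P0 f0 rel.
have z01 : nv (0 : C) < 1 by rewrite nv0.
have rel1 (z : C) : nv z < 1 -> f1 z + (1 * f1 z + z * f2 z) =
    f1 z * Phi (w z) + f z * (P1 (w z) * w1 z).
  move=> z1; have L := cderD (hf _ z1) (cderM (cder_id z) (hf1 _ z1)).
  have Rr := cderM (hf _ z1) (cder_comp (hw _ z1) (hP _ (wU _ z1))).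
  exact: (@derive_eq_disk (fun x => f x + x * f1 x) (fun x =>
    f x * Phi (w x)) z _ _ z1 rel L Rr).
have E1 : f1 0 = P1 0 * w1 0.
  have := rel1 _ z01; rewrite w0 P0 f0; move: (f1 0) (f2 0) (P1 0 * w1 0) => a b c.
  by rewrite !mul1r mul0r addr0 mulr1 => /addrI.
split; first exact: E1.
have h1 := hf1 _ z01; have h2 := hf2 _ z01.
have L := cderD h1 (cderD (cderM (cder_cst 1 (0:C) 1) h1) (cderM (cder_id 0) h2)).
have Pw := cder_comp (hw _ z01) (hP _ (wU _ z01)).
have P1w := cder_comp (hw _ z01) (hP1 _ (wU _ z01)).
have Rr := cderD (cderM h1 Pw) (cderM (hf _ z01) (cderM P1w (hw1 _ z01))).
have := @derive_eq_disk (fun z => f1 z + (1 * f1 z + z * f2 z))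
  (fun z => f1 z * Phi (w z) + f z * (P1 (w z) * w1 z)) 0 _ _ z01 rel1 L Rr.
rewrite w0 P0 f0 E1.
move: (f1 0) (P1 0) (w1 0) (f2 0) (P2 0) (w2 0) (f3 0) => a p c f'' q c' f''' H.
have {}H : f'' + f'' = (p * c) ^+ 2 + (p * c) ^+ 2 + q * c ^+ 2 + p * c'.
  apply: (@addrI _ f''); rewrite expr2.
  by transitivity (f'' + (0 * (p * c) + 1 * f'' + (1 * f'' + 0 * f''')));
    [|rewrite H]; ring.
have -> : f'' = (f'' + f'') / 2 by field.
by rewrite H; field.
Qed.

(** With f = 1 + b2 s + b3 s^2 + ..., Phi = 1 + B1 s + B2 s^2 + ... and
    w = c1 s + c2 s^2 + ..., these are b2 = B1 c1 and
    2 b3 = b2^2 + B2 c1^2 + B1 c2. *)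
Lemma coef_relation (f Phi w : C -> C) :
  (forall z : C, nv z < 1 -> derivable f z 1) ->
  (forall z : C, nv z < 1 -> derivable Phi z 1) ->
  (forall z : C, nv z < 1 -> derivable w z 1) ->
  (forall z : C, nv z < 1 -> nv (w z) < 1) -> w 0 = 0 -> Phi 0 = 1 -> f 0 = 1 ->
  (forall z : C, nv z < 1 -> f z + z * 'D_1 f z = f z * Phi (w z)) ->
  'D_1 f 0 = 'D_1 Phi 0 * 'D_1 w 0 /\
  'D_1 ('D_1 f) 0 / 2 = ('D_1 f 0 ^+ 2 + 'D_1 ('D_1 Phi) 0 / 2 * 'D_1 w 0 ^+ 2
     + 'D_1 Phi 0 * ('D_1 ('D_1 w) 0 / 2)) / 2.
Proof.
have D1 (h : C -> C) : (forall z : C, nv z < 1 -> derivable h z 1) ->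
    forall z : C, nv z < 1 -> is_derive z 1 h ('D_1 h z).
  by move=> dh z /dh/derivableP.
move=> df dP dw.
have df1 := derive1_derivable df; have dP1 := derive1_derivable dP.
have df2 := derive1_derivable df1; have dw1 := derive1_derivable dw.
exact: (coef_relation_derivs (D1 _ df) (D1 _ df1) (D1 _ df2) (D1 _ dP) (D1 _ dP1)
  (D1 _ dw) (D1 _ dw1)).
Qed.

Lemma coef_bound (p q : R) (c1 c2 b2 b3 : C) :
  0 < p -> 2 * p <= `|q + 2 * p ^+ 2| ->
  nv c1 <= 1 -> nv c2 <= 1 - nv c1 ^+ 2 -> b2 = p%:C * c1 ->
  b3 = (b2 ^+ 2 + q%:C / 2 * c1 ^+ 2 + p%:C * c2) / 2 ->
  nv (b3 ^+ 2 - b2 ^+ 2) <= p ^+ 2 + (q + 2 * p ^+ 2) ^+ 2 / 16.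
Proof.
move=> p0 pq h1 h2 -> ->; set b3' := _ / 2.
pose S := `|q + 2 * p ^+ 2|.
(* b3 is half of p c2 + (q/2 + p^2) c1^2, and S / 2 = |q/2 + p^2| *)
have H3 : nv b3' <= S / 4.
  have -> : b3' = ((q + 2 * p ^+ 2)%:C / 2 * c1 ^+ 2 + p%:C * c2) / 2.
    by rewrite /b3' rmorphD rmorphM rmorphXn /= realC2; field.
  rewrite nv_half; have := nvD ((q + 2 * p ^+ 2)%:C / 2 * c1 ^+ 2) (p%:C * c2).
  rewrite nvM nv_half nv_real nvX [nv (p%:C * _)]nvM nv_real (gtr0_norm p0) -/S.
  have X1 : nv c1 ^+ 2 <= 1 by rewrite expr_le1 ?nv_ge0.
  set N := nv (_ + _) => hN; move: h2 pq; rewrite -/S.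
  move: (nv c2) (nv c1 ^+ 2) X1 (sqr_ge0 (nv c1)) hN => y X X1 X0 hN h2 pq.
  have h3 : p * y <= p * (1 - X) by rewrite ler_wpM2l// ltW.
  have h4 : 2 * p * (1 - X) <= S * (1 - X) by rewrite ler_wpM2r// subr_ge0.
  nra.
have H2 : nv (p%:C * c1) <= p.
  by rewrite nvM nv_real gtr0_norm// ler_piMr// ltW.
apply: le_trans (nvD _ _) _; rewrite nvN !nvX addrC; apply: lerD.
  by rewrite ler_sqr ?nnegrE ?nv_ge0 ?(ltW p0).
have -> : (q + 2 * p ^+ 2) ^+ 2 / 16 = (S / 4) ^+ 2.
  by rewrite expr_div_n real_normK ?num_real//; field.
have S0 : 0 <= S / 4 by rewrite divr_ge0// normr_ge0.
by rewrite ler_sqr ?nnegrE ?nv_ge0 ?S0.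
Qed.

End Coefficients.

(** * Directional derivatives of a function with continuous partial derivatives *)

Section Euler.
Context {R : realType} {n : nat}.
Local Notation C := R[i].
Variable rho : 'cV[C]_n -> R.
Implicit Types (y z v : 'cV[C]_n).

Lemma real_line_is_derive y v (u : R) :
  derivable (real_line rho (y + u%:C *: v) v) 0 1 ->
  is_derive u 1 (fun s : R => rho (y + s%:C *: v)) (real_derive rho v (y + u%:C
    *: v)).
Proof.
move=> /derivableP /is_derive_realP H; apply/is_derive_realP => e e0.
have [d d0 hd] := H _ e0; exists d; first exact: d0.
move=> t td; have := hd t td.
have -> : real_derive rho v (y + u%:C *: v) = 'D_1 (real_line rho (y + u%:C *: v)
  v) (0 : R).
  by rewrite /real_derive derive1E.
have -> : real_line rho (y + u%:C *: v) v (0 + t) = rho (y + (u + t)%:C *: v).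
  by rewrite /real_line add0r rmorphD /= scalerDl addrA.
have -> : real_line rho (y + u%:C *: v) v 0 = rho (y + u%:C *: v).
  by rewrite /real_line scale0r addr0.
exact.
Qed.

(** The real derivative of rho in the direction v exists and is continuous away
    from the origin. *)
Definition partial_ok (v : 'cV[C]_n) := forall z, z != 0 ->
  derivable (real_line rho z v) 0 1 /\ {for z, continuous (real_derive rho v)}.

(** An increment s of rho in the direction v is s times the derivative at z,
    uniformly for base points y near z. *)
Lemma real_partial_increment v z (e : R) : partial_ok v -> z != 0 -> 0 < e ->
  exists2 d : R, 0 < d & forall y (s : R), nv (y - z) < d -> `|s| < d ->
  `|rho (y + s%:C *: v) - rho y - s * real_derive rho v z| <= e * `|s|.
Proof.
move=> ok z0 e0; have [_ cz] := ok _ z0.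
have : \forall y \near z, `|real_derive rho v z - real_derive rho v y| < e.
  by move/cvgrPdist_lt : cz; exact.
move=> /nbhs_nvP[d1 d10 hd1].
have nz : 0 < nv z by rewrite nv_gt0.
pose d := Num.min d1 (nv z).
have d0 : 0 < d by rewrite lt_min d10.
have v0 : 0 < nv v + 1 by rewrite ltr_wpDl ?nv_ge0.
exists (Num.min (d / 2) (d / (2 * (nv v + 1)))).
  by rewrite lt_min !divr_gt0// mulr_gt0.
move=> y s; rewrite !lt_min => /andP[yz _] /andP[_].
rewrite ltr_pdivlMr ?mulr_gt0// => sd.
have near_z (t : R) : 0 <= t <= 1 -> nv (y + (s * t)%:C *: v - z) < d.
  move=> t01; rewrite addrAC; apply: le_lt_trans (nvD _ _) _.
  rewrite nvZ nv_real normrM [`|t|]ger0_norm; last lra.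
  have : `|s| * t * nv v <= `|s| * nv v.
    by rewrite ler_wpM2r ?nv_ge0// ler_piMr//; lra.
  have := normr_ge0 s; nra.
have neq0 y' : nv (y' - z) < d -> y' != 0.
  move=> h; apply/eqP => E; move: h;
    rewrite E sub0r nvN ltNge /d ge_min lexx orbT//.
have H (t : R) : 0 <= t <= 1 -> is_derive t 1 (fun t :
  R => rho (y + (s * t)%:C *: v))
    (s * real_derive rho v (y + (s * t)%:C *: v)).
  move=> t01; have [dr _] := ok _ (neq0 _ (near_z _ t01)).
  have D1 := real_line_is_derive dr.
  have D2 : is_derive t 1 (fun t : R => s * t) s.
    by apply: is_derive_eq; rewrite -[_ *: _]/(_ * _) mulr1.
  have := is_derive1_comp (f := fun u : R => rho (y + u%:C *: v)) (g :=
    fun t : R => s * t) D1 D2.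
  by move=> h; apply: is_derive_eq h _; rewrite mulrC.
have [|||c c01] := @MVT_segment R (fun t : R => rho (y + (s * t)%:C *: v))
    (fun t => s * real_derive rho v (y + (s * t)%:C *: v)) 0 1.
- exact: ler01.
- by move=> x; rewrite in_itv /= => /andP[x0 x1]; apply: H; rewrite !ltW.
- by apply: derivable_within_continuous => x; rewrite in_itv /= => /H[].
rewrite subr0 mulr1 mulr0 scale0r addr0 mulr1 => ->.
rewrite -mulrBr normrM mulrC ler_wpM2r//.
have := near_z c; rewrite in_itv /= in c01 => /(_ c01) h; rewrite distrC;
  apply: ltW.
have := hd1 (y + (s * c)%:C *: v - z); rewrite subrKC; apply.
by apply: lt_le_trans h _; rewrite /d ge_min lexx.
Qed.

(** Continuous partial derivatives give the derivative in any real combination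
    of the directions, by adding the increments one direction at a time. *)
Lemma total_derivative (I : Type) (r : seq I) (v : I -> 'cV[C]_n) (c : I -> R) z :
  (forall k, partial_ok (v k)) -> z != 0 -> forall e : R, 0 < e ->
  exists2 d : R, 0 < d & forall t : R, `|t| < d ->
  `|rho (z + t%:C *: \sum_(k <- r) (c k)%:C *: v k) - rho z
    - t * \sum_(k <- r) c k * real_derive rho (v k) z| <= e * `|t|.
Proof.
move=> ok z0; elim: r => [|k r IH] e e0.
  exists 1 => // t _; rewrite !big_nil scaler0 addr0 mulr0 !subrr normr0.
  by rewrite mulr_ge0// ltW.
have e2 : 0 < e / 2 by lra.
have [d1 d10 h1] := IH _ e2.
have c0 : 0 < `|c k| + 1 by rewrite ltr_wpDl.
have e3 : 0 < e / (2 * (`|c k| + 1)) by rewrite divr_gt0// mulr_gt0.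
have [d2 d20 h2] := real_partial_increment (ok k) z0 e3.
set S := \sum_(k <- r) (c k)%:C *: v k in h1 *.
have S0 : 0 < nv S + 1 by rewrite ltr_wpDl ?nv_ge0.
exists (Num.min d1 (Num.min (d2 / (nv S + 1)) (d2 / (`|c k| + 1)))).
  by rewrite !lt_min d10 !divr_gt0.
move=> t; rewrite !lt_min !ltr_pdivlMr// => /and3P[/h1 H1 tS tc].
rewrite !big_cons -/S.
have H2 : `|t| * nv S < d2 by apply: le_lt_trans tS; rewrite ler_wpM2l// lerDl.
have H3 : `|t| * `|c k| < d2 by apply: le_lt_trans tc; rewrite ler_wpM2l// lerDl.
have := h2 (z + t%:C *: S) (t * c k).
rewrite [z + _ - z]addrAC subrr add0r nvZ nv_real normrM => /(_ H2 H3).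
have -> : z + t%:C *: ((c k)%:C *: v k + S) = z + t%:C *: S + (t * c k)%:C *: v k.
  by rewrite scalerDr scalerA -rmorphM addrA addrAC.
move: (rho (_ + (t * c k)%:C *: v k)) H1 => A; move: (rho (z + t%:C *: S)) => B.
move: (rho z) (real_derive rho (v k) z) (\sum_(j <- r) _) => Z D T H1 H4.
have -> : A - Z - t * (c k * D + T) = (A - B - t * c k * D) + (B - Z - t * T) by
  ring.
apply: le_trans (ler_normD _ _) _.
have : e / (2 * (`|c k| + 1)) * (`|t| * `|c k|) <= e / 2 * `|t|.
  have -> : e / 2 * `|t| = e / (2 * (`|c k| + 1)) * (`|t| * (`|c k| + 1)).
    by field; rewrite gt_eqF.
  by apply: ler_wpM2l; [exact: ltW|apply: ler_wpM2l => //; rewrite lerDl].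
lra.
Qed.

End Euler.

(** * Euler's identity for the Minkowski functional *)

Section EulerIdentity.
Context {R : realType} {n : nat}.
Local Notation C := R[i].
Variables (Omega : set 'cV[C]_n) (rho : 'cV[C]_n -> R).
Hypothesis hrho : minkowski_functional Omega rho.
Hypothesis hC1 : C1_off_origin rho.
Implicit Types (u v z : 'cV[C]_n).

Lemma minkowski_scale (t : C) z : rho (t *: z) = nv t * rho z.
Proof.
by have [_ _ _ h _] := hrho; apply: complexI; rewrite h rmorphM /= nvE.
Qed.

Lemma minkowski_ge0 z : 0 <= rho z.
Proof. by have [_ h _ _ _] := hrho. Qed.

Lemma minkowski_gt0 z : z != 0 -> 0 < rho z.
Proof.
move=> z0; rewrite lt_neqAle minkowski_ge0 andbT eq_sym.
by have [_ _ h _ _] := hrho; apply: contra z0 => /eqP/h ->.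
Qed.

Lemma minkowski_normalize z : z != 0 -> rho ((rho z)%:C^-1 *: z) = 1.
Proof.
move=> z0; have r0 := minkowski_gt0 z0.
by rewrite minkowski_scale nvV nv_real gtr0_norm// mulVf// gt_eqF.
Qed.

Lemma minkowski_mem z : Omega z <-> rho z < 1.
Proof. by have [_ _ _ _ ->] := hrho. Qed.

(** The 2n real coordinate directions: the pair (false, j) stands for the real
    part and (true, j) for the imaginary part of the j-th coordinate. *)
Definition dirvec (k : bool * 'I_n) : 'cV[C]_n :=
  if k.1 then 'i%C *: stdvec k.2 else stdvec k.2.

(** The real coordinates of u in the directions [dirvec]. *)
Definition dircoef u (k : bool * 'I_n) : R :=
  if k.1 then complex.Im (u k.2 0) else complex.Re (u k.2 0).

Lemma sum_bool_pair (A : nmodType) (F : bool * 'I_n -> A) :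
  \sum_k F k = \sum_j (F (false, j) + F (true, j)).
Proof.
rewrite big_split /= addrC.
have -> : \sum_j F (true, j) + \sum_j F (false, j) = \sum_b \sum_j F (b,
  j) by rewrite big_bool.
by rewrite pair_bigA /=; apply: eq_bigr => -[].
Qed.

Lemma dirsum u : u = \sum_k (dircoef u k)%:C *: dirvec k.
Proof.
rewrite sum_bool_pair; apply/matrixP => i j; rewrite ord1 summxE (bigD1 i)//= big1.
  rewrite /dircoef /dirvec /= !mxE !eqxx addr0 /= !mulr1 mulrC.
  by rewrite -complexE.
move=> k ki; rewrite !mxE [i == k]eq_sym (negbTE ki) /=.
by rewrite !mulr0 addr0.
Qed.

Lemma dirvec_partial_ok k : partial_ok rho (dirvec k).
Proof.
move=> z z0; case: k => -[] j; rewrite /dirvec /=; apply: (@hC1 j) => //;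
  [right|left]; reflexivity.
Qed.

(** The real derivative of rho at z in the direction u, from the partial
    derivatives. *)
Definition dirder u z : R := \sum_k dircoef u k * real_derive rho (dirvec k) z.

Lemma dirderP u z : z != 0 -> forall e : R, 0 < e ->
  exists2 d : R, 0 < d & forall t : R, `|t| < d ->
  `|rho (z + t%:C *: u) - rho z - t * dirder u z| <= e * `|t|.
Proof.
move=> z0 e e0; have := total_derivative (index_enum _) (dircoef u)
  dirvec_partial_ok z0 e0.
by rewrite -dirsum.
Qed.

(** Homogeneity of rho along the real ray through z. *)
Lemma dirder_self z : z != 0 -> dirder z z = rho z.
Proof.
move=> z0; apply/eqP; rewrite eq_sym -subr_eq0 -normr_eq0 eq_le normr_ge0 andbT.
apply/ler_addgt0Pr => e e0; rewrite add0r.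
have [d d0 hd] := dirderP z z0 e0.
pose t := Num.min (d / 2) (1 / 2).
have t0 : 0 < t by rewrite lt_min !divr_gt0.
have td : t <= d / 2 by rewrite ge_min lexx.
have := hd t; rewrite gtr0_norm// => /(_ ltac:(lra)).
have -> : z + t%:C *: z = (1 + t%:C) *: z by rewrite scalerDl scale1r.
rewrite minkowski_scale -[1]/((1 : R)%:C) -rmorphD nv_real (gtr0_norm (x :=
  1 + t)); last by lra.
have -> : (1 + t) * rho z - rho z - t * dirder z z = t * (rho z - dirder z z) by
  ring.
by rewrite normrM (gtr0_norm t0) mulrC ler_pM2r.
Qed.

(** rho is constant to first order in the direction i z, because |1 + i t| is
    1 + O(t^2). *)
Lemma dirder_rot z : z != 0 -> dirder ('i%C *: z) z = 0.
Proof.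
move=> z0; apply/eqP; rewrite -normr_eq0 eq_le normr_ge0 andbT.
apply/ler_addgt0Pr => e e0; rewrite add0r.
have e2 : 0 < e / 2 by rewrite divr_gt0.
have [d d0 hd] := dirderP ('i%C *: z) z0 e2.
have r0 := minkowski_gt0 z0.
pose t := Num.min (d / 2) (e / (2 * rho z)).
have t0 : 0 < t by rewrite lt_min !divr_gt0// mulr_gt0.
have td : t <= d / 2 by rewrite ge_min lexx.
have te : t * rho z <= e / 2.
  have : t <= e / (2 * rho z) by rewrite ge_min lexx orbT.
  by rewrite ler_pdivlMr ?mulr_gt0//; lra.
have := hd t; rewrite gtr0_norm// => /(_ ltac:(lra)).
have -> : z + t%:C *: ('i%C *: z) = (1 + t%:C * 'i%C) *: z by rewrite scalerDl
  scale1r scalerA.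
rewrite minkowski_scale.
have Nsq : nv (1 + t%:C * 'i%C) ^+ 2 = 1 + t ^+ 2.
  by rewrite sqr_nv /=; ring.
have := nv_ge0 (1 + t%:C * 'i%C : C); move: (nv _) Nsq => N Nsq N0 H.
have N1 : 1 <= N by nra.
have N2 : N - 1 <= t ^+ 2 by nra.
have H2 : `|t * dirder ('i%C *: z) z| <= e / 2 * t + t ^+ 2 * rho z.
  have -> : t * dirder ('i%C *: z) z = - (N * rho z - rho z - t * dirder ('i%C *:
    z) z) + (N - 1) * rho z by ring.
  apply: le_trans (ler_normD _ _) _; rewrite normrN; apply: lerD => //.
  by rewrite ger0_norm; nra.
move: H2; rewrite normrM (gtr0_norm t0) => H2.
rewrite -(ler_pM2l t0); apply: le_trans H2 _; nra.
Qed.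

(** Euler's identity: the real part comes from the derivative along z and the
    imaginary part from the derivative along i z. *)
Lemma wirtinger_mul_self z : z != 0 -> wirtinger_mul rho z z = (rho z)%:C / 2.
Proof.
move=> z0; have h1 := dirder_self z0; have h2 := dirder_rot z0.
have key : \sum_j wirtinger rho z 0 j * z j 0 + 'i%C * (dirder ('i%C *: z) z)%:C
  / 2 =
    (dirder z z)%:C / 2; last first.
  by move: key; rewrite h2 rmorph0 mulr0 mul0r addr0 h1 /wirtinger_mul mxE.
rewrite /dirder !sum_bool_pair !rmorph_sum /= mulr_sumr !mulr_suml -big_split /=.
apply: eq_bigr => j _; rewrite /dircoef /dirvec /= !mxE.
move: (real_derive _ _ _) (real_derive _ _ _) => a b.
rewrite mulrAC -mulrDl; congr (_ / _).
by case: (z j 0) => x y; apply/eqP; rewrite eq_complex /=; apply/andP; split;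
  apply/eqP; ring.
Qed.

Lemma wirtinger_mulZ z (c : C) v :
  wirtinger_mul rho z (c *: v) = c * wirtinger_mul rho z v.
Proof. by rewrite /wirtinger_mul -scalemxAr mxE. Qed.

Lemma wirtinger_mul_line z (c : C) : z != 0 ->
  2 * wirtinger_mul rho z (c *: z) = c * (rho z)%:C.
Proof. by move=> z0; rewrite wirtinger_mulZ wirtinger_mul_self//; field. Qed.

End EulerIdentity.

(** * Partial derivatives and the Jacobian of z g(z) *)

Section Coordinates.
Context {R : realType} {n : nat}.
Local Notation C := R[i].
Local Notation V := 'cV[C]_n.
Implicit Types (g h : V -> C) (a v w z : V).

Lemma is_derive_coord (j : 'I_n) a v : is_derive a v (fun w : V => w j 0) (v j 0).
Proof.
apply/is_derive_nvP => e e0; exists 1 => // t _.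
rewrite !mxE -[t *: v j 0]/(t * v j 0).
have -> : a j 0 + t * v j 0 - a j 0 - t * v j 0 = 0 by ring.
by rewrite nv0 mulr_ge0 ?nv_ge0// ltW.
Qed.

Lemma cV_sum_stdvec z : z = \sum_j z j 0 *: stdvec j.
Proof.
apply/matrixP => i j; rewrite ord1 summxE (bigD1 i)//= big1.
  by rewrite !mxE !eqxx addr0 mulr1.
by move=> k ki; rewrite !mxE [i == k]eq_sym (negbTE ki) mulr0.
Qed.

(** A directional derivative from the partial derivatives. *)
Lemma derive_stdvec h a z : differentiable h a ->
  'D_z h a = \sum_j 'D_(stdvec j) h a * z j 0.
Proof.
move=> dh; rewrite deriveE// {1}(cV_sum_stdvec z) linear_sum; apply: eq_bigr => j _.
by rewrite linearZ deriveE// mulrC.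
Qed.

Lemma diff_is_derive h a (z : V) : differentiable h a -> is_derive a z h ('D_z h a).
Proof. by move=> dh; exact/derivableP/diff_derivable. Qed.

Variable Omega : set V.
Hypothesis oO : open Omega.

Lemma near_open h1 h2 a v (d : C) : Omega a -> (forall x, Omega x -> h1 x = h2 x) ->
  is_derive a v h1 d -> is_derive a v h2 d.
Proof.
move=> Oa E H; have /open_nvP/(_ _ Oa)[r r0 hr] := oO.
by apply: cder_near H _; exists r => // x /hr; exact: E.
Qed.

(** Holomorphy on the open set Omega. *)
Definition hol h := forall x, Omega x -> differentiable h x.

Lemma hol_derive h v : hol h -> hol ('D_v h).
Proof. by move=> hh x; exact: derive_differentiable. Qed.

Lemma hol_iter_partial h s : hol h -> hol (iter_partial s h).
Proof. by move=> hh; elim: s => //= j s; exact: hol_derive. Qed.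

Lemma is_derive_bigsum (I : Type) (r : seq I) (F : I -> V -> C) (d : I -> C) a v :
  (forall k, is_derive a v (F k) (d k)) ->
  is_derive a v (fun x => \sum_(k <- r) F k x) (\sum_(k <- r) d k).
Proof.
move=> hF; elim: r => [|k r IH].
  by apply: (cder_ext (f := fun=> 0)); [rewrite big_nil;
    exact: cder_cst|move=> x; rewrite big_nil].
apply: (cder_ext (f := fun x => F k x + \sum_(j <- r) F j x)).
  by rewrite big_cons; exact: (cderD (hF k) IH).
by move=> x; rewrite big_cons.
Qed.

Lemma sum_tuple_cons (A : nmodType) k (F : k.+1.-tuple 'I_n -> A) :
  \sum_p F p = \sum_(p : k.-tuple 'I_n) \sum_j F [tuple of j :: p].
Proof.
rewrite pair_bigA /=.
rewrite (reindex (fun x : k.-tuple 'I_n * 'I_n => [tuple of x.2 :: x.1])) //=.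
exists (fun p : k.+1.-tuple 'I_n => ([tuple of behead p], thead p)) =>
  [[p j] _|p _] /=.
  by rewrite theadE; congr (_, _); apply/val_inj.
by rewrite [RHS]tuple_eta; apply/val_inj.
Qed.

(** The multilinear form D^k h(a)(z, ..., z) in coordinates is the k-th iterated
    derivative in the direction z. *)
Lemma iter_partial_dir h z k a : hol h -> Omega a ->
  \sum_(p : k.-tuple 'I_n) iter_partial p h a * \prod_(i < k) z (tnth p i) 0 =
  iter k (fun f => 'D_z f) h a.
Proof.
move=> hh; elim: k a => [|k IH] a Oa.
  rewrite (bigD1 [tuple]) //= big_ord0 mulr1 big1 ?addr0 // => p.
  by move=> /negP; case; apply/eqP; rewrite (tuple0 p); exact: val_inj.
rewrite sum_tuple_cons /=.
have H : is_derive a z (fun x => \sum_(p : k.-tuple 'I_n)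
     (\prod_(i < k) z (tnth p i) 0) * iter_partial p h x)
   (\sum_(p : k.-tuple 'I_n) (\prod_(i < k) z (tnth p i) 0) * 'D_z (iter_partial
     p h) a).
  apply: is_derive_bigsum => p; apply: cderZ; apply: derivableP.
  exact/diff_derivable/hol_iter_partial.
have : is_derive a z (iter k (fun f => 'D_z f) h)
   (\sum_(p : k.-tuple 'I_n) (\prod_(i < k) z (tnth p i) 0) * 'D_z (iter_partial
     p h) a).
  apply: near_open Oa _ H => x Ox; rewrite -(IH x Ox).
  by apply: eq_bigr => p _; rewrite mulrC.
case=> _ ->; apply: eq_bigr => p _.
rewrite derive_stdvec; last exact: hol_iter_partial.
rewrite mulr_sumr; apply: eq_bigr => j _.
rewrite big_ord_recl /= tnth0 [in LHS]mulrA [LHS]mulrC; congr (_ * _).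
by apply: eq_bigr => i _; rewrite tnthS.
Qed.

(** The derivative of a component g(w) w_j of w g(w); the second and third ones
    below follow from Leibniz' rule in the same way. *)
Lemma derive_mul_coord1 g j z a : hol g -> Omega a ->
  'D_z (fun w => g w * w j 0) a = 'D_z g a * a j 0 + g a * z j 0.
Proof.
move=> hg Oa.
by have [_ ->] := cderM (diff_is_derive z (hg _ Oa)) (is_derive_coord j a z).
Qed.

Lemma hol_mul_coord g j : hol g -> hol (fun w => g w * w j 0).
Proof.
move=> hg x Ox; apply: differentiableM; first exact: hg.
exact: differentiable_coord.
Qed.

Lemma derive_mul_coord2 g j z a : hol g -> Omega a ->
  'D_z ('D_z (fun w => g w * w j 0)) a = 'D_z ('D_z g) a * a j 0 + ('D_z g a * z
    j 0) *+ 2.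
Proof.
move=> hg Oa; have hg1 := hol_derive z hg.
have d1 := diff_is_derive z (hg _ Oa).
have d2 := diff_is_derive z (hg1 _ Oa).
have H := cderD (cderM d2 (is_derive_coord j a z)) (cderM d1 (cder_cst (z j 0) a
  z)).
have E x : Omega x -> 'D_z g x * x j 0 + g x * z j 0 = 'D_z (fun w =>
  g w * w j 0) x.
  by move=> Ox; rewrite derive_mul_coord1.
have H2 := @near_open (fun x => 'D_z g x * x j 0 + g x * z j 0)
  ('D_z (fun w => g w * w j 0)) a z _ Oa E H.
apply: (etrans (@derive_val _ _ _ _ _ _ _ H2)).
have alg (p q r s t : C) : (r * s + q * t) + (q * t + p * 0) = r * s + (q * t) *+
  2 by ring.
exact: alg.
Qed.

Lemma derive_mul_coord3 g j z a : hol g -> Omega a ->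
  'D_z ('D_z ('D_z (fun w => g w * w j 0))) a =
  'D_z ('D_z ('D_z g)) a * a j 0 + ('D_z ('D_z g) a * z j 0) *+ 3.
Proof.
move=> hg Oa; have hg1 := hol_derive z hg; have hg2 := hol_derive z hg1.
have d2 := diff_is_derive z (hg1 _ Oa).
have d3 := diff_is_derive z (hg2 _ Oa).
have H := cderD (cderM d3 (is_derive_coord j a z)) (cderZ 2 (cderM d2 (cder_cst
  (z j 0) a z))).
have E x : Omega x -> 'D_z ('D_z g) x * x j 0 + 2 * ('D_z g x * z j 0) =
    'D_z ('D_z (fun w => g w * w j 0)) x.
  by move=> Ox; rewrite mulr_natl; exact: (esym (derive_mul_coord2 j z hg Ox)).
have H2 := @near_open (fun x => 'D_z ('D_z g) x * x j 0 + 2 * ('D_z g x * z j 0))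
  ('D_z ('D_z (fun w => g w * w j 0))) a z _ Oa E H.
apply: (etrans (@derive_val _ _ _ _ _ _ _ H2)).
have alg (p q r s t : C) : (r * s + q * t) + 2 * (q * t + p * 0) = r * s + (q *
  t) *+ 3 by ring.
exact: alg.
Qed.

(** At the origin only the terms in which one factor w_j is differentiated
    survive. *)
Lemma frechet_pow2 g z : hol g -> Omega 0 ->
  frechet_pow 2 (times_id g) 0 z = (2 * 'D_z g 0) *: z.
Proof.
move=> hg O0; apply/matrixP => i j; rewrite ord1 !mxE.
have -> : (fun w => times_id g w i 0) = (fun w => g w * w i 0).
  by apply/funext => w; rewrite /times_id mxE.
apply: (etrans (iter_partial_dir z 2 (hol_mul_coord i hg) O0)).
apply: (etrans (derive_mul_coord2 i z hg O0)); rewrite mxE.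
have alg (p q t : C) : p * 0 + (q * t) *+ 2 = 2 * q * t by ring.
exact: alg.
Qed.

Lemma frechet_pow3 g z : hol g -> Omega 0 ->
  frechet_pow 3 (times_id g) 0 z = (3 * 'D_z ('D_z g) 0) *: z.
Proof.
move=> hg O0; apply/matrixP => i j; rewrite ord1 !mxE.
have -> : (fun w => times_id g w i 0) = (fun w => g w * w i 0).
  by apply/funext => w; rewrite /times_id mxE.
apply: (etrans (iter_partial_dir z 3 (hol_mul_coord i hg) O0)).
apply: (etrans (derive_mul_coord3 i z hg O0)); rewrite mxE.
have alg (p q t : C) : p * 0 + (q * t) *+ 3 = 3 * q * t by ring.
exact: alg.
Qed.

(** The Jacobian of w g(w) applied to z. *)
Lemma cjacobian_times_id g w z : differentiable g w ->
  cjacobian (times_id g) w *m z = ('D_z g w) *: w + g w *: z.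
Proof.
move=> dg; apply/matrixP => i j; rewrite ord1 !mxE derive_stdvec// mulr_suml.
transitivity (\sum_k ('D_(stdvec k) g w * w i 0 + g w * stdvec k i 0) * z k 0).
  apply: eq_bigr => k _; rewrite mxE; congr (_ * _).
  have -> : (fun w => times_id g w i 0) = (fun w => g w * w i 0).
    by apply/funext => w'; rewrite /times_id mxE.
  by have [_ ->] := cderM (diff_is_derive (stdvec k) dg) (is_derive_coord i w
    (stdvec k)).
transitivity (\sum_k 'D_(stdvec k) g w * z k 0 * w i 0 + g w * \sum_k z k 0 *
  stdvec k i 0).
  by rewrite mulr_sumr -big_split /=; apply: eq_bigr => k _; ring.
congr (_ + _ * _); rewrite [in RHS](cV_sum_stdvec z) summxE.
by apply: eq_bigr => k _; rewrite [in RHS]mxE.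
Qed.

End Coordinates.

(** * Restriction to a complex line *)

Section Lines.
Context {R : realType} {n : nat}.
Local Notation C := R[i].
Local Notation V := 'cV[C]_n.
Variables (Omega : set V) (rho : V -> R).
Hypothesis oO : open Omega.
Hypothesis hrho : minkowski_functional Omega rho.
Hypothesis hC1 : C1_off_origin rho.
Implicit Types (g : V -> C) (w z : V).

Lemma unit_diskP (s : C) : unit_disk s <-> nv s < 1.
Proof. by rewrite /unit_disk /= nvE -[1]/((1 : R)%:C) ltcR. Qed.

Lemma Omega0 : Omega 0.
Proof.
by apply/(minkowski_mem hrho); have [_ _ h _ _] := hrho; rewrite (h 0).2.
Qed.

Lemma derive_scale g a (c : C) z :
  differentiable g a -> 'D_(c *: z) g a = c * 'D_z g a.
Proof. by move=> dg; rewrite !deriveE// linearZ. Qed.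

Lemma derive2_scale g (c : C) z : hol Omega g ->
  'D_(c *: z) ('D_(c *: z) g) 0 = c ^+ 2 * 'D_z ('D_z g) 0.
Proof.
move=> hg; have hg1 := hol_derive oO z hg.
have H := cderZ c (diff_is_derive (c *: z) (hg1 _ Omega0)).
have E x : Omega x -> c * 'D_z g x = 'D_(c *: z) g x.
  by move=> Ox; rewrite derive_scale//; exact: hg.
have H2 := @near_open R n Omega oO (fun x =>
  c * 'D_z g x) ('D_(c *: z) g) 0 _ _ Omega0 E H.
apply: (etrans (@derive_val _ _ _ _ _ _ _ H2)).
by rewrite (derive_scale c z (hg1 _ Omega0)) mulrA.
Qed.

(** In terms of the restriction of g to the line through z0 = z / rho(z), the two
    expressions of the inequality are f''(0)/2 and f'(0). *)
Lemma lhs_line g z : hol Omega g -> z != 0 ->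
  let z0 := (rho z)%:C^-1 *: z in
  2 * wirtinger_mul rho z ((3`!%:R * (rho z)%:C ^+ 3)^-1 *: frechet_pow 3
    (times_id g) 0 z)
    = 'D_z0 ('D_z0 g) 0 / 2 /\
  2 * wirtinger_mul rho z ((2`!%:R * (rho z)%:C ^+ 2)^-1 *: frechet_pow 2
    (times_id g) 0 z)
    = 'D_z0 g 0.
Proof.
move=> hg z0 z1; have r0 := minkowski_gt0 hrho z0.
have rC : (rho z)%:C != 0 :> C by rewrite -nv_gt0 nv_real gtr0_norm.
rewrite (frechet_pow2 oO z hg Omega0) (frechet_pow3 oO z hg Omega0) !scalerA.
have D1 := derive_scale (rho z)%:C^-1 z (hg _ Omega0).
have D2 := derive2_scale (rho z)%:C^-1 z hg.
split; apply: (etrans (wirtinger_mul_line hrho hC1 _ z0)).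
  apply: (etrans _ (congr1 (fun x => x / 2) (esym D2))).
  have alg (r p : C) : r != 0 -> (3`!%:R * r ^+ 3)^-1 * (3 * p) * r = r^-1 ^+ 2 *
    p / 2.
    by move=> rn; rewrite /factorial /=; field.
  exact: alg.
apply: (etrans _ (esym D1)).
have alg (r p : C) : r != 0 -> (2`!%:R * r ^+ 2)^-1 * (2 * p) * r = r^-1 * p.
  by move=> rn; rewrite /factorial /=; field.
exact: alg.
Qed.

Lemma line_in_Omega z0 : rho z0 = 1 -> forall s : C, nv s < 1 -> Omega (s *: z0).
Proof. by move=> h s s1; apply/(minkowski_mem hrho);
  rewrite (minkowski_scale hrho) h mulr1. Qed.

Lemma line_derive g z0 (s : C) : Omega (s *: z0) -> hol Omega g ->
  is_derive s 1 (fun s : C => g (s *: z0)) ('D_z0 g (s *: z0)).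
Proof.
move=> Os hg; have H := @cder_line R _ g 0 z0 s ('D_z0 g (s *: z0)).
rewrite add0r in H; apply: cder_ext (H _) _; first by apply: diff_is_derive;
  exact: hg.
by move=> x; rewrite add0r.
Qed.

(** [coef_relation] for the restriction of g to the line through z0. *)
Lemma line_coefs g z0 (Phi w : C -> C) : hol Omega g -> rho z0 = 1 -> g 0 = 1 ->
  (forall z : C, nv z < 1 -> derivable Phi z 1) ->
  (forall z : C, nv z < 1 -> derivable w z 1) ->
  (forall z : C, nv z < 1 -> nv (w z) < 1) -> w 0 = 0 -> Phi 0 = 1 ->
  (forall s : C, nv s < 1 ->
     g (s *: z0) + 'D_(s *: z0) g (s *: z0) = g (s *: z0) * Phi (w s)) ->
  'D_z0 g 0 = 'D_1 Phi 0 * 'D_1 w 0 /\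
  'D_z0 ('D_z0 g) 0 / 2 = ('D_z0 g 0 ^+ 2 + 'D_1 ('D_1 Phi) 0 / 2 * 'D_1 w 0 ^+ 2
     + 'D_1 Phi 0 * ('D_1 ('D_1 w) 0 / 2)) / 2.
Proof.
move=> hg rz g0 dP dw wU w0 P0 rel.
pose f (s : C) : C := g (s *: z0).
have Os := line_in_Omega rz.
have z01 : nv (0 : C) < 1 by rewrite nv0.
have hf (s : C) : nv s < 1 -> is_derive s 1 f ('D_z0 g (s *: z0)).
  by move=> s1; apply: line_derive => //; exact: Os.
have f1E (s : C) : nv s < 1 -> 'D_1 f s = 'D_z0 g (s *: z0) by move=> /hf[].
have hf2 : is_derive (0 : C) 1 ('D_1 f) ('D_z0 ('D_z0 g) 0).
  have H := @line_derive ('D_z0 g) z0 0 (Os _ z01) (hol_derive oO z0 hg).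
  have H' := is_derive_eq H (congr1 (fun x => 'D_z0 ('D_z0 g) x) (scale0r z0)).
  apply: cder_near H' _; exists 1; first exact: ltr01.
  by move=> h h1; apply/esym/f1E; rewrite add0r.
have E1 : 'D_1 f 0 = 'D_z0 g 0.
  exact: (etrans (f1E 0 z01) (congr1 (fun x => 'D_z0 g x) (scale0r z0))).
have E2 : 'D_1 ('D_1 f) 0 = 'D_z0 ('D_z0 g) 0 by case: hf2.
have df (s : C) : nv s < 1 -> derivable f s 1 by move=> /hf[].
have f0 : f 0 = 1 by rewrite /f scale0r.
have relf (s : C) : nv s < 1 -> f s + s * 'D_1 f s = f s * Phi (w s).
  move=> s1; apply: etrans (rel s s1); congr (_ + _).
  apply: (etrans (congr1 (fun x => s * x) (f1E s s1))).
  exact: (esym (derive_scale s z0 (hg _ (Os _ s1)))).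
have [e1 e2] := coef_relation df dP dw wU w0 P0 f0 relf.
have subst (a a' b b' X Y : C) : a = a' -> b = b' ->
    b / 2 = (a ^+ 2 + X + Y) / 2 -> b' / 2 = (a' ^+ 2 + X + Y) / 2 by move=> -> ->.
split; first exact: (etrans (esym E1) e1).
exact: (subst _ _ _ _ _ _ E1 E2 e2).
Qed.

(** w is an eigenvector of the Jacobian of w g(w) at w. *)
Lemma invjac_times_id g w : differentiable g w -> w != 0 ->
  cjacobian (times_id g) w \in unitmx ->
  g w + 'D_w g w != 0 /\
  invjac_mul (times_id g) w = (g w / (g w + 'D_w g w)) *: w.
Proof.
move=> dg w0 Ju; set J := cjacobian _ _ in Ju *; set s := g w + 'D_w g w.
have Jw : J *m w = s *: w by rewrite /J cjacobian_times_id// -scalerDl addrC.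
have Jw' : w = s *: (invmx J *m w) by rewrite scalemxAr -Jw mulKmx.
have s0 : s != 0 by apply: contra w0 => /eqP s0; rewrite Jw' s0 scale0r.
have E : invmx J *m w = s^-1 *: w.
  by apply: (scalerI s0); rewrite -Jw' scalerA mulfV// scale1r.
by split => //; rewrite /invjac_mul /times_id -scalemxAr -/J E scalerA.
Qed.

Lemma ratio_line w (c : C) : w != 0 ->
  (rho w)%:C / (2 * wirtinger_mul rho w (c *: w)) = c^-1.
Proof.
move=> w0; rewrite (wirtinger_mul_line hrho hC1 _ w0).
have rC : (rho w)%:C != 0 :> C.
  by rewrite -nv_gt0 nv_real gtr0_norm ?(minkowski_gt0 hrho).
by rewrite invfM mulrCA mulfV// mulr1.
Qed.

Variable Phi : C -> C.
Hypothesis hPhi : biholomorphic_onto_image unit_disk Phi.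
Hypothesis hPhi0 : Phi 0 = 1.
Hypothesis hPhiRe : forall zeta, unit_disk zeta -> 0 < complex.Re (Phi zeta).

Lemma Phi_derivable (z : C) : nv z < 1 -> derivable Phi z 1.
Proof.
by move=> z1; have [h _ _] := hPhi; apply/derivable1_diffP/h; apply/unit_diskP.
Qed.

Lemma Phi_neq0 (z : C) : nv z < 1 -> Phi z != 0.
Proof.
move=> /unit_diskP /hPhiRe; apply: contraTneq => ->; by rewrite /= ltxx.
Qed.

(** Membership in the class M_Phi on the line through z0: the quotient
    1 + s f'/f takes its values in the image of Phi, and w is obtained by applying
    the holomorphic inverse of Phi. Where g vanishes, so does J_G^-1 G, and the
    quotient in the definition of M_Phi is x / 0 = 0, which is not a value of
    Phi; hence g has no zeros. *)
Lemma admissible_subordinate g z0 : hol Omega g -> g 0 = 1 -> rho z0 = 1 ->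
  (forall z, Omega z -> cjacobian (times_id g) z \in unitmx) ->
  class_M Omega rho Phi (invjac_mul (times_id g)) ->
  exists w : C -> C, [/\ forall s : C, nv s < 1 -> derivable w s 1,
    forall s : C, nv s < 1 -> nv (w s) < 1, w 0 = 0 &
    forall s : C, nv s < 1 ->
      g (s *: z0) + 'D_(s *: z0) g (s *: z0) = g (s *: z0) * Phi (w s)].
Proof.
move=> hg g0 rz hJ [_ _ _ hM].
have Os := line_in_Omega rz.
have z00 : z0 != 0.
  have [_ _ h _ _] := hrho; apply/eqP => /h; rewrite rz => /eqP;
    by rewrite oner_eq0.
have hM' x : Omega x -> x != 0 -> g x != 0 /\
    exists2 u : C, nv u < 1 & (g x + 'D_x g x) / g x = Phi u.
  move=> Ox x0; have [s0 E] := invjac_times_id (hg _ Ox) x0 (hJ _ Ox).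
  have [u /unit_diskP u1] := hM x Ox x0; rewrite E ratio_line// => Pu.
  have : Phi u != 0 by exact: Phi_neq0.
  rewrite Pu invr_eq0 mulf_eq0 negb_or => /andP[gx _]; split => //.
  by exists u => //; rewrite Pu invfM invrK mulrC.
have [_ _ [h hh hK]] := hPhi.
pose q (s : C) : C := (g (s *: z0) + s * 'D_z0 g (s *: z0)) / g (s *: z0).
have gn0 (s : C) : nv s < 1 -> g (s *: z0) != 0.
  move=> s1; have [->|s0] := eqVneq s 0; first by rewrite scale0r g0 oner_eq0.
  have [] // := hM' (s *: z0) (Os _ s1).
  by rewrite scaler_eq0 negb_or s0.
have qP (s : C) : nv s < 1 -> exists2 u : C, nv u < 1 & q s = Phi u.
  move=> s1; have [->|s0] := eqVneq s 0.
    exists 0; first by rewrite nv0.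
    by rewrite /q scale0r mul0r addr0 divff ?hPhi0// g0 oner_eq0.
  have [|_ [u u1 E]] := hM' (s *: z0) (Os _ s1).
    by rewrite scaler_eq0 negb_or s0.
  exists u => //; rewrite -E /q; congr (_ / _); congr (_ + _).
  by rewrite (derive_scale s z0 (hg _ (Os _ s1))).
have dq (s : C) : nv s < 1 -> derivable q s 1.
  move=> s1; have Oss := Os _ s1.
  have d1 := line_derive Oss hg; have d2 := line_derive Oss (hol_derive oO z0 hg).
  by have [] := cderM (cderD d1 (cderM (cder_id s) d2)) (cderV d1 (gn0 _ s1)).
have qim (s : C) : nv s < 1 -> (Phi @` unit_disk) (q s).
  by move=> /qP[u u1 ->]; exists u => //; apply/unit_diskP.
exists (fun s => h (q s)); split.
- move=> s s1; have /derivable1_diffP/derivableP dh := hh _ (qim _ s1).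
  by have [] := cder_comp (derivableP (dq _ s1)) dh.
- by move=> s /qP[u u1 ->]; rewrite hK//; apply/unit_diskP.
- have -> : q 0 = Phi 0 by rewrite /q scale0r mul0r addr0 divff ?hPhi0// g0
  oner_eq0.
  by apply: hK; apply/unit_diskP; rewrite nv0.
- move=> s s1; have [u u1 E] := qP _ s1.
  have -> : Phi (h (q s)) = q s by rewrite E hK//; apply/unit_diskP.
  rewrite /q mulrC divfK ?gn0//; congr (_ + _).
  by rewrite (derive_scale s z0 (hg _ (Os _ s1))).
Qed.

End Lines.

(** * A linear form attaining its maximum on the indicatrix *)

Section Extremal.
Context {R : realType} {n : nat}.
Local Notation C := R[i].
Local Notation V := 'cV[C]_n.
Variables (Omega : set V) (rho : V -> R).
Hypothesis hrho : minkowski_functional Omega rho.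

(** The vector with real and imaginary parts given by the two halves of x;
    it transfers compactness from the real row vectors. *)
Definition realify (x : 'rV[R]_(n + n)) : V :=
  \col_j (x 0 (lshift n j) +i* x 0 (rshift n j)).

Lemma realifyB x y : realify (x - y) = realify x - realify y.
Proof. by apply/matrixP => i j; rewrite !mxE. Qed.

Lemma realifyZ (t : R) x : realify (t *: x) = t%:C *: realify x.
Proof.
apply/matrixP => i j; rewrite !mxE; apply/eqP; rewrite eq_complex /=.
by rewrite !mul0r subr0 addr0 !eqxx.
Qed.

Lemma realify_surj (z : V) : exists x, realify x = z.
Proof.
exists (row_mx (\row_j complex.Re (z j 0)) (\row_j complex.Im (z j 0))).
apply/matrixP => i j; rewrite ord1 mxE.
by rewrite row_mxEl row_mxEr !mxE; case: (z i 0).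
Qed.

Lemma realify_eq0 x : realify x = 0 -> x = 0.
Proof.
move=> /matrixP E; apply/matrixP => i j; rewrite ord1.
case: (split_ordP j) => k ->; have := E k 0; rewrite !mxE => /eqP.
  by rewrite eq_complex /= => /andP[/eqP ->].
by rewrite eq_complex /= => /andP[_ /eqP ->].
Qed.

Lemma entry_le_norm m (x : 'rV[R]_m) i : `|x 0 i| <= `|x|.
Proof. rewrite [`|x|]mx_normrE;
  exact: (le_bigmax _ (fun ij => `|x ij.1 ij.2|) (0, i)). Qed.

Lemma nv_realify x : nv (realify x) <= `|x| * (2 * \sum_j nv (stdvec j : V)).
Proof.
rewrite [realify x]cV_sum_stdvec !mulr_sumr.
have -> : \sum_i `|x| * (2 * nv (stdvec i :
  V)) = \sum_(i <- index_enum 'I_n) `|x| * (2 * nv (stdvec i : V)) by [].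
elim: (index_enum 'I_n) => [|j r IH]; first by rewrite !big_nil nv0.
rewrite !big_cons; apply: le_trans (nvD _ _) _; apply: lerD => //.
rewrite nvZ mulrA ler_wpM2r ?nv_ge0// mxE; apply: le_trans (nv_le_ReIm _) _ => /=.
by have := entry_le_norm x (lshift n j); have := entry_le_norm x (rshift n j); lra.
Qed.

Lemma realify_continuous : continuous realify.
Proof.
move=> x A /nbhs_nvP[d d0 hA]; apply/nbhs_ballP.
pose S : R := 2 * \sum_j nv (stdvec j : V).
have S0 : 0 <= S by rewrite mulr_ge0// sumr_ge0// => j _; exact: nv_ge0.
exists (d / (S + 1)); first by rewrite /= divr_gt0// ltr_wpDl.
move=> y; rewrite -ball_normE /= distrC ltr_pdivlMr ?ltr_wpDl// => H.
rewrite /= -[realify y](subrKC (realify x)) -realifyB; apply: hA.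
apply: le_lt_trans (nv_realify _) _; apply: le_lt_trans H.
by rewrite ler_wpM2l// lerDl.
Qed.

Lemma nv_coord_continuous j : continuous (fun z : V => nv (z j 0)).
Proof.
move=> z A /nbhsR_P[e e0 hA].
have /differentiable_continuous/continuous_nvP/(_ _ e0)[d d0 hd] :=
  differentiable_coord z j 0.
apply/nbhs_nvP; exists d => // h /hd H.
rewrite /= -[nv _](subrKC (nv (z j 0))); apply: hA; apply: le_lt_trans H.
rewrite ler_norml; apply/andP; split.
  have := nv_tri ((z + h) j 0) (z j 0) 0; rewrite !subr0 (nvB (z j 0)).
  by move: (nv (z j 0)) (nv ((z + h) j 0)) (nv (_ - _)) => *; lra.
have := nv_tri (z j 0) ((z + h) j 0) 0; rewrite !subr0.
by move: (nv (z j 0)) (nv ((z + h) j 0)) (nv (_ - _)) => *; lra.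
Qed.

(** The quotient |z_j| / rho(z) is homogeneous of degree 0, so its maximum over
    a real sphere is its maximum over all nonzero vectors. *)
Lemma extremal_vector (j : 'I_n) : exists2 zs : V, rho zs = 1 &
  zs j 0 != 0 /\ forall z : V, nv (z j 0) <= nv (zs j 0) * rho z.
Proof.
(* the unit sphere of R^(2n) for the maximum norm *)
pose S : set 'rV[R]_(n + n) := [set x | `|x| = 1].
pose F (x : 'rV[R]_(n + n)) : R := nv (realify x j 0) / rho (realify x).
have SN0 x : S x -> realify x != 0.
  by move=> Sx; apply/eqP => /realify_eq0 x0; move: Sx;
    rewrite /S /= x0 normr0 => /eqP; rewrite eq_sym oner_eq0.
have nrm x : x != 0 -> S (`|x|^-1 *: x).
  by move=> x0; rewrite /S /= normrZ ger0_norm ?invr_ge0// mulVf// normr_eq0.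
have [x1 x1E] := realify_surj (stdvec j).
have x10 : x1 != 0.
  apply/eqP => x0; move: x1E; rewrite x0 => /matrixP/(_ j 0); rewrite !mxE !eqxx /=.
  by move=> /eqP; rewrite eq_complex /= eq_sym oner_eq0.
have Fhom x (t : R) : 0 < t -> F (t *: x) = F x.
  move=> t0; rewrite /F realifyZ (minkowski_scale hrho) mxE nvM nv_real gtr0_norm//.
  by rewrite invfM mulrACA mulfV ?gt_eqF// mul1r.
have cS : compact S.
  apply: bounded_closed_compact.
    by exists 1; split => // M M1 x; rewrite /S /= => ->; exact: ltW.
  have -> : S = (fun x : 'rV[R]_(n + n) => `|x|) @^-1` [set 1] by [].
  by apply: preimage_closed; [move=> y _; exact: norm_continuous|exact: closed_eq].
have cF : {within S, continuous F}.
  apply: continuous_in_subspaceT => x; rewrite inE => Sx.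
  have crho : {for x, continuous (fun x => rho (realify x))}.
    apply: continuous_comp; first exact: realify_continuous.
    by have [h _ _ _ _] := hrho; exact: h.
  have cnum : {for x, continuous (fun x => nv (realify x j 0))}.
    by apply: (@continuous_comp _ _ _ realify (fun z : V => nv (z j 0)));
      [exact: realify_continuous|exact: nv_coord_continuous].
  apply: (@continuousM _ _ (fun x => nv (realify x j 0)) (fun x =>
    (rho (realify x))^-1)) => //.
  apply: continuousV => //; rewrite gt_eqF//; apply: (minkowski_gt0 hrho);
    exact: SN0.
have [xs] := EVT_max_rV (ex_intro _ _ (nrm _ x10)) cS cF.
rewrite inE => Sxs hmax.
have zs0 := SN0 _ Sxs; have r0 := minkowski_gt0 hrho zs0.
pose zs : V := (rho (realify xs))^-1%:C *: realify xs.
have rzs : rho zs = 1.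
  by rewrite /zs (minkowski_scale hrho) nv_real ger0_norm ?invr_ge0 ?ltW//
    mulVf// gt_eqF.
have zsj : nv (zs j 0) = F xs.
  by rewrite /zs mxE nvM nv_real ger0_norm ?invr_ge0 ?ltW// mulrC.
have main (z : V) : nv (z j 0) <= nv (zs j 0) * rho z.
  have [->|z0] := eqVneq z 0; first by rewrite mxE nv0 mulr_ge0 ?nv_ge0
    ?(minkowski_ge0 hrho).
  have rz := minkowski_gt0 hrho z0; rewrite -ler_pdivrMr// zsj.
  have [x xE] := realify_surj z.
  have x0 : x != 0.
    apply/eqP => x0; move: z0; rewrite -xE x0 => /eqP; apply.
    by apply/matrixP => i k; rewrite !mxE.
  have -> : nv (z j 0) / rho z = F (`|x|^-1 *: x).
    by rewrite Fhom ?invr_gt0 ?normr_gt0// /F xE.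
  by apply: hmax; rewrite inE; exact: nrm.
exists zs => //; split => //.
apply/eqP => E; have := main (stdvec j); rewrite E nv0 mul0r mxE !eqxx /=.
by rewrite nv1 ler10.
Qed.

End Extremal.

(** * The extremal function *)

Section DiskPrimitive.
Context {R : realType}.
Local Notation C := R[i].

(** Each point of the unit disk is interior to a smaller closed disk, on which
    the derivative exists at all points. *)
Lemma disk_primitive (k : C -> C) (s : C) : (forall z :
  C, nv z < 1 -> derivable k z 1) ->
  nv s < 1 -> is_derive s 1 (seg k 0) (k s).
Proof.
move=> dk s1; pose r := (1 + nv s) / 2.
have s0 := nv_ge0 s.
have r1 : r < 1 by rewrite /r; lra.
have r0 : 0 < r by rewrite /r; lra.
apply: (@primitive_of_convex _ [set z : C | nv z <= r]).
- move=> a b t /= ha hb t01.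
  have -> : a + t%:C * (b - a) = (1 - t)%:C * a + t%:C * b by rewrite rmorphB
    rmorph1 /=; ring.
  apply: le_trans (nvD _ _) _; rewrite !nvM !nv_real !ger0_norm; [|lra..].
  by move: t01 => /andP[t0 t1]; nra.
- move=> p h /=; apply: le_of_addgt0 => e /h[a /= ha hap].
  by have := nv_tri a p 0; rewrite !subr0 (nvB p); lra.
- by move=> z /= hz; apply: dk; exact: le_lt_trans hz r1.
- by rewrite /= nv0 ltW.
- exists (r - nv s); first by rewrite /r; lra.
  by move=> h hh /=; apply: le_trans (nvD _ _) _; lra.
Qed.

Lemma seg_same (k : C -> C) (a : C) : seg k a a = 0.
Proof. by rewrite /seg subrr mul0r. Qed.

Lemma differentiable_expand (V W : normedModType C) (f : V -> W) (a : V) :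
  differentiable f a -> forall e : R, 0 < e -> exists2 d :
    R, 0 < d & forall u, nv u < d ->
     nv (f (a + u) - f a - 'd f a u) <= e * nv u.
Proof.
move=> /diff_locally /eqaddoP h e e0.
have /h/nbhs_nvP[d d0 hd] : 0 < e%:C :> C by rewrite ltcR.
exists d => // u /hd; rewrite add0r !fctE /= [u + a]addrC opprD addrA.
by rewrite nvE [`|u|]nvE -rmorphM lecR.
Qed.

Lemma differentiable_near (V W : normedModType C) (f g : V -> W) (a : V) :
  differentiable f a ->
  (exists2 r : R, 0 < r & forall h, nv h < r -> f (a + h) = g (a + h)) ->
  differentiable g a.
Proof.
move=> df [r r0 fg]; have [k k0 hk] := linear_lipschitz (diff_continuous df).
have [kr kr0 kE] := gt0cP k0.
apply: (@differentiable_nv _ _ _ g a ('d f a) kr).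
- exact: linearP.
- by move=> u; rewrite -lecR rmorphM /= -!nvE -kE.
- move=> e /(differentiable_expand df)[d d0 hd].
  exists (Num.min d r); first by rewrite lt_min d0.
  move=> u; rewrite lt_min => /andP[/hd H ur].
  have ga : f a = g a by have := fg 0; rewrite addr0 nv0; exact.
  by rewrite -fg// -ga.
Qed.

End DiskPrimitive.

Section Sharp.
Context {R : realType} {n : nat}.
Local Notation C := R[i].
Local Notation V := 'cV[C]_n.
Variables (Omega : set V) (rho : V -> R).
Hypothesis oO : open Omega.
Hypothesis hrho : minkowski_functional Omega rho.
Hypothesis hC1 : C1_off_origin rho.
Variable Phi : C -> C.
Hypothesis hPhi : biholomorphic_onto_image unit_disk Phi.
Hypothesis hPhi0 : Phi 0 = 1.
Hypothesis hPhiRe : forall zeta, unit_disk zeta -> 0 < complex.Re (Phi zeta).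
Variables (j : 'I_n) (zs : V).
Hypothesis zs1 : rho zs = 1.
Hypothesis zsj : zs j 0 != 0.
Hypothesis zsmax : forall z : V, nv (z j 0) <= nv (zs j 0) * rho z.

(** The linear form z_j / zs_j, of absolute value at most rho and equal to 1 at
    zs. *)
Definition lform (z : V) : C := (zs j 0)^-1 * z j 0.
(** Phi precomposed with the rotation by a right angle. *)
Definition rotPhi (s : C) : C := Phi ('i%C * s).
(** The extremal function: exp of a primitive of (Phi(i s) - 1) / s, evaluated at
    the linear form. *)
Definition sharp_g (z : V) : C := cexp (seg (dquot rotPhi) 0 (lform z)).

Lemma lform_le z : nv (lform z) <= rho z.
Proof. by rewrite /lform nvM nvV ler_pdivrMl ?nv_gt0. Qed.

Lemma lform_lt1 z : Omega z -> nv (lform z) < 1.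
Proof. by move=> /(minkowski_mem hrho); exact: le_lt_trans (lform_le z). Qed.

Lemma lform_line (s : C) : lform (s *: zs) = s.
Proof. by rewrite /lform mxE mulrCA mulVf// mulr1. Qed.

Lemma lform0 : lform 0 = 0.
Proof. by rewrite /lform mxE mulr0. Qed.

Lemma is_derive_lform z v : is_derive z v lform (lform v).
Proof. exact: (cderZ (zs j 0)^-1 (is_derive_coord j z v)). Qed.

Lemma differentiable_lform z : differentiable lform z.
Proof. exact/differentiableM/differentiable_coord. Qed.

Lemma nvi_mul (s : C) : nv ('i%C * s) = nv s.
Proof. by rewrite nvM nvi mul1r. Qed.

Lemma rotPhi_is_derive (s : C) : nv s < 1 ->
  is_derive s 1 rotPhi ('D_1 Phi ('i%C * s) * ('i%C * 1)).
Proof.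
move=> s1; apply: (cder_comp (cderZ 'i%C (cder_id s))).
by apply/derivableP/(Phi_derivable hPhi); rewrite nvi_mul.
Qed.

Lemma rotPhi_derivable (s : C) : nv s < 1 -> derivable rotPhi s 1.
Proof. by move=> /rotPhi_is_derive[]. Qed.

Lemma rotPhi0 : rotPhi 0 = 1.
Proof. by rewrite /rotPhi mulr0. Qed.

Lemma rotPhi_neq0 (s : C) : nv s < 1 -> rotPhi s != 0.
Proof. by move=> s1; apply: (Phi_neq0 hPhiRe); rewrite nvi_mul. Qed.

Lemma mul_dquot_rotPhi (s : C) : s * dquot rotPhi s = rotPhi s - 1.
Proof.
rewrite /dquot rotPhi0; have [->|s0] := eqVneq s 0;
  first by rewrite mul0r rotPhi0 subrr.
by rewrite mulrC divfK.
Qed.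

Lemma sharp_g0 : sharp_g 0 = 1.
Proof. by rewrite /sharp_g lform0 seg_same cexp0. Qed.

Lemma sharp_g_neq0 z : sharp_g z != 0.
Proof. exact: cexp_neq0. Qed.

Lemma sharp_outer_is_derive (s : C) : nv s < 1 ->
  is_derive s 1 (fun s => cexp (seg (dquot rotPhi) 0 s))
    (cexp (seg (dquot rotPhi) 0 s) * dquot rotPhi s).
Proof.
move=> s1; apply: (@cder_comp _ _ (seg (dquot rotPhi) 0) cexp);
  last exact: is_derive_cexp.
by apply: disk_primitive => // z; exact: (dquot_derivable_disk rotPhi_derivable).
Qed.

Lemma sharp_g_hol : hol Omega sharp_g.
Proof.
move=> z /lform_lt1 z1; apply: (@differentiable_comp _ _ _ _ lform (fun s =>
  cexp (seg (dquot rotPhi) 0 s))).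
  exact: differentiable_lform.
by apply/derivable1_diffP; have [] := sharp_outer_is_derive z1.
Qed.

(** The differential equation that defines the extremal function. *)
Lemma sharp_g_radial z : Omega z ->
  sharp_g z + 'D_z sharp_g z = sharp_g z * rotPhi (lform z).
Proof.
move=> /lform_lt1 z1.
have [_ E] := cder_comp (is_derive_lform z z) (sharp_outer_is_derive z1).
apply: (etrans (congr1 (fun x => sharp_g z + x) E)).
have alg (g d l p : C) : l * d = p - 1 -> g + g * d * l = g * p.
  by move=> H; have -> : p = 1 + l * d by [rewrite H; ring]; ring.
exact: (alg _ _ _ _ (mul_dquot_rotPhi (lform z))).
Qed.

(** A kernel vector u of the Jacobian is a multiple of z, and z is an
    eigenvector for the eigenvalue g Phi(i l(z)), which does not vanish. *)
Lemma sharp_jacobian_unit z : Omega z -> cjacobian (times_id sharp_g) z \in unitmx.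
Proof.
move=> Oz; rewrite unitmxE unitfE -det_tr; apply/det0P => -[v v0 hv].
have dg := sharp_g_hol Oz.
have Jv : cjacobian (times_id sharp_g) z *m v^T = 0.
  by apply: trmx_inj; rewrite trmx_mul trmxK hv trmx0.
pose u : V := v^T.
have H := esym (cjacobian_times_id u dg); rewrite [RHS]Jv in H.
pose c := - ((sharp_g z)^-1 * 'D_u sharp_g z).
have uE : u = c *: z.
  apply: (scalerI (sharp_g_neq0 z));
    rewrite scalerA /c mulrN mulrA mulfV ?sharp_g_neq0// mul1r.
  by rewrite scaleNr; apply/eqP; rewrite -subr_eq0 opprK addrC H.
have H2 := cjacobian_times_id (c *: z) dg.
rewrite -uE [LHS]Jv uE (derive_scale c z dg) scalerA -scalerDl in H2.
have E : c * 'D_z sharp_g z + sharp_g z * c = c * (sharp_g z * rotPhi (lform z)).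
  apply: (etrans _ (congr1 (fun x => c * x) (sharp_g_radial Oz))).
  by rewrite mulrDr addrC [_ * c]mulrC.
have gP0 : sharp_g z * rotPhi (lform z) != 0.
  by apply: mulf_neq0; [exact: sharp_g_neq0|exact/rotPhi_neq0/lform_lt1].
move/esym/eqP: H2; rewrite E scaler_eq0 (mulf_eq0 c) (negbTE gP0) orbF => H3.
have u0 : u = 0.
  by rewrite uE; move: H3 => /orP[] /eqP ->; rewrite ?scale0r ?scaler0.
by move/eqP: v0; apply; rewrite -[v]trmxK -/u u0 trmx0.
Qed.

Lemma sharp_invjac z : Omega z ->
  invjac_mul (times_id sharp_g) z = (rotPhi (lform z))^-1 *: z.
Proof.
move=> Oz; have [->|z0] := eqVneq z 0.
  by rewrite /invjac_mul /times_id !scaler0 mulmx0.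
have [s0 ->] := invjac_times_id (sharp_g_hol Oz) z0 (sharp_jacobian_unit Oz).
congr (_ *: _); apply: (etrans (congr1 (fun x =>
  sharp_g z / x) (sharp_g_radial Oz))).
by rewrite invfM mulrA mulfV ?sharp_g_neq0// mul1r.
Qed.

Lemma inv_rotPhi_is_derive z v :
  Omega z -> is_derive z v (fun w => (rotPhi (lform w))^-1)
  (- ('D_1 Phi ('i%C * lform z) * ('i%C * 1) * lform v) / rotPhi (lform z) ^+ 2).
Proof.
move=> Oz; apply: cderV; last exact/rotPhi_neq0/lform_lt1.
exact: (cder_comp (is_derive_lform z v) (rotPhi_is_derive (lform_lt1 Oz))).
Qed.

Lemma inv_rotPhi_differentiable z : Omega z ->
  differentiable (fun w => (rotPhi (lform w))^-1) z.
Proof.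
move=> Oz; apply: differentiableV; last exact/rotPhi_neq0/lform_lt1.
apply: (@differentiable_comp _ _ _ _ lform rotPhi);
  first exact: differentiable_lform.
by apply/derivable1_diffP/rotPhi_derivable/lform_lt1.
Qed.

Lemma sharp_class_M : class_M Omega rho Phi (invjac_mul (times_id sharp_g)).
Proof.
have O0 := Omega0 hrho.
split.
- move=> z Oz; have [r r0 hr] := (open_nvP Omega).1 oO z Oz.
  pose f (k : 'I_n) (w : V) : V := ((rotPhi (lform w))^-1 * w k 0) *: stdvec k.
  apply: (@differentiable_near _ _ _ (\sum_(k < n) f k)).
    apply: differentiable_sum => k; apply: differentiableZl.
    apply: differentiableM; first exact: inv_rotPhi_differentiable.
    exact: differentiable_coord.
  exists r => // h /hr Oh; rewrite sharp_invjac//.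
  rewrite fct_sumE.
  apply: (etrans _ (congr1 (fun x =>
    (rotPhi (lform (z + h)))^-1 *: x) (esym (cV_sum_stdvec (z + h))))).
  rewrite scaler_sumr.
  by apply: eq_bigr => k _; rewrite scalerA.
- by rewrite /invjac_mul /times_id scaler0 mulmx0.
- apply/matrixP => i k; rewrite !mxE.
  have H := cderM (inv_rotPhi_is_derive (stdvec k) O0) (is_derive_coord i 0
    (stdvec k)).
  have E x : Omega x -> (rotPhi (lform x))^-1 * x i 0 = invjac_mul (times_id
    sharp_g) x i 0.
    by move=> Ox; rewrite sharp_invjac// mxE.
  have [_ H2] := @near_open R n Omega oO (fun x => (rotPhi (lform x))^-1 * x i 0)
    (fun x => invjac_mul (times_id sharp_g) x i 0) 0 _ _ O0 E H.
  apply: (etrans H2); rewrite lform0 rotPhi0 invr1 mul1r !mxE mulr0 add0r.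
  by rewrite andbT.
- move=> z Oz z0; rewrite sharp_invjac// (ratio_line hrho hC1 _ z0) invrK.
  exists ('i%C * lform z) => //; apply/unit_diskP; rewrite nvi_mul;
    exact: lform_lt1.
Qed.

(** [line_coefs] for w(s) = i s. *)
Lemma sharp_coefs :
  'D_zs sharp_g 0 = 'D_1 Phi 0 * 'i%C /\
  'D_zs ('D_zs sharp_g) 0 / 2 =
     (('D_1 Phi 0 * 'i%C) ^+ 2 + 'D_1 ('D_1 Phi) 0 / 2 * 'i%C ^+ 2) / 2.
Proof.
have hw (s : C) : is_derive s 1 (fun s : C => 'i%C * s) 'i%C.
  by apply: is_derive_eq (cderZ 'i%C (cder_id s)) _; rewrite mulr1.
have D1 : 'D_1 (fun s : C => 'i%C * s) = (fun=> 'i%C).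
  by apply/funext => s; have [] := hw s.
have [e1 e2] := @line_coefs R n Omega rho oO hrho sharp_g zs Phi (fun s =>
  'i%C * s) sharp_g_hol zs1 sharp_g0
  (Phi_derivable hPhi) (fun s _ => @ex_derive _ _ _ _ _ _ _ (hw s))
  (fun s s1 => eq_ind_r (fun x => x < 1) s1 (nvi_mul s)) (mulr0 _) hPhi0
  (fun s s1 => etrans (sharp_g_radial (line_in_Omega hrho zs1 s1))
     (congr1 (fun x => sharp_g (s *: zs) * rotPhi x) (lform_line s))).
have {}D1 : 'D_1 (fun s : C => 'i%C * s) 0 = 'i%C /\ 'D_1 ('D_1 (fun s :
  C => 'i%C * s)) 0 = 0.
  split; first by have [] := hw 0.
  by rewrite D1; have [_ H0] := cder_cst ('i%C : C) (0 : C) 1.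
have [d1 d2] := D1; have e1' := etrans e1 (congr1 (fun x => 'D_1 Phi 0 * x) d1).
have alg (X A p q W W2 : C) : A = p * 'i%C -> W = 'i%C -> W2 = 0 ->
    X = (A ^+ 2 + q * W ^+ 2 + p * (W2 / 2)) / 2 ->
    X = ((p * 'i%C) ^+ 2 + q * 'i%C ^+ 2) / 2.
  by move=> -> -> -> ->; rewrite mul0r mulr0 addr0.
by split; [exact: e1'|exact: (alg _ _ _ _ _ _ e1' d1 d2 e2)].
Qed.

End Sharp.

(** * The sharp coefficient bound *)
Lemma derive1_funE (R : realType) (f : R[i] -> R[i]) : derive1 f = 'D_1 f.
Proof. by apply/funext => x; exact: derive1E. Qed.

Lemma derive1n2E (R : realType) (f : R[i] -> R[i]) (x : R[i]) :
  derive1n 2 f x = 'D_1 ('D_1 f) x.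
Proof.
have -> : derive1n 2 f x = derive1 (derive1 f) x by [].
by rewrite derive1_funE derive1_funE.
Qed.

Unset Implicit Arguments.

Theorem theorem3p1 (R : realType) (n : nat) (hn : (0 < n)%N)
    (Omega : set 'cV[R[i]]_n) (rho : 'cV[R[i]]_n -> R) (Phi : R[i] -> R[i])
    (hOmega : bounded_starlike_circular_domain Omega)
    (hOmega0 : Omega 0)
    (hrho : minkowski_functional Omega rho)
    (hrhoC1 : C1_off_origin rho)
    (hPhi : biholomorphic_onto_image unit_disk Phi)
    (hPhi0 : Phi 0 = 1)
    (hPhi1 : 0 < derive1 Phi 0)
    (hPhi2 : derive1n 2 Phi 0 \is Num.real)
    (hPhiRe : forall zeta, unit_disk zeta -> 0 < complex.Re (Phi zeta))
    (hPhi12 : 2 * derive1 Phi 0 <= `|derive1n 2 Phi 0 + 2 * (derive1 Phi 0) ^+ 2|) :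
  let admissible (g : 'cV[R[i]]_n -> R[i]) :=
    [/\ holomorphic_on Omega g, g 0 = 1,
        forall z, Omega z -> cjacobian (times_id g) z \in unitmx &
        class_M Omega rho Phi (invjac_mul (times_id g))] in
  let lhs (g : 'cV[R[i]]_n -> R[i]) (z : 'cV[R[i]]_n) :=
    `| (2 * wirtinger_mul rho z
          ((3`!%:R * (rho z)%:C ^+ 3)^-1 *: frechet_pow 3 (times_id g) 0 z)) ^+ 2
     - (2 * wirtinger_mul rho z
          ((2`!%:R * (rho z)%:C ^+ 2)^-1 *: frechet_pow 2 (times_id g) 0 z)) ^+ 2 | in
  let bound :=
    (derive1 Phi 0) ^+ 2
    + (derive1 Phi 0) ^+ 2 / 4
      * (1 / 2 * (derive1n 2 Phi 0 / derive1 Phi 0) + derive1 Phi 0) ^+ 2 in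
  (forall g, admissible g -> forall z, Omega z -> z != 0 -> lhs g z <= bound) /\
  (exists g, admissible g /\
     exists z, [/\ Omega z, z != 0 & lhs g z = bound]).
Proof.
move=> admissible lhs bound.
have [oO _ _ _ _] := hOmega.
have P1E : derive1 Phi 0 = 'D_1 Phi 0 := derive1E Phi 0.
have P2E : derive1n 2 Phi 0 = 'D_1 ('D_1 Phi) 0 := derive1n2E Phi 0.
have [p p0 pE] := gt0cP hPhi1.
have /complex_realP[q qE] := hPhi2.
have P1p : 'D_1 Phi 0 = p%:C := etrans (esym P1E) pE.
have P2q : 'D_1 ('D_1 Phi) 0 = q%:C := etrans (esym P2E) qE.
have sE : (q + 2 * p ^+ 2)%:C = q%:C + 2 * p%:C ^+ 2 :> R[i].
  by rewrite rmorphD rmorphM rmorphXn /= realC2.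
have bE : (p ^+ 2 + (q + 2 * p ^+ 2) ^+ 2 / 16)%:C =
    p%:C ^+ 2 + (q%:C + 2 * p%:C ^+ 2) ^+ 2 / 16 :> R[i].
  rewrite rmorphD rmorphXn rmorphM fmorphV rmorphXn /= sE.
  by congr (_ + _ / _); rewrite (rmorph_nat (real_complex R)).
have pq : 2 * p <= `|q + 2 * p ^+ 2|.
  move: hPhi12; rewrite pE qE -sE -realC2 -rmorphM nvE nv_real.
  by rewrite lecR.
have boundE : bound = (p ^+ 2 + (q + 2 * p ^+ 2) ^+ 2 / 16)%:C.
  have pC : p%:C != 0 :> R[i] by rewrite -nv_gt0 nv_real gtr0_norm.
  rewrite /bound pE qE bE.
  by field.
have lhsE g z : hol Omega g -> z != 0 ->
    let z0 := (rho z)%:C^-1 *: z in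
    lhs g z = (nv (('D_z0 ('D_z0 g) 0 / 2) ^+ 2 - ('D_z0 g 0) ^+ 2))%:C.
  move=> hg z0 z1; have [e1 e2] := lhs_line oO hrho hrhoC1 hg z0.
  apply: (etrans _ (nvE _)).
  exact: (congr2 (fun x y : R[i] => `|x ^+ 2 - y ^+ 2|) e1 e2).
have normalized := minkowski_normalize hrho.
split.
- move=> g [hg g0 hJ hM] z Oz z0; rewrite (lhsE g z hg z0) boundE lecR.
  set z1 := (rho z)%:C^-1 *: z.
  have [w [dw wU w0 rel]] := admissible_subordinate oO hrho hrhoC1 hPhi hPhi0
    hPhiRe hg g0 (normalized z z0) hJ hM.
  have dPhi := Phi_derivable hPhi.
  have [e1 e2] := line_coefs oO hrho hg (normalized z z0) g0 dPhi dw wU w0 hPhi0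
    rel.
  have [c1 c2] := schwarz_coefs dw (fun s s1 => ltW (wU s s1)) w0.
  have alg (X A P Q c d : R[i]) : P = p%:C -> Q = q%:C ->
      X = (A ^+ 2 + Q / 2 * c ^+ 2 + P * d) / 2 ->
      X = (A ^+ 2 + q%:C / 2 * c ^+ 2 + p%:C * d) / 2 by move=> -> ->.
  have e1' := etrans e1 (congr1 (fun x => x * 'D_1 w 0) P1p).
  exact: (coef_bound p0 pq c1 c2 e1' (alg _ _ _ _ _ _ P1p P2q e2)).
- have [zs zs1 [zsj zsmax]] := extremal_vector hrho (Ordinal hn).
  pose g := sharp_g Phi (Ordinal hn) zs.
  have hg : hol Omega g := sharp_g_hol hrho hPhi zsj zsmax.
  exists g; split.
    split; [exact: hg|exact: sharp_g0| |].
      by move=> z; exact: (sharp_jacobian_unit hrho hPhi hPhi0 hPhiRe zsj zsmax).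
    exact: (sharp_class_M oO hrho hrhoC1 hPhi hPhi0 hPhiRe zsj zsmax).
  have zs0 : zs != 0.
    by apply/eqP => E; move: zsj; rewrite E mxE eqxx.
  (* any multiple of zs inside Omega will do *)
  pose z : 'cV[R[i]]_n := (2^-1 : R)%:C *: zs.
  have rz : rho z = 2^-1.
    by rewrite (minkowski_scale hrho) zs1 mulr1 nv_real ger0_norm ?invr_ge0.
  have hc : (2^-1 : R)%:C != 0 :> R[i] by rewrite -nv_gt0 nv_real gtr0_norm
    ?invr_gt0.
  have z0 : z != 0 by rewrite scaler_eq0 negb_or hc zs0.
  have z1 : rho z < 1 by rewrite rz invf_lt1 ?ltr1n// ltr0n.
  have Oz : Omega z := (minkowski_mem hrho z).2 z1.
  exists z; split; [exact: Oz|exact: z0|].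
  rewrite (lhsE g z hg z0) boundE.
  have zE : (rho z)%:C^-1 *: z = zs.
    by rewrite rz /z scalerA mulVf ?scale1r.
  have [e1 e2] := sharp_coefs oO hrho hPhi hPhi0 zs1 zsj zsmax.
  have alg (A B P Q : R[i]) : P = p%:C -> Q = q%:C ->
      A = P * 'i%C -> B = ((P * 'i%C) ^+ 2 + Q / 2 * 'i%C ^+ 2) / 2 ->
      nv (B ^+ 2 - A ^+ 2) = p ^+ 2 + (q + 2 * p ^+ 2) ^+ 2 / 16.
    move=> -> -> -> ->.
    have poly (a b i : R[i]) : (((a * i) ^+ 2 + b / 2 * i ^+ 2) / 2) ^+ 2 - (a *
      i) ^+ 2 =
        ((a ^+ 2 + b / 2) * i ^+ 2 / 2) ^+ 2 - a ^+ 2 * i ^+ 2 by field.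
    rewrite poly sqr_i.
    have -> : ((p%:C ^+ 2 + q%:C / 2) * -1 / 2) ^+ 2 - p%:C ^+ 2 * -1 =
        (p ^+ 2 + (q + 2 * p ^+ 2) ^+ 2 / 16)%:C :> R[i].
      by rewrite bE; field.
    rewrite nv_real; apply: ger0_norm; apply: addr_ge0; first exact: sqr_ge0.
    by apply: divr_ge0; [exact: sqr_ge0|rewrite ler0n].
  rewrite zE; apply: (congr1 (real_complex R)); exact: (alg _ _ _ _ P1p P2q e1 e2).
Qed.
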